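(* Restricted to dynamic network games $(G,R)$ in which $R$ contains no movement rule, the dynamic safety problem is in EXPTIME (input size: size of the initial network plus size of $R$).
   Context: A network is $G=(V,E,A,S,(P_a)_{a\in\Sigma})$: finite node set $V$, undirected edges $E$, active nodes $A\subseteq V$, strong nodes $S\subseteq A$, and a partition $(P_a)_{a\in\Sigma}$ of $V$ into label classes; weak nodes are those in $A\setminus S$; the network is connected if the subgraph induced by $A$ is connected. In a dynamic network game $(G,R)$ ($G$ initial network, $R$ finite rule set), Destructor and Constructor alternate, Destructor first, both may skip. Destructor deletes one weak node. Constructor applies one rule of $R$: relabeling rules $\langle a,b\to c,d\rangle$ (relabel adjacent active nodes labeled $a,b$ to $c,d$; possibly several relabelings per turn), movement rules $\langle a\xrightarrow{\text{move}}b\rangle$ (for adjacent $u\in S\cap P_a$, $v\in P_b\setminus S$: $S:=(S\setminus\{u\})\cup\{v\}$, $A:=A\cup\{v\}$), and creation rules $\langle a_1,\dots,a_n\xrightarrow{\text{create}(c)}a'_1,\dots,a'_n\rangle$ (choose distinct strong $u_i$ labeled $a_i$, add a new active node labeled $c$ adjacent to all $u_i$, which may be weak or, for strong creation rules, strong; relabel $u_i$ to $a'_i$). The dynamic safety problem: given $(G,R)$ with $G$ connected, does Constructor have a strategy guaranteeing that every network in the play is connected? *)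

(* Defs.v *)
From Stdlib Require Import List Arith PeanoNat Relations Bool.
Import ListNotations.
Open Scope bool_scope.
Set Implicit Arguments.

(* Networks.  V = the (duplicate-free) list [nodes]; node identifiers   *)
(* are naturals; labels are naturals (the alphabet Sigma is the set of  *)
(* labels occurring).  The label partition (P_a) is the function [lab]. *)
(* Only the values of edge/act/strong/lab on nodes of V are relevant.   *)
Record network := mkNet {
  nodes  : list nat;
  edge   : nat -> nat -> bool;
  act    : nat -> bool;
  strong : nat -> bool;
  lab    : nat -> nat }.

Definition inV (N : network) (v : nat) : Prop := In v (nodes N).

Definition adj (N : network) (u v : nat) : Prop :=
  inV N u /\ inV N v /\ u <> v /\ (edge N u v || edge N v u) = true.

Definition isActive (N : network) (v : nat) : Prop := inV N v /\ act N v = true.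
(* S is a subset of A by construction *)
Definition isStrong (N : network) (v : nat) : Prop := isActive N v /\ strong N v = true.
Definition isWeak   (N : network) (v : nat) : Prop := isActive N v /\ strong N v = false.

Definition active_adj (N : network) (u v : nat) : Prop :=
  adj N u v /\ isActive N u /\ isActive N v.
Definition connected (N : network) : Prop :=
  forall u v, isActive N u -> isActive N v -> clos_refl_trans nat (active_adj N) u v.

Inductive rule :=
| Relabel (a b c d : nat)
| Move (a b : nat)
| Create (pre_post : list (nat * nat)) (c : nat) (strongc : bool).
    (* <a_1..a_n -create(c)-> a'_1..a'_n>, pre_post = [(a_i,a'_i)],
       strongc = true for strong creation rules *)

Definition is_move (r : rule) : Prop := match r with Move _ _ => True | _ => False end.
Definition no_move (R : list rule) : Prop := forall r, In r R -> ~ is_move r.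
Definition wf_rule (r : rule) : Prop :=
  match r with Create l _ _ => l <> [] | _ => True end.
Definition wf_rules (R : list rule) : Prop := forall r, In r R -> wf_rule r.
Definition wf_network (N : network) : Prop := NoDup (nodes N).

Definition relab (l : nat -> nat) (ups : list (nat * nat)) : nat -> nat :=
  fun x => match find (fun p => Nat.eqb (fst p) x) ups with
           | Some p => snd p | None => l x end.

Definition fresh (N : network) : nat := S (list_max (nodes N)).

Inductive dmove (N : network) : network -> Prop :=
| d_skip : dmove N N
| d_delete v : isWeak N v ->
    dmove N (mkNet (filter (fun x => negb (Nat.eqb x v)) (nodes N))
                   (edge N) (act N) (strong N) (lab N)).

Inductive cmove (R : list rule) (N : network) : network -> Prop :=
| c_skip : cmove R N N
| c_relabel a b c d (ps : list (nat * nat)) :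
    In (Relabel a b c d) R ->
    ps <> [] ->
    NoDup (flat_map (fun p => [fst p; snd p]) ps) ->
    (forall p, In p ps ->
       adj N (fst p) (snd p) /\ isActive N (fst p) /\ isActive N (snd p) /\
       lab N (fst p) = a /\ lab N (snd p) = b) ->
    cmove R N (mkNet (nodes N) (edge N) (act N) (strong N)
                     (relab (lab N) (flat_map (fun p => [(fst p, c); (snd p, d)]) ps)))
| c_move a b u v :
    In (Move a b) R ->
    adj N u v -> isStrong N u -> lab N u = a ->
    inV N v -> ~ isStrong N v -> lab N v = b ->
    cmove R N (mkNet (nodes N) (edge N)
                     (fun x => if Nat.eqb x v then true else act N x)
                     (fun x => if Nat.eqb x v then true
                               else if Nat.eqb x u then false else strong N x)
                     (lab N))
| c_create (pp : list (nat * nat)) c s (us : list nat) :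
    In (Create pp c s) R ->
    length us = length pp ->
    NoDup us ->
    (forall i u, nth_error us i = Some u ->
       isStrong N u /\ exists q, nth_error pp i = Some q /\ lab N u = fst q) ->
    let z := fresh N in
    cmove R N (mkNet (z :: nodes N)
                     (fun x y => if Nat.eqb x z then existsb (Nat.eqb y) us
                                 else if Nat.eqb y z then existsb (Nat.eqb x) us
                                 else edge N x y)
                     (fun x => if Nat.eqb x z then true else act N x)
                     (fun x => if Nat.eqb x z then s else strong N x)
                     (relab (lab N) ((z, c) :: combine us (map snd pp)))).

(* Constructor can keep every network of the play connected
   (safety game, Destructor moves first): coinductive winning region. *)
CoInductive safeD (R : list rule) : network -> Prop :=
| safeD_intro N : connected N -> (forall N', dmove N N' -> safeC R N') -> safeD R N
with safeC (R : list rule) : network -> Prop :=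
| safeC_intro N N' : connected N -> cmove R N N' -> safeD R N' -> safeC R N.

Definition dynamically_safe (G : network) (R : list rule) : Prop := safeD R G.

Inductive dir := GoL | GoR | Stay.

Record TM := mkTM {
  tm_states : nat;
  tm_start  : nat;
  tm_accept : nat;
  tm_reject : nat;
  tm_delta  : nat -> option bool -> nat * option bool * dir;
  tm_ok : tm_start < tm_states /\ tm_accept < tm_states /\
          tm_reject < tm_states /\ tm_accept <> tm_reject /\
          forall s x, s < tm_states -> fst (fst (tm_delta s x)) < tm_states }.

(* configuration: state, left tape (reversed), scanned symbol, right tape *)
Definition config : Type := (nat * list (option bool) * option bool * list (option bool))%type.

Definition tm_step (M : TM) (cf : config) : config :=
  let '(q, l, h, r) := cf in
  if Nat.eqb q (tm_accept M) || Nat.eqb q (tm_reject M) then cf else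
  let '(q', w, d) := tm_delta M q h in
  match d with
  | GoL => match l with [] => (q', [], w, r) | x :: l' => (q', l', x, w :: r) end
  | GoR => match r with [] => (q', w :: l, None, []) | x :: r' => (q', w :: l, x, r') end
  | Stay => (q', l, w, r)
  end.

Definition tm_init (M : TM) (w : list bool) : config :=
  match w with
  | [] => (tm_start M, [], None, [])
  | b :: w' => (tm_start M, [], Some b, map Some w')
  end.

Definition cf_state (cf : config) : nat := let '(q, _, _, _) := cf in q.

Definition tm_decides_within (M : TM) (w : list bool) (t : nat) (ans : bool) : Prop :=
  exists k, k <= t /\
    cf_state (Nat.iter k (tm_step M) (tm_init M w)) =
      (if ans then tm_accept M else tm_reject M).

Fixpoint bits_aux (fuel n : nat) : list bool :=
  match fuel with
  | 0 => []
  | S f => if Nat.eqb n 0 then [] else Nat.odd n :: bits_aux f (Nat.div2 n)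
  end.
(* self-delimiting binary encoding of a natural number *)
Definition enc_nat (n : nat) : list bool :=
  flat_map (fun b => [true; b]) (bits_aux n n) ++ [false].

Definition enc_list {A} (e : A -> list bool) (l : list A) : list bool :=
  flat_map (fun x => true :: e x) l ++ [false].

Definition enc_network (N : network) : list bool :=
  let vs := nodes N in
  enc_nat (length vs) ++
  flat_map (fun v => act N v :: strong N v :: enc_nat (lab N v)) vs ++
  flat_map (fun u => map (fun v => edge N u v || edge N v u) vs) vs.

Definition enc_rule (r : rule) : list bool :=
  match r with
  | Relabel a b c d => [false; false] ++ enc_nat a ++ enc_nat b ++ enc_nat c ++ enc_nat d
  | Move a b => [false; true] ++ enc_nat a ++ enc_nat b
  | Create pp c s =>
      [true; s] ++ enc_list (fun p => enc_nat (fst p) ++ enc_nat (snd p)) pp ++ enc_nat c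
  end.

Definition encode (G : network) (R : list rule) : list bool :=
  enc_network G ++ enc_list enc_rule R.

(* Main.v *)
Require Import Defs.
From Stdlib Require Import List Arith PeanoNat Lia Bool Relations Classical FunctionalExtensionality.
Import ListNotations.
Set Implicit Arguments.

(** Destructor never gains by skipping, because Constructor can skip in return; so
    Destructor may be assumed to delete a weak node in every round.  Then a creation
    only refills the place of a deleted node, and since without movement rules
    inactive nodes stay inactive, every position of the play fits into as many
    slots as the initial network has nodes.  There are at most [2 ^ p(L)] such
    positions, for a polynomial [p] in the input length [L].  The set of positions
    lost by Constructor is computed by iterating its defining inductive step [M]
    times over a table indexed by all numbers below [M = 2 ^ ((L + 2) ^ 3)].

    The inductive step is a formula with quantifiers bounded by [M] over arithmetic
    on position codes, so its evaluation takes time polynomial in [M].  It is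
    evaluated by a machine with unary registers and two bit arrays, which is laid
    out on the tape in columns: a register is the number of marked columns of its
    track, and reading an array at a register means walking to the first unmarked
    column. *)

(** * Structured tape programs *)

(** Creation picks names above all present ones, so no finite set of networks is at hand. A code
    forgets names, and every statement about the table goes through [Codes], which relates one code
    to many networks. Two facts about the computed table are proved: a marked code only codes
    networks lost by Constructor, by induction on the updates, and the networks with an unmarked
    code satisfy the coinductive clause of [safeD]. Numbers that code no network may be marked or
    not.

    One machine must serve all inputs, so the rules cannot be compiled into it. The formula is a
    fixed expression that reads the rules from the input array; its nesting of loops, hence the
    degree of the running time in [M], is a constant. Cuts, pairings for relabelings, tuples of
    creating nodes and successor positions are all digit strings in base [B], so the same bound [M]
    serves every quantifier over such objects. Unary registers are affordable because a factor [M]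
    per arithmetic operation is still polynomial in [M]. *)

Definition sym := option bool.

Inductive tcmd :=
| Act (g : sym -> sym * dir)
| Sq (a b : tcmd)
| IfS (p : sym -> bool) (a b : tcmd)
| WhileS (p : sym -> bool) (a : tcmd).

Definition upd {A} (f : nat -> A) (k : nat) (v : A) : nat -> A :=
  fun x => if Nat.eqb x k then v else f x.

(** [pred 0 = 0] agrees with [tm_step], which keeps the head in place when it moves left at the left
    end. *)
Definition mv (d : dir) (p : nat) : nat :=
  match d with GoL => pred p | GoR => S p | Stay => p end.

Definition tape := (nat -> sym)%type.

(** The last index is the exact number of machine steps: a test is a transition of its own and costs
    one step, sequencing is free. *)
Inductive exec : tcmd -> tape -> nat -> tape -> nat -> nat -> Prop :=
| ex_act g f p :
    exec (Act g) f p (upd f p (fst (g (f p)))) (mv (snd (g (f p))) p) 1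
| ex_seq a b f p f1 p1 f2 p2 t1 t2 :
    exec a f p f1 p1 t1 -> exec b f1 p1 f2 p2 t2 ->
    exec (Sq a b) f p f2 p2 (t1 + t2)
| ex_if_true c a b f p f1 p1 t :
    c (f p) = true -> exec a f p f1 p1 t -> exec (IfS c a b) f p f1 p1 (S t)
| ex_if_false c a b f p f1 p1 t :
    c (f p) = false -> exec b f p f1 p1 t -> exec (IfS c a b) f p f1 p1 (S t)
| ex_while_end c a f p :
    c (f p) = false -> exec (WhileS c a) f p f p 1
| ex_while_step c a f p f1 p1 f2 p2 t1 t2 :
    c (f p) = true -> exec a f p f1 p1 t1 -> exec (WhileS c a) f1 p1 f2 p2 t2 ->
    exec (WhileS c a) f p f2 p2 (S (t1 + t2)).

Fixpoint csize (m : tcmd) : nat :=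
  match m with
  | Act _ => 1
  | Sq a b => csize a + csize b
  | IfS _ a b => S (csize a + csize b)
  | WhileS _ a => S (csize a)
  end.

Definition trans := (sym -> nat * sym * dir)%type.

(** The exit state is passed in, so no jump has to be patched afterwards. The code of [m] occupies
    the states from [base] to [base + csize m - 1]; a test becomes a transition that writes back the
    scanned symbol and stays. *)
Fixpoint assemble (m : tcmd) (base exit : nat) : list trans :=
  match m with
  | Act g => [fun x => (exit, fst (g x), snd (g x))]
  | Sq a b => assemble a base (base + csize a) ++ assemble b (base + csize a) exit
  | IfS p a b =>
      (fun x => (if p x then S base else S base + csize a, x, Stay))
        :: assemble a (S base) exit ++ assemble b (S base + csize a) exit
  | WhileS p a =>
      (fun x => (if p x then S base else exit, x, Stay)) :: assemble a (S base) base
  end.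

Lemma csize_pos m : 0 < csize m.
Proof. induction m; simpl; lia. Qed.

Lemma assemble_length m : forall base exit, length (assemble m base exit) = csize m.
Proof.
  induction m; intros; simpl; rewrite ?length_app, ?IHm, ?IHm1, ?IHm2; lia.
Qed.

Lemma assemble_target m : forall base exit tr x, In tr (assemble m base exit) ->
  fst (fst (tr x)) = exit \/ (base <= fst (fst (tr x)) < base + csize m).
Proof.
  induction m as [g|a IHa b IHb|p a IHa b IHb|p a IHa]; intros base exit tr x H; simpl in *.
  - destruct H as [<-|[]]; simpl; auto.
  - pose proof (csize_pos b). apply in_app_or in H as [H|H].
    + apply IHa with (x:=x) in H. lia.
    + apply IHb with (x:=x) in H. lia.
  - pose proof (csize_pos a); pose proof (csize_pos b).
    destruct H as [<-|H]; simpl; [destruct (p x); lia|].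
    apply in_app_or in H as [H|H].
    + apply IHa with (x:=x) in H. lia.
    + apply IHb with (x:=x) in H. lia.
  - pose proof (csize_pos a).
    destruct H as [<-|H]; simpl; [destruct (p x); lia|].
    apply IHa with (x:=x) in H. lia.
Qed.

(* After the program, state [csize m] accepts iff the scanned cell is [Some true]. *)
Definition machine_delta (m : tcmd) (s : nat) (x : sym) : nat * sym * dir :=
  match nth_error (assemble m 0 (csize m)) s with
  | Some tr => tr x
  | None => (match x with Some true => S (csize m) | _ => S (S (csize m)) end, x, Stay)
  end.

Lemma machine_ok m :
  0 < S (S (S (csize m))) /\ S (csize m) < S (S (S (csize m))) /\
  S (S (csize m)) < S (S (S (csize m))) /\ S (csize m) <> S (S (csize m)) /\
  forall s x, s < S (S (S (csize m))) ->
    fst (fst (machine_delta m s x)) < S (S (S (csize m))).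
Proof.
  repeat split; try lia.
  intros s x Hs. unfold machine_delta.
  destruct (nth_error (assemble m 0 (csize m)) s) eqn:E.
  - apply nth_error_In in E. apply assemble_target with (x:=x) in E. lia.
  - destruct x as [[|]|]; simpl; lia.
Qed.

Definition machine (m : tcmd) : TM :=
  @mkTM (S (S (S (csize m)))) 0 (S (csize m)) (S (S (csize m))) (machine_delta m) (machine_ok m).

(** The right list may be short, since missing cells read as blank. The left list has length exactly
    [p], so that the left end of the tape is respected. *)
Definition tape_rep (l : list sym) (h : sym) (r : list sym) (f : tape) (p : nat) : Prop :=
  length l = p /\ (forall i, i < p -> nth i l None = f (p - 1 - i)) /\
  h = f p /\ (forall i, nth i r None = f (S p + i)).

(** The code of [m] is a segment of the whole program. Leaving [base] and [exit] arbitrary is what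
    lets the simulation be proved by induction on [exec]. *)
Definition placed (code : list trans) (base : nat) (m : tcmd) (exit : nat) : Prop :=
  forall i tr, nth_error (assemble m base exit) i = Some tr ->
    nth_error code (base + i) = Some tr.

Lemma nth_error_app_l {A} (l1 l2 : list A) i x :
  nth_error l1 i = Some x -> nth_error (l1 ++ l2) i = Some x.
Proof.
  intros H. rewrite nth_error_app1; auto. apply nth_error_Some. congruence.
Qed.

Lemma tm_step_rep m q l h r f p q' w d :
  q < csize m -> machine_delta m q h = (q', w, d) -> tape_rep l h r f p ->
  exists l' h' r', tm_step (machine m) (q, l, h, r) = (q', l', h', r') /\
    tape_rep l' h' r' (upd f p w) (mv d p).
Proof.
  intros Hq Hd (Hl & Hli & Hh & Hr).
  unfold tm_step; simpl.
  assert ((q =? S (csize m)) = false) as -> by (apply Nat.eqb_neq; lia).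
  assert ((q =? S (S (csize m))) = false) as -> by (apply Nat.eqb_neq; lia).
  simpl. rewrite Hd. unfold tape_rep, upd. destruct d; simpl.
  - destruct l as [|y l'].
    + simpl in Hl; subst p. do 3 eexists; split; [reflexivity|]. simpl.
      repeat split; auto; try lia.
    + simpl in Hl. destruct p as [|p]; [lia|]. do 3 eexists; split; [reflexivity|].
      simpl. repeat split; try lia.
      * intros i Hi. specialize (Hli (S i) ltac:(lia)). simpl in Hli. rewrite Hli.
        destruct (Nat.eqb_spec (p - 1 - i) (S p)); [lia|]. f_equal; lia.
      * destruct (Nat.eqb_spec p (S p)); [lia|].
        specialize (Hli 0 ltac:(lia)). simpl in Hli. rewrite Hli; f_equal; lia.
      * intros [|i]; simpl.
        -- rewrite Nat.add_0_r. rewrite Nat.eqb_refl. reflexivity.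
        -- destruct (Nat.eqb_spec (p + S i) p); [lia|]. rewrite Hr; f_equal; lia.
  - assert (forall i, nth i (w :: l) None =
       (if (S p - 1 - i =? p) then w else f (S p - 1 - i)) \/ i >= S p) as HL.
    { intros [|i]; simpl.
      - left. rewrite !Nat.sub_0_r, Nat.eqb_refl. reflexivity.
      - destruct (Nat.lt_ge_cases i p); [left|right; lia].
        destruct (Nat.eqb_spec (p - 0 - S i) p); [lia|].
        rewrite Hli by lia. f_equal; lia. }
    assert (forall y, nth 0 r None = y -> y = (if S p =? p then w else f (S p))) as HH.
    { intros y <-. destruct (Nat.eqb_spec (S p) p); [lia|].
      rewrite (Hr 0). f_equal; lia. }
    assert (forall i, nth (S i) r None =
      if S (S p) + i =? p then w else f (S (S p) + i)) as HRr.
    { intros i. destruct (Nat.eqb_spec (S (S p) + i) p); [lia|].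
      rewrite Hr. f_equal; lia. }
    (* An empty right list yields a blank, which is what [nth] with default [None] already says, so
       both cases share the facts above. *)
    destruct r as [|y r']; (do 3 eexists; split; [reflexivity|]); repeat split;
      try (simpl; lia).
    + intros i Hi. destruct (HL i) as [E|]; [|lia]. exact E.
    + apply HH. reflexivity.
    + intros i. etransitivity; [|exact (HRr i)]. destruct i; reflexivity.
    + intros i Hi. destruct (HL i) as [E|]; [|lia]. exact E.
    + apply HH. reflexivity.
    + exact HRr.
  - do 3 eexists; split; [reflexivity|]. repeat split; auto.
    + intros i Hi. destruct (Nat.eqb_spec (p - 1 - i) p); [lia|]. auto.
    + rewrite Nat.eqb_refl. reflexivity.
    + intros i. change (nth i r None = if S p + i =? p then w else f (S p + i)).
      destruct (Nat.eqb_spec (S p + i) p); [lia|]. apply Hr.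
Qed.

Lemma iter_add {A} (g : A -> A) a b x :
  Nat.iter (a + b) g x = Nat.iter b g (Nat.iter a g x).
Proof.
  rewrite Nat.add_comm. induction b; simpl; congruence.
Qed.

Lemma upd_same {A} (f : nat -> A) p : upd f p (f p) = f.
Proof.
  apply functional_extensionality; intros x. unfold upd.
  destruct (Nat.eqb_spec x p); congruence.
Qed.

Lemma placed_bound m0 base m exit :
  placed (assemble m0 0 (csize m0)) base m exit -> base < csize m0.
Proof.
  intros H. destruct (nth_error (assemble m base exit) 0) eqn:E.
  - apply H in E. rewrite Nat.add_0_r in E.
    rewrite <- (assemble_length m0 0 (csize m0)). apply nth_error_Some. congruence.
  - apply nth_error_None in E. rewrite assemble_length in E. pose proof (csize_pos m). lia.
Qed.

Lemma placed_app code base m exit l1 l2 m' exit' :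
  placed code base m exit -> assemble m base exit = l1 ++ assemble m' (base + length l1) exit' ++ l2 ->
  placed code (base + length l1) m' exit'.
Proof.
  intros HP E i tr Hi. rewrite <- Nat.add_assoc. apply HP. rewrite E, nth_error_app2 by lia.
  replace (length l1 + i - length l1) with i by lia. apply nth_error_app_l, Hi.
Qed.

Lemma exec_simulated m0 m f p f' p' t : exec m f p f' p' t ->
  forall base exit l h r,
    placed (assemble m0 0 (csize m0)) base m exit -> tape_rep l h r f p ->
    exists l' h' r', Nat.iter t (tm_step (machine m0)) (base, l, h, r) = (exit, l', h', r')
      /\ tape_rep l' h' r' f' p'.
Proof.
  set (code := assemble m0 0 (csize m0)).
  assert (Hstep : forall m base exit tr l h r f p,
    placed code base m exit -> nth_error (assemble m base exit) 0 = Some tr ->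
    tape_rep l h r f p ->
    exists l' h' r', tm_step (machine m0) (base, l, h, r) = (fst (fst (tr (f p))), l', h', r')
      /\ tape_rep l' h' r' (upd f p (snd (fst (tr (f p))))) (mv (snd (tr (f p))) p)).
  { intros m1 base exit tr l h r g p1 HP HN HR. pose proof HR as (_ & _ & <- & _).
    pose proof (placed_bound _ HP). apply HP in HN. rewrite Nat.add_0_r in HN.
    apply tm_step_rep; auto. unfold machine_delta. fold code. rewrite HN.
    destruct (tr h) as [[? ?] ?]; reflexivity. }
  assert (Hsplit : forall a b c0 c1 c2 c3 t1 t2,
    Nat.iter t1 (tm_step (machine m0)) c0 = c1 -> Nat.iter t2 (tm_step (machine m0)) c1 = c2 ->
    c2 = c3 -> a = t1 -> b = t2 -> Nat.iter (a + b) (tm_step (machine m0)) c0 = c3).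
  { intros. subst. apply iter_add. }
  induction 1 as [g f p|a b f p f1 p1 f2 p2 t1 t2 Ha IHa Hb IHb
    |c a b f p f1 p1 t Hc Ha IHa|c a b f p f1 p1 t Hc Ha IHa|c a f p Hc
    |c a f p f1 p1 f2 p2 t1 t2 Hc Ha IHa Hb IHb]; intros base exit l h r HP HR;
    try (destruct (@Hstep _ _ _ _ _ _ _ _ _ HP eq_refl HR) as (l1 & h1 & r1 & E1 & R1);
         cbn [fst snd mv] in E1, R1; try rewrite Hc in E1; try rewrite upd_same in R1).
  - eauto.
  - destruct (IHa base (base + csize a) l h r) as (l1 & h1 & r1 & E1 & R1); auto.
    { intros i tr Hi. apply HP. simpl. apply nth_error_app_l, Hi. }
    destruct (IHb (base + csize a) exit l1 h1 r1) as (l2 & h2 & r2 & E2 & R2); auto.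
    { rewrite <- (assemble_length a base (base + csize a)).
      eapply placed_app with (l2 := []); [exact HP|]. simpl.
      rewrite app_nil_r, assemble_length. reflexivity. }
    exists l2, h2, r2. split; eauto.
  - destruct (IHa (S base) exit l1 h1 r1) as (l2 & h2 & r2 & E2 & R2); auto.
    { rewrite <- Nat.add_1_r. eapply placed_app with (l1 := [_]); [exact HP|].
      simpl. rewrite Nat.add_1_r. reflexivity. }
    exists l2, h2, r2. split; auto. rewrite Nat.iter_succ_r, E1. exact E2.
  - destruct (IHa (S base + csize a) exit l1 h1 r1) as (l2 & h2 & r2 & E2 & R2); auto.
    { replace (S base + csize a) with (base + S (csize a)) by lia.
      rewrite <- (assemble_length a (S base) exit).
      eapply placed_app with (l1 := _ :: assemble a (S base) exit) (l2 := []); [exact HP|].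
      simpl. rewrite app_nil_r, assemble_length, Nat.add_succ_r. reflexivity. }
    exists l2, h2, r2. split; auto. rewrite Nat.iter_succ_r, E1. exact E2.
  - eauto.
  - destruct (IHa (S base) base l1 h1 r1) as (l2 & h2 & r2 & E2 & R2); auto.
    { rewrite <- Nat.add_1_r. eapply placed_app with (l1 := [_]) (l2 := []); [exact HP|].
      simpl. rewrite Nat.add_1_r, app_nil_r. reflexivity. }
    (* The body exits to [base], so the remaining iterations start under the same placement [HP]. *)
    destruct (IHb _ _ _ _ _ HP R2) as (l3 & h3 & r3 & E3 & R3).
    exists l3, h3, r3. split; auto. rewrite Nat.iter_succ_r, E1. eauto.
Qed.

Definition input_tape (w : list bool) : tape := fun p => nth_error w p.

Lemma machine_decides m w f p t ans :
  exec m (input_tape w) 0 f p t -> (ans = true <-> f p = Some true) ->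
  tm_decides_within (machine m) w (S t) ans.
Proof.
  intros HE Hans. exists (S t). split; [lia|].
  set (c0 := tm_init (machine m) w).
  assert (exists l h r, c0 = (0, l, h, r) /\ tape_rep l h r (input_tape w) 0)
    as (l & h & r & Hc & HR).
  { unfold c0, tm_init, input_tape. destruct w as [|b w'].
    - exists [], None, []. split; [reflexivity|]. repeat split; simpl; auto; try lia.
      intros [|]; reflexivity.
    - exists [], (Some b), (map Some w'). split; [reflexivity|].
      repeat split; simpl; auto; try lia.
      intros i. destruct (nth_error w' i) eqn:E.
      + apply nth_error_nth with (d := b) in E as E'.
        assert (i < length w') by (apply nth_error_Some; congruence).
        rewrite nth_indep with (d' := Some b) by (rewrite length_map; lia).
        rewrite map_nth. congruence.
      + apply nth_error_None in E. apply nth_overflow. rewrite length_map; lia. }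
  assert (placed (assemble m 0 (csize m)) 0 m (csize m)) as HP.
  { intros i tr H; exact H. }
  destruct (exec_simulated m HE HP HR) as (l' & h' & r' & E & R').
  (* The last of the [S t] steps leaves state [csize m], which has no listed transition and turns
     the scanned cell into the verdict. *)
  rewrite Nat.iter_succ.
  replace (Nat.iter t (tm_step (machine m)) c0) with ((csize m, l', h', r') : config)
    by (symmetry; rewrite Hc; exact E).
  unfold tm_step; simpl.
  assert ((csize m =? S (csize m)) = false) as -> by (apply Nat.eqb_neq; lia).
  assert ((csize m =? S (S (csize m))) = false) as -> by (apply Nat.eqb_neq; lia).
  simpl. unfold machine_delta.
  assert (nth_error (assemble m 0 (csize m)) (csize m) = None) as ->.
  { apply nth_error_None. rewrite assemble_length. lia. }
  destruct R' as (_ & _ & -> & _). simpl.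
  destruct (f p) as [[|]|]; simpl; destruct ans; auto; intuition congruence.
Qed.

(** * Registers and arrays on the tape *)

Definition noop : tcmd := Act (fun x => (x, Stay)).
Definition write (w : sym) : tcmd := Act (fun _ => (w, Stay)).
Fixpoint goR (n : nat) : tcmd :=
  match n with 0 => noop | S n' => Sq (Act (fun x => (x, GoR))) (goR n') end.
Fixpoint goL (n : nat) : tcmd :=
  match n with 0 => noop | S n' => Sq (Act (fun x => (x, GoL))) (goL n') end.
Definition is_true_sym (x : sym) : bool := match x with Some true => true | _ => false end.
Definition is_some_sym (x : sym) : bool := match x with Some _ => true | _ => false end.

Lemma exec_time m f p f' p' t t' : exec m f p f' p' t -> t = t' -> exec m f p f' p' t'.
Proof. congruence. Qed.

Lemma exec_pos m f p f' p' q t : exec m f p f' p' t -> p' = q -> exec m f p f' q t.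
Proof. congruence. Qed.

Lemma exec_noop f p : exec noop f p f p 1.
Proof. pose proof (ex_act (fun x => (x, Stay)) f p) as H. simpl in H.
  rewrite upd_same in H. exact H. Qed.

Lemma exec_write w f p : exec (write w) f p (upd f p w) p 1.
Proof. exact (ex_act (fun _ => (w, Stay)) f p). Qed.

Lemma exec_goR n : forall f p, exec (goR n) f p f (p + n) (S n).
Proof.
  induction n; intros f p; simpl.
  - rewrite Nat.add_0_r. apply exec_noop.
  - pose proof (ex_act (fun x => (x, GoR)) f p) as H. simpl in H. rewrite upd_same in H.
    change (S (S n)) with (1 + S n). eapply ex_seq; [exact H|].
    rewrite <- Nat.add_succ_comm. apply IHn.
Qed.

Lemma exec_goL n : forall f p, exec (goL n) f p f (p - n) (S n).
Proof.
  induction n; intros f p; simpl.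
  - rewrite Nat.sub_0_r. apply exec_noop.
  - pose proof (ex_act (fun x => (x, GoL)) f p) as H. simpl in H. rewrite upd_same in H.
    change (S (S n)) with (1 + S n). eapply ex_seq; [exact H|].
    replace (p - S n) with (pred p - n) by lia. apply IHn.
Qed.

Record mstate := mkS { reg : nat -> nat; arr : nat -> nat -> bool; rem : list bool }.

(* Tracks 0 and 1 are bit arrays; track [r + 2] holds register [r] in unary. *)
Definition trk (s : mstate) (i c : nat) : bool :=
  match i with
  | 0 => arr s 0 c
  | 1 => arr s 1 c
  | S (S r) => c <? reg s r
  end.

Definition cell (b : bool) : sym := if b then Some true else None.

Definition low (L : nat) (rm : list bool) (p : nat) : sym :=
  if p <? L - length rm then None else nth_error rm (p - (L - length rm)).

Section Columns.

(* The tape is the unread input (cells below [L], consumed from the left), a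
   blank cell, and then columns of [S K] cells: a flag, which is [Some true] in
   column 0 only, followed by one cell for each of the [K] tracks. *)
Variables K L : nat.

Definition pos (c i : nat) : nat := S L + (c * S K + i).

Lemma pos_inj c i c' i' : i <= K -> i' <= K -> pos c i = pos c' i' -> c = c' /\ i = i'.
Proof.
  unfold pos; intros Hi Hi' H.
  rewrite (Nat.mul_comm c), (Nat.mul_comm c') in H.
  apply (Nat.div_mod_unique (S K)); lia.
Qed.

(** The range [p <= L] includes the blank cell [L], where [low] runs past the end of the unread
    suffix. Together the clauses fix every cell. *)
Definition Tape (s : mstate) (f : tape) : Prop :=
  (forall p, p <= L -> f p = low L (rem s) p) /\
  (forall c, f (pos c 0) = cell (c =? 0)) /\
  (forall i c, i < K -> f (pos c (S i)) = cell (trk s i c)).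

(** Every command starts and ends on the flag of column 0, so commands compose without tracking the
    head. The time is only an upper bound, so costs may be rounded up. *)
Definition runs (m : tcmd) (s s' : mstate) (t : nat) : Prop :=
  forall f, Tape s f -> exists f' t',
    exec m f (pos 0 0) f' (pos 0 0) t' /\ t' <= t /\ Tape s' f'.

Lemma runs_seq a b s1 s2 s3 t1 t2 t :
  runs a s1 s2 t1 -> runs b s2 s3 t2 -> t1 + t2 <= t -> runs (Sq a b) s1 s3 t.
Proof.
  intros Ha Hb Ht f Hf. destruct (Ha f Hf) as (f1 & u1 & E1 & L1 & T1).
  destruct (Hb f1 T1) as (f2 & u2 & E2 & L2 & T2).
  exists f2, (u1 + u2). split; [|split; [lia|auto]]. eapply ex_seq; eauto.
Qed.

Lemma runs_weaken m s s' t t' : runs m s s' t -> t <= t' -> runs m s s' t'.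
Proof.
  intros H Ht f Hf. destruct (H f Hf) as (f1 & u1 & E1 & L1 & T1).
  exists f1, u1. repeat split; auto; [lia|apply T1|apply T1|apply T1].
Qed.

Lemma runs_noop s t : 1 <= t -> runs noop s s t.
Proof. intros Ht f Hf. exists f, 1. split; [apply exec_noop|auto]. Qed.

Definition seek (i : nat) : tcmd :=
  Sq (goR (S i)) (Sq (WhileS is_true_sym (goR (S K))) (goL (S i))).
Definition home : tcmd := WhileS (fun x => negb (is_true_sym x)) (goL (S K)).
Definition set_at (j : nat) (b : bool) : tcmd :=
  Sq (goR (S j)) (Sq (write (cell b)) (goL (S j))).

Lemma is_true_cell b : is_true_sym (cell b) = b.
Proof. destruct b; reflexivity. Qed.

Lemma exec_seek s f i v : Tape s f -> i < K -> (forall c, trk s i c = (c <? v)) ->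
  exec (seek i) f (pos 0 0) f (pos v 0) (v * (K + 3) + 2 * i + 5).
Proof.
  intros (_ & _ & HT) Hi Hv.
  assert (HW : forall k c, c + k = v -> exec (WhileS is_true_sym (goR (S K)))
     f (pos c (S i)) f (pos v (S i)) (k * (K + 3) + 1)).
  { induction k; intros c Hc.
    - rewrite Nat.add_0_r in Hc; subst c. apply ex_while_end.
      rewrite HT, Hv, is_true_cell by auto. apply Nat.ltb_irrefl.
    - eapply exec_time.
      + eapply ex_while_step.
        * rewrite HT, Hv, is_true_cell by auto. apply Nat.ltb_lt; lia.
        * apply exec_goR.
        * eapply exec_time; [|reflexivity].
          replace (pos c (S i) + S K) with (pos (S c) (S i)) by (unfold pos; lia).
          apply IHk; lia.
      + lia. }
  eapply exec_time.
  - eapply ex_seq; [apply exec_goR|].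
    replace (pos 0 0 + S i) with (pos 0 (S i)) by (unfold pos; lia).
    eapply ex_seq; [apply (HW v 0); lia|].
    eapply exec_pos; [apply exec_goL|]. unfold pos; lia.
  - lia.
Qed.

Lemma exec_home f v : (forall c, f (pos c 0) = cell (c =? 0)) ->
  exec home f (pos v 0) f (pos 0 0) (v * (K + 3) + 1).
Proof.
  intros HF. induction v.
  - apply ex_while_end. rewrite HF. reflexivity.
  - eapply exec_time.
    + eapply ex_while_step.
      * rewrite HF. reflexivity.
      * apply exec_goL.
      * replace (pos (S v) 0 - S K) with (pos v 0) by (unfold pos; lia). exact IHv.
    + lia.
Qed.

Lemma exec_set_at f c j b :
  exec (set_at j b) f (pos c 0) (upd f (pos c (S j)) (cell b)) (pos c 0) (2 * j + 5).
Proof.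
  eapply exec_time.
  - eapply ex_seq; [apply exec_goR|].
    replace (pos c 0 + S j) with (pos c (S j)) by (unfold pos; lia).
    eapply ex_seq; [apply exec_write|].
    eapply exec_pos; [apply exec_goL|]. unfold pos; lia.
  - lia.
Qed.

Lemma Tape_upd s s' f j c b : Tape s f -> j < K -> rem s' = rem s ->
  (forall i c', i < K -> trk s' i c' = if (i =? j) && (c' =? c) then b else trk s i c') ->
  Tape s' (upd f (pos c (S j)) (cell b)).
Proof.
  intros (H1 & H2 & H3) Hj Hr HT. unfold upd. split; [|split].
  - intros p Hp. destruct (Nat.eqb_spec p (pos c (S j))); [unfold pos in *; lia|].
    rewrite Hr; auto.
  - intros c'. destruct (Nat.eqb_spec (pos c' 0) (pos c (S j))) as [E|]; [|auto].
    apply pos_inj in E; lia.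
  - intros i c' Hi. rewrite HT by auto.
    destruct (Nat.eqb_spec (pos c' (S i)) (pos c (S j))) as [E|E].
    + apply pos_inj in E as [-> E]; try lia. injection E as ->.
      rewrite !Nat.eqb_refl. reflexivity.
    + destruct (Nat.eqb_spec i j); destruct (Nat.eqb_spec c' c); simpl; subst; auto.
      congruence.
Qed.

(** The first unmarked column of a unary register is where an increment writes; a decrement clears
    the column before it. *)
Definition Inc (r : nat) : tcmd := Sq (seek (r + 2)) (Sq (set_at (r + 2) true) home).
Definition Dec (r : nat) : tcmd :=
  Sq (seek (r + 2)) (Sq (goL (S K)) (Sq (set_at (r + 2) false) home)).
Definition SetArr (r a : nat) (b : bool) : tcmd :=
  Sq (seek (r + 2)) (Sq (set_at a b) home).
(* Branches on track [j] in the column whose number is the value of register [r]. *)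
Definition Test (r j : nat) (m1 m2 : tcmd) : tcmd :=
  Sq (seek (r + 2)) (Sq (goR (S j))
    (IfS is_true_sym (Sq (goL (S j)) (Sq home m1)) (Sq (goL (S j)) (Sq home m2)))).
Definition IfNZ (r : nat) (m1 m2 : tcmd) : tcmd :=
  Sq (goR (r + 3)) (IfS is_true_sym (Sq (goL (r + 3)) m1) (Sq (goL (r + 3)) m2)).
Definition WhileNZ (r : nat) (m : tcmd) : tcmd :=
  Sq (goR (r + 3)) (Sq (WhileS is_true_sym (Sq (goL (r + 3)) (Sq m (goR (r + 3)))))
    (goL (r + 3))).

(** Covers a walk to column [v], the walk home and a bounded number of walks inside a column; the
    factor 10 is slack. *)
Definition unit_time (v : nat) : nat := 10 * (K + 5) * (v + 2).

Definition setreg (s : mstate) (r v : nat) : mstate := mkS (upd (reg s) r v) (arr s) (rem s).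
Definition setarr (s : mstate) (a c : nat) (b : bool) : mstate :=
  mkS (reg s) (upd (arr s) a (upd (arr s a) c b)) (rem s).

Lemma trk_reg s r c : trk s (r + 2) c = (c <? reg s r).
Proof. rewrite Nat.add_comm. reflexivity. Qed.

Lemma runs_set s s' r j b : r + 2 < K -> j < K -> rem s' = rem s ->
  (forall i c', i < K -> trk s' i c' = if (i =? j) && (c' =? reg s r) then b else trk s i c') ->
  runs (Sq (seek (r + 2)) (Sq (set_at j b) home)) s s' (unit_time (reg s r)).
Proof.
  intros Hr Hj Hrem HT f Hf.
  pose proof (Tape_upd s' _ _ Hf Hj Hrem HT) as Hf'.
  do 2 eexists; split; [|split; [|exact Hf']].
  - eapply ex_seq; [eapply exec_seek; eauto; intros; apply trk_reg|].
    eapply ex_seq; [apply exec_set_at|]. apply exec_home. apply Hf'.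
  - unfold unit_time. nia.
Qed.

Lemma runs_Inc s r t : r + 2 < K -> unit_time (reg s r) <= t ->
  runs (Inc r) s (setreg s r (S (reg s r))) t.
Proof.
  intros Hr Ht. eapply runs_weaken; [|exact Ht].
  apply runs_set; auto. intros i c' Hi.
  destruct i as [|[|i]]; simpl.
  - rewrite (Nat.add_comm r); reflexivity.
  - rewrite (Nat.add_comm r); reflexivity.
  - rewrite (Nat.add_comm r); simpl. unfold upd.
    destruct (Nat.eqb_spec i r) as [->|]; simpl; [|reflexivity].
    destruct (Nat.eqb_spec c' (reg s r)) as [->|].
    + apply Nat.ltb_lt; lia.
    + destruct (Nat.ltb_spec c' (reg s r)); [apply Nat.ltb_lt|apply Nat.ltb_ge]; lia.
Qed.

Lemma runs_Dec s r t : r + 2 < K -> 0 < reg s r -> unit_time (reg s r) <= t ->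
  runs (Dec r) s (setreg s r (pred (reg s r))) t.
Proof.
  intros Hr Hp Ht f Hf.
  assert (Tape (setreg s r (pred (reg s r)))
     (upd f (pos (pred (reg s r)) (S (r + 2))) (cell false))) as Hf'.
  { eapply Tape_upd; eauto. intros i c' Hi.
    destruct i as [|[|i]]; simpl; rewrite (Nat.add_comm r); try reflexivity.
    simpl. unfold upd.
    destruct (Nat.eqb_spec i r) as [->|]; simpl; [|reflexivity].
    destruct (Nat.eqb_spec c' (pred (reg s r))) as [->|].
    + apply Nat.ltb_ge; lia.
    + destruct (Nat.ltb_spec c' (reg s r)); [apply Nat.ltb_lt|apply Nat.ltb_ge]; lia. }
  do 2 eexists; split; [|split; [|exact Hf']].
  - eapply ex_seq; [eapply exec_seek; eauto; intros; apply trk_reg|].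
    eapply ex_seq; [apply exec_goL|].
    replace (pos (reg s r) 0 - S K) with (pos (pred (reg s r)) 0)
      by (unfold pos; destruct (reg s r); simpl; lia).
    eapply ex_seq; [apply exec_set_at|]. apply exec_home. apply Hf'.
  - unfold unit_time in Ht. nia.
Qed.

Lemma runs_SetArr s r a b t : r + 2 < K -> a < 2 -> unit_time (reg s r) <= t ->
  runs (SetArr r a b) s (setarr s a (reg s r) b) t.
Proof.
  intros Hr Ha Ht. eapply runs_weaken; [|exact Ht].
  apply runs_set; auto; [lia|]. intros i c' Hi. unfold setarr, upd; simpl.
  destruct i as [|[|i]]; destruct a as [|[|]]; simpl; try lia; try reflexivity.
Qed.

Lemma runs_Test s s' r j m1 m2 t : r + 2 < K -> j < K ->
  runs (if trk s j (reg s r) then m1 else m2) s s' t ->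
  runs (Test r j m1 m2) s s' (unit_time (reg s r) + t).
Proof.
  intros Hr Hj Hm f Hf. destruct (Hm f Hf) as (f' & t' & E & Ht & Hf').
  assert (is_true_sym (f (pos (reg s r) (S j))) = trk s j (reg s r)) as HB.
  { destruct Hf as (_ & _ & ->); auto. apply is_true_cell. }
  exists f'. eexists; split; [|split; [|exact Hf']].
  - eapply ex_seq; [eapply exec_seek; eauto; intros; apply trk_reg|].
    eapply ex_seq; [apply exec_goR|].
    replace (pos (reg s r) 0 + S j) with (pos (reg s r) (S j)) by (unfold pos; lia).
    assert (exec (Sq (goL (S j)) (Sq home (if trk s j (reg s r) then m1 else m2)))
       f (pos (reg s r) (S j)) f' (pos 0 0) (S (S j) + (reg s r * (K + 3) + 1 + t'))) as HE.
    { eapply ex_seq; [apply exec_goL|].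
      replace (pos (reg s r) (S j) - S j) with (pos (reg s r) 0) by (unfold pos; lia).
      eapply ex_seq; [apply exec_home; apply Hf|exact E]. }
    destruct (trk s j (reg s r)).
    + apply ex_if_true; eauto.
    + apply ex_if_false; eauto.
  - unfold unit_time. nia.
Qed.

Lemma runs_IfNZ s s' r m1 m2 t : r + 2 < K ->
  runs (if reg s r =? 0 then m2 else m1) s s' t ->
  runs (IfNZ r m1 m2) s s' (unit_time 0 + t).
Proof.
  intros Hr Hm f Hf. destruct (Hm f Hf) as (f' & t' & E & Ht & Hf').
  assert (is_true_sym (f (pos 0 (r + 3))) = negb (reg s r =? 0)) as HB.
  { replace (r + 3) with (S (r + 2)) by lia.
    destruct Hf as (_ & _ & ->); auto. rewrite is_true_cell, trk_reg.
    destruct (reg s r); reflexivity. }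
  exists f'. eexists; split; [|split; [|exact Hf']].
  - eapply ex_seq; [apply exec_goR|].
    replace (pos 0 0 + (r + 3)) with (pos 0 (r + 3)) by (unfold pos; lia).
    assert (exec (Sq (goL (r + 3)) (if reg s r =? 0 then m2 else m1))
       f (pos 0 (r + 3)) f' (pos 0 0) (S (r + 3) + t')) as HE.
    { eapply ex_seq; [apply exec_goL|].
      replace (pos 0 (r + 3) - (r + 3)) with (pos 0 0) by (unfold pos; lia). exact E. }
    destruct (reg s r =? 0).
    + apply ex_if_false; eauto.
    + apply ex_if_true; eauto.
  - unfold unit_time. nia.
Qed.

(** The invariant is a sequence of states, one per round, so the number of rounds, and hence the
    time, is known in advance. *)
Lemma runs_WhileNZ r m (n : nat) (S_ : nat -> mstate) t : r + 2 < K ->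
  (forall k, k < n -> reg (S_ k) r <> 0) -> reg (S_ n) r = 0 ->
  (forall k, k < n -> runs m (S_ k) (S_ (S k)) t) ->
  runs (WhileNZ r m) (S_ 0) (S_ n) (n * (t + unit_time 0) + unit_time 0).
Proof.
  intros Hr Hnz Hz Hm f Hf.
  assert (HB : forall s f, Tape s f -> is_true_sym (f (pos 0 (r + 3))) = negb (reg s r =? 0)).
  { clear f Hf. intros s f Hf. replace (r + 3) with (S (r + 2)) by lia.
    destruct Hf as (_ & _ & ->); auto. rewrite is_true_cell, trk_reg.
    destruct (reg s r); reflexivity. }
  assert (HW : forall j k f, k + j = n -> Tape (S_ k) f -> exists f' t',
    exec (WhileS is_true_sym (Sq (goL (r + 3)) (Sq m (goR (r + 3)))))
      f (pos 0 (r + 3)) f' (pos 0 (r + 3)) t' /\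
    t' <= j * (t + unit_time 0) + 1 /\ Tape (S_ n) f').
  { clear f Hf. induction j; intros k f Hk Hf.
    - rewrite Nat.add_0_r in Hk; subst k. exists f, 1. split; [|split; [lia|exact Hf]].
      apply ex_while_end. rewrite (HB _ _ Hf), Hz. reflexivity.
    - destruct (Hm k ltac:(lia) f Hf) as (f1 & t1 & E1 & L1 & T1).
      destruct (IHj (S k) f1 ltac:(lia) T1) as (f2 & t2 & E2 & L2 & T2).
      exists f2. eexists; split; [|split; [|exact T2]].
      + eapply ex_while_step.
        * rewrite (HB _ _ Hf). specialize (Hnz k ltac:(lia)).
          apply Nat.eqb_neq in Hnz. rewrite Hnz. reflexivity.
        * eapply ex_seq; [apply exec_goL|].
          replace (pos 0 (r + 3) - (r + 3)) with (pos 0 0) by (unfold pos; lia).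
          eapply ex_seq; [exact E1|]. apply exec_goR.
        * replace (pos 0 0 + (r + 3)) with (pos 0 (r + 3)) by (unfold pos; lia). exact E2.
      + unfold unit_time in *. lia. }
  destruct (HW n 0 f eq_refl Hf) as (f' & t' & E & Lt & T').
  exists f'. eexists; split; [|split; [|exact T']].
  - eapply ex_seq; [apply exec_goR|].
    replace (pos 0 0 + (r + 3)) with (pos 0 (r + 3)) by (unfold pos; lia).
    eapply ex_seq; [exact E|]. eapply exec_pos; [apply exec_goL|]. unfold pos; lia.
  - unfold unit_time in *. lia.
Qed.

Lemma unit_time_mono v w : v <= w -> unit_time v <= unit_time w.
Proof. unfold unit_time. nia. Qed.

End Columns.

(** * Bounded recursive expressions *)

(* The registers below [NG] hold the global parameters of the computation;
   register 0 is the bound above which [Succ] saturates. *)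
Definition NG : nat := 6.

(* [Rec n b s] binds the accumulator as [Var 0] and the loop index as [Var 1] in [s]. *)
Inductive exp :=
| Var (i : nat)
| Glob (k : nat)
| Zero
| Succ (e : exp)
| Cond (c a b : exp)
| Orc (a : bool) (e : exp)
| LetE (a e : exp)
| Lift (e : exp)
| Rec (n b s : exp).

(** Saturation at [G 0] keeps all values, and so all registers and loop counts, bounded by [M].
    [Lift] is explicit weakening: an argument can be placed under a binder without renumbering its
    variables. *)
Fixpoint eval (G : nat -> nat) (A : nat -> nat -> bool) (e : exp) (env : list nat) : nat :=
  match e with
  | Var i => nth i env 0
  | Glob k => if k <? NG then G k else 0
  | Zero => 0
  | Succ e => let v := eval G A e env in if v <? G 0 then S v else v
  | Cond c a b => if eval G A c env =? 0 then eval G A b env else eval G A a env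
  | Orc a e => Nat.b2n (A (Nat.b2n a) (eval G A e env))
  | LetE a e => eval G A e (eval G A a env :: env)
  | Lift e => eval G A e (tl env)
  | Rec n b s =>
      nat_rect (fun _ => nat) (eval G A b env)
        (fun k acc => eval G A s (acc :: k :: env)) (eval G A n env)
  end.

(** Only [Succ] exceeds its argument, and it saturates; [1 <= G 0] accounts for the bits returned by
    [Orc]. *)
Lemma ev_le G A e : 1 <= G 0 -> (forall k, k < NG -> G k <= G 0) ->
  forall env, Forall (fun v => v <= G 0) env -> eval G A e env <= G 0.
Proof.
  intros H1 HG. induction e; intros env He; simpl.
  - destruct (Nat.lt_ge_cases i (length env)).
    + rewrite Forall_forall in He. apply He, nth_In; auto.
    + rewrite nth_overflow by auto. lia.
  - destruct (Nat.ltb_spec k NG); auto; lia.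
  - lia.
  - destruct (Nat.ltb_spec (eval G A e env) (G 0)); auto.
  - destruct (_ =? 0); auto.
  - destruct (A _ _); simpl; lia.
  - apply IHe2. constructor; auto.
  - apply IHe. destruct env; simpl; auto. inversion He; auto.
  - specialize (IHe1 env He). induction (eval G A e1 env); simpl; auto.
    assert (n <= G 0) as Hn by lia. apply IHe3. repeat constructor; auto.
Qed.

Lemma mstate_ext s s' : (forall k, reg s k = reg s' k) -> arr s = arr s' -> rem s = rem s' ->
  s = s'.
Proof.
  destruct s, s'; simpl. intros H -> ->. f_equal. apply functional_extensionality, H.
Qed.

Ltac regs :=
  unfold setreg, upd; cbn [reg arr rem];
  repeat match goal with
  | |- context [?a =? ?b] =>
      let E := fresh "E" in
      destruct (Nat.eqb_spec a b) as [E|E]; [first [subst a|subst b|idtac]|]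
  end; try reflexivity; try congruence; try lia.
Ltac st_eq := apply mstate_ext; [intros ?k; regs|reflexivity|reflexivity].

(** * Compilation of expressions to register programs *)

Section Compile.
Variables K L : nat.

Notation runs := (runs K L).

(** The [noop] gives the loop the shape treated by [runs_For]. *)
Definition Clear (r : nat) : tcmd := WhileNZ r (Sq (Dec K r) noop).
Definition MoveR (a b : nat) : tcmd := WhileNZ a (Sq (Dec K a) (Inc K b)).
(** Counting a register down destroys it, so a second copy is collected in [t] and moved back. *)
Definition Copy (a b t : nat) : tcmd :=
  Sq (WhileNZ a (Sq (Dec K a) (Sq (Inc K b) (Inc K t)))) (MoveR t a).

Definition mac (v : nat) : nat := 10 * (v + 2) * unit_time K v.

Lemma runs_eq m s s' s'' t : runs m s s' t -> s' = s'' -> runs m s s'' t.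
Proof. intros H <-. exact H. Qed.

(** The body runs with the counter already decremented, hence [n - S k] in its initial state. *)
Lemma runs_For r m n (S_ : nat -> mstate) u t : r + 2 < K ->
  (forall k, k <= n -> reg (S_ k) r = n - k) ->
  (forall k, k < n -> runs m (setreg (S_ k) r (n - S k)) (S_ (S k)) t) ->
  unit_time K n <= u ->
  runs (WhileNZ r (Sq (Dec K r) m)) (S_ 0) (S_ n) (n * (t + 2 * u) + u).
Proof.
  intros Hr Hn Hm Hu. pose proof (@unit_time_mono K 0 n ltac:(lia)).
  eapply runs_weaken.
  - apply runs_WhileNZ with (S_ := S_) (n := n) (t := u + t); auto.
    + intros k Hk. rewrite Hn; lia.
    + rewrite Hn; lia.
    + intros k Hk. pose proof (@unit_time_mono K (n - k) n ltac:(lia)).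
      eapply runs_seq; [|apply Hm; auto|apply Nat.le_refl].
      eapply runs_eq; [apply runs_Dec; auto; rewrite Hn; lia|].
      rewrite Hn by lia. f_equal. lia.
  - nia.
Qed.

Lemma mac_unit v w : v <= w -> unit_time K v <= mac w.
Proof.
  intros H. pose proof (unit_time_mono K H). unfold mac. nia.
Qed.

Lemma runs_Clear s r t : r + 2 < K -> mac (reg s r) <= t -> runs (Clear r) s (setreg s r 0) t.
Proof.
  intros Hr Ht.
  pose (S_ := fun k => setreg s r (reg s r - k)).
  replace s with (S_ 0) at 1 by (unfold S_; st_eq).
  eapply runs_eq with (s' := S_ (reg s r)); [|unfold S_; st_eq].
  eapply runs_weaken; [eapply runs_For with (t := 1); auto|].
  - unfold S_; intros; regs.
  - intros k Hk. eapply runs_eq; [apply runs_noop; lia|]. unfold S_; st_eq.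
  - unfold mac, unit_time in *. nia.
Qed.

Lemma runs_MoveR s a b v t : a + 2 < K -> b + 2 < K -> a <> b -> reg s a + reg s b <= v ->
  mac v <= t ->
  runs (MoveR a b) s (setreg (setreg s a 0) b (reg s b + reg s a)) t.
Proof.
  intros Ha Hb Hab Hv Ht.
  pose (S_ := fun k => setreg (setreg s a (reg s a - k)) b (reg s b + k)).
  replace s with (S_ 0) at 1 by (unfold S_; st_eq).
  eapply runs_eq with (s' := S_ (reg s a)); [|unfold S_; st_eq].
  eapply runs_weaken; [eapply runs_For with (t := unit_time K v) (u := unit_time K v); auto|].
  - unfold S_; intros; regs.
  - intros k Hk. eapply runs_eq; [apply runs_Inc; auto|unfold S_; st_eq].
    apply unit_time_mono. unfold S_; regs.
  - apply unit_time_mono. lia.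
  - unfold mac in Ht. nia.
Qed.

Lemma runs_Copy s a b t v u : a + 2 < K -> b + 2 < K -> t + 2 < K ->
  a <> b -> a <> t -> b <> t -> reg s b = 0 -> reg s t = 0 -> reg s a <= v ->
  2 * mac v <= u ->
  runs (Copy a b t) s (setreg s b (reg s a)) u.
Proof.
  intros Ha Hb Ht Hab Hat Hbt Hb0 Ht0 Hv Hu.
  pose (S_ := fun k => setreg (setreg (setreg s a (reg s a - k)) b k) t k).
  eapply runs_seq with (s2 := S_ (reg s a)) (t1 := mac v) (t2 := mac v); [| |lia].
  - replace s with (S_ 0) at 1 by (unfold S_; st_eq).
    eapply runs_weaken;
      [eapply runs_For with (t := unit_time K v + unit_time K v) (u := unit_time K v); auto|].
    + unfold S_; intros; regs.
    + intros k Hk. eapply runs_seq; [| |apply Nat.le_refl].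
      * apply runs_Inc; auto. apply unit_time_mono. unfold S_; regs.
      * eapply runs_eq; [apply runs_Inc; auto|unfold S_; st_eq].
        apply unit_time_mono. unfold S_; regs.
    + apply unit_time_mono. lia.
    + unfold mac. nia.
  - eapply runs_eq.
    + apply runs_MoveR with (v := v); auto. unfold S_; regs.
    + unfold S_; st_eq.
Qed.

(* The value of [e], whose variables live in the registers [vars], is left in
   register [d]; only registers from [d] on are modified. *)
Fixpoint compile (e : exp) (vars : list nat) (d : nat) : tcmd :=
  match e with
  | Var i => match nth_error vars i with Some r => Copy r d (S d) | None => noop end
  | Glob k => if k <? NG then Copy k d (S d) else noop
  | Zero => noop
  | Succ e => Sq (compile e vars d) (Test K d 2 (Inc K d) noop)
  | Cond c a b =>
      Sq (compile c vars d) (IfNZ d (Sq (Clear d) (compile a vars d)) (compile b vars d))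
  | Orc a e =>
      Sq (compile e vars d) (Test K d (Nat.b2n a) (Sq (Clear d) (Inc K d)) (Clear d))
  | LetE a e =>
      Sq (compile a vars d) (Sq (compile e (d :: vars) (S d)) (Sq (Clear d) (MoveR (S d) d)))
  | Lift e => compile e (tl vars) d
  | Rec n b s =>
      Sq (compile n vars d) (Sq (compile b vars (d + 1))
        (Sq (WhileNZ d (Sq (Dec K d) (Sq (compile s ((d + 1) :: (d + 2) :: vars) (d + 3))
               (Sq (Clear (d + 1)) (Sq (MoveR (d + 3) (d + 1)) (Inc K (d + 2)))))))
          (Sq (Clear (d + 2)) (MoveR (d + 1) d))))
  end.

Fixpoint need (e : exp) : nat :=
  match e with
  | Var _ | Glob _ | Zero => 2
  | Succ e | Lift e | Orc _ e => need e
  | Cond c a b => need c + need a + need b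
  | LetE a e => need a + need e + 2
  | Rec n b s => need n + need b + need s + 4
  end.

(** A [Rec] multiplies the cost of its body by [M + 1], so for a fixed expression this is a
    polynomial in [M] whose degree is governed by the nesting of [Rec]. *)
Fixpoint cost (M : nat) (e : exp) : nat :=
  match e with
  | Var _ | Glob _ | Zero => 2 * mac M
  | Succ e => cost M e + 2 * mac M
  | Lift e => cost M e
  | Orc _ e => cost M e + 3 * mac M
  | Cond c a b => cost M c + cost M a + cost M b + 2 * mac M
  | LetE a e => cost M a + cost M e + 2 * mac M
  | Rec n b s => cost M n + cost M b + (M + 1) * (cost M s + 5 * mac M) + 2 * mac M
  end.

Lemma mac_mono v w : v <= w -> mac v <= mac w.
Proof. intros H. pose proof (unit_time_mono K H). unfold mac. nia. Qed.

Lemma mac_pos v : 1 <= mac v.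
Proof. unfold mac, unit_time. nia. Qed.

Lemma need_pos e : 2 <= need e.
Proof. induction e; simpl; lia. Qed.

Lemma map_agree s s' vars d : Forall (fun v => v < d) vars ->
  (forall k, k < d -> reg s' k = reg s k) -> map (reg s') vars = map (reg s) vars.
Proof.
  intros HF H. apply map_ext_in. intros k Hk. apply H.
  rewrite Forall_forall in HF. auto.
Qed.

Lemma Forall_lt_mono vars d d' : d <= d' -> Forall (fun v => v < d) vars ->
  Forall (fun v => v < d') vars.
Proof. intros H. apply Forall_impl. intros; lia. Qed.

(** All registers from [d] on hold 0 before the run and, apart from [d], again after it. So scratch
    registers need no initialisation, and an expression of value 0, such as a variable out of range,
    may compile to [noop]. *)
Lemma compile_ok (G : nat -> nat) (A : nat -> nat -> bool) e : forall vars d s,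
  1 <= G 0 ->
  NG <= d -> Forall (fun v => v < d) vars -> (forall k, d <= k -> reg s k = 0) ->
  (forall k, reg s k <= G 0) -> (forall k, k < NG -> reg s k = G k) -> arr s = A ->
  d + need e + 2 < K ->
  runs (compile e vars d) s (setreg s d (eval G A e (map (reg s) vars))) (cost (G 0) e).
Proof.
  assert (HEV : forall s e vars, 1 <= G 0 -> (forall k, reg s k <= G 0) ->
     (forall k, k < NG -> reg s k = G k) -> eval G A e (map (reg s) vars) <= G 0).
  { intros s e0 vars H1 HM HG. apply ev_le; auto.
    - intros k Hk. rewrite <- HG by auto. apply HM.
    - apply Forall_forall. intros v Hv. apply in_map_iff in Hv as (k & <- & _). apply HM. }
  assert (HU : forall v, v <= G 0 -> unit_time K v <= mac (G 0)).
  { intros; apply mac_unit; auto. }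
  pose proof (mac_pos (G 0)) as Hmp.
  induction e as [i|k| |e IH|c IHc a IHa b IHb|a e IH|a IHa e IHe|e IH|n IHn b IHb st IHs];
    intros vars d s H1 Hd HF Hz HM HG HA HK; simpl in HK; cbn [compile cost eval].
  - destruct (nth_error vars i) as [r|] eqn:E.
    + assert (r < d) by (rewrite Forall_forall in HF; apply HF; eapply nth_error_In; eauto).
      replace (nth i (map (reg s) vars) 0) with (reg s r).
      2: { symmetry. apply nth_error_nth. rewrite nth_error_map, E. reflexivity. }
      apply runs_Copy with (v := G 0); auto; try lia; apply Hz; lia.
    + apply nth_error_None in E. rewrite nth_overflow by (rewrite length_map; lia).
      eapply runs_eq; [apply runs_noop; lia|]. specialize (Hz d). st_eq; symmetry; apply Hz; lia.
  - destruct (Nat.ltb_spec k NG).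
    + rewrite <- HG by auto.
      apply runs_Copy with (v := G 0); auto; try lia; apply Hz; lia.
    + eapply runs_eq; [apply runs_noop; lia|]. specialize (Hz d). st_eq; symmetry; apply Hz; lia.
  - eapply runs_eq; [apply runs_noop; lia|]. specialize (Hz d). st_eq; symmetry; apply Hz; lia.
  - set (v := eval G A e (map (reg s) vars)).
    assert (Hv : v <= G 0) by (apply HEV; auto).
    eapply runs_seq; [apply IH; auto| |apply Nat.le_refl].
    fold v. pose proof (need_pos e).
    eapply runs_weaken; [apply runs_Test with (t := mac (G 0)); try lia|].
    (* Track 2 holds register 0, the saturation bound, so its cell in column [v] is marked iff
       [v < G 0]. *)
    + simpl trk. replace (upd (reg s) d v d) with v by regs.
      replace (upd (reg s) d v 0) with (G 0)
        by (unfold upd; destruct (Nat.eqb_spec 0 d); [unfold NG in *; lia|];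
            symmetry; apply HG; unfold NG; lia).
      destruct (v <? G 0).
      * eapply runs_eq; [apply runs_Inc; [lia|]|].
        -- apply HU. regs.
        -- st_eq.
      * apply runs_noop; lia.
    + replace (reg (setreg s d v) d) with v by regs. specialize (HU v Hv). lia.
  - set (v := eval G A c (map (reg s) vars)).
    assert (Hv : v <= G 0) by (apply HEV; auto).
    eapply runs_seq with (t2 := cost (G 0) a + cost (G 0) b + 2 * mac (G 0));
      [apply IHc; auto; lia| |lia].
    fold v. pose proof (need_pos c). pose proof (need_pos a). pose proof (need_pos b).
    eapply runs_weaken;
      [apply runs_IfNZ with (t := cost (G 0) a + cost (G 0) b + mac (G 0)); [lia|]|
       specialize (HU 0 ltac:(lia)); lia].
    replace (reg (setreg s d v) d) with v by regs.
    destruct (Nat.eqb_spec v 0) as [Ev|Ev].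
    + replace (setreg s d v) with s
        by (rewrite Ev; specialize (Hz d); st_eq; apply Hz; lia).
      eapply runs_weaken; [apply IHb; auto; lia|lia].
    + eapply runs_seq with (s2 := s) (t2 := cost (G 0) a);
        [eapply runs_eq; [apply runs_Clear; [lia|apply Nat.le_refl]|] | apply IHa; auto; lia |].
      * specialize (Hz d). st_eq; symmetry; apply Hz; lia.
      * replace (reg (setreg s d v) d) with v by regs.
        pose proof (@mac_mono v (G 0) Hv). lia.
  - set (v := eval G A e (map (reg s) vars)).
    assert (Hv : v <= G 0) by (apply HEV; auto).
    pose proof (need_pos e). pose proof (@mac_mono v (G 0) Hv).
    eapply runs_seq with (t2 := 3 * mac (G 0)); [apply IH; auto| |lia].
    fold v.
    assert (reg (setreg s d v) d = v) as Ed by regs.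
    eapply runs_weaken; [apply runs_Test with (t := 2 * mac (G 0)); try lia|].
    + destruct a; simpl; lia.
    + rewrite Ed.
      replace (trk (setreg s d v) (Nat.b2n a) v) with (A (Nat.b2n a) v)
        by (rewrite <- HA; destruct a; reflexivity).
      destruct (A (Nat.b2n a) v).
      * eapply runs_seq with (t1 := mac (G 0)) (t2 := mac (G 0)); [apply runs_Clear; [lia|rewrite Ed; lia]| |lia].
        eapply runs_eq; [apply runs_Inc; [lia|]|].
        -- apply HU. regs.
        -- st_eq.
      * eapply runs_eq; [apply runs_Clear; [lia|rewrite Ed; lia]|st_eq].
    + rewrite Ed. specialize (HU v Hv). lia.
  - set (v := eval G A a (map (reg s) vars)).
    assert (Hv : v <= G 0) by (apply HEV; auto).
    pose proof (need_pos a). pose proof (need_pos e).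
    eapply runs_seq with (t2 := cost (G 0) e + 2 * mac (G 0)); [apply IHa; auto; lia| |lia].
    fold v. set (s1 := setreg s d v).
    assert (map (reg s1) (d :: vars) = v :: map (reg s) vars) as Em.
    { cbn [map]. f_equal; [unfold s1; regs|]. apply map_agree with d; auto.
      intros; unfold s1; regs. }
    assert (forall k, reg s1 k <= G 0) as HM1 by (intros k; specialize (HM k); unfold s1; regs).
    assert (forall k, k < NG -> reg s1 k = G k) as HG1
      by (intros k Hk; specialize (HG k); unfold s1; regs; auto).
    set (w := eval G A e (v :: map (reg s) vars)).
    assert (Hw : w <= G 0) by (unfold w; rewrite <- Em; apply HEV; auto).
    eapply runs_seq with (t1 := cost (G 0) e) (t2 := 2 * mac (G 0)) (s2 := setreg s1 (S d) w);
      [|  |lia].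
    + unfold w. rewrite <- Em. apply IHe; auto; try lia.
      * constructor; [lia|]. apply Forall_lt_mono with d; auto.
      * intros k Hk. specialize (Hz k). unfold s1; regs; apply Hz; lia.
    + assert (reg s (S d) = 0) by (apply Hz; lia).
      eapply runs_seq with (t1 := mac (G 0)) (t2 := mac (G 0)); [apply runs_Clear; [lia|]| |lia].
      * replace (reg (setreg s1 (S d) w) d) with v by (unfold s1; regs). apply mac_mono, Hv.
      * eapply runs_eq; [apply runs_MoveR with (v := G 0); auto; try lia|].
        -- unfold s1; regs.
        -- unfold s1; st_eq.
  - replace (tl (map (reg s) vars)) with (map (reg s) (tl vars)) by (destruct vars; reflexivity).
    apply IH; auto. destruct vars; simpl; auto. inversion HF; auto.
  - set (v := eval G A n (map (reg s) vars)).
    assert (Hv : v <= G 0) by (apply HEV; auto).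
    pose proof (need_pos n). pose proof (need_pos b). pose proof (need_pos st).
    assert (Hz1 : reg s (d + 1) = 0) by (apply Hz; lia).
    assert (Hz2 : reg s (d + 2) = 0) by (apply Hz; lia).
    assert (Hz3 : reg s (d + 3) = 0) by (apply Hz; lia).
    eapply runs_seq with
      (t2 := cost (G 0) b + ((G 0 + 1) * (cost (G 0) st + 5 * mac (G 0)) + 2 * mac (G 0)));
      [apply IHn; auto; lia| |lia].
    fold v. set (s1 := setreg s d v).
    assert (map (reg s1) vars = map (reg s) vars) as Em.
    { apply map_agree with d; auto. intros; unfold s1; regs. }
    assert (forall k, reg s1 k <= G 0) as HM1 by (intros k; specialize (HM k); unfold s1; regs).
    assert (forall k, k < NG -> reg s1 k = G k) as HG1
      by (intros k Hk; specialize (HG k); unfold s1; regs; auto).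
    set (w := eval G A b (map (reg s) vars)).
    assert (Hw : w <= G 0) by (unfold w; apply HEV; auto).
    eapply runs_seq with (t1 := cost (G 0) b) (s2 := setreg s1 (d + 1) w); [| |apply Nat.le_refl].
    { unfold w. rewrite <- Em. apply IHb; auto; try lia.
      * apply Forall_lt_mono with d; auto. lia.
      * intros k Hk. specialize (Hz k). unfold s1; regs; apply Hz; lia. }
    set (acc := nat_rect (fun _ => nat) w
                  (fun k a => eval G A st (a :: k :: map (reg s) vars))).
    assert (Hacc : forall k, k <= v -> acc k <= G 0).
    { induction k; intros Hk; simpl; auto.
      apply ev_le; auto.
      - intros j Hj. rewrite <- HG by auto. apply HM.
      - repeat constructor; [apply IHk; lia|lia|].
        apply Forall_forall. intros y Hy. apply in_map_iff in Hy as (j & <- & _). apply HM. }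
    (* Register [d] counts down to control the loop, [d + 1] is the accumulator, and [d + 2] counts
       up because the body may read the loop index. *)
    pose (S_ := fun k => setreg (setreg (setreg s d (v - k)) (d + 1) (acc k)) (d + 2) k).
    replace (setreg s1 (d + 1) w) with (S_ 0) by (unfold S_, s1; st_eq).
    eapply runs_seq with (s2 := S_ v)
      (t1 := (G 0 + 1) * (cost (G 0) st + 5 * mac (G 0))) (t2 := 2 * mac (G 0));
      [| |apply Nat.le_refl].
    + eapply runs_weaken;
        [apply runs_For with (t := cost (G 0) st + 3 * mac (G 0)) (u := mac (G 0)); [lia| | |auto]|].
      * unfold S_; intros; regs.
      * intros k Hk. set (s2 := setreg (S_ k) d (v - S k)).
        assert (map (reg s2) ((d + 1) :: (d + 2) :: vars) = acc k :: k :: map (reg s) vars) as Em2.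
        { cbn [map]. f_equal; [unfold s2, S_; regs|]. f_equal; [unfold s2, S_; regs|].
          apply map_agree with d; auto. intros; unfold s2, S_; regs. }
        eapply runs_seq with (t1 := cost (G 0) st) (s2 := setreg s2 (d + 3) (acc (S k)))
          (t2 := 3 * mac (G 0)); [| |lia].
        { simpl acc. fold acc. rewrite <- Em2. apply IHs; auto; try lia.
          - repeat constructor; try lia. apply Forall_lt_mono with d; auto. lia.
          - intros j Hj. specialize (Hz j). unfold s2, S_; regs; apply Hz; lia.
          - intros j. specialize (HM j). specialize (Hacc k ltac:(lia)). unfold s2, S_; regs.
          - intros j Hj. specialize (HG j). unfold s2, S_; regs; auto. }
        pose proof (Hacc k ltac:(lia)) as Hak. pose proof (Hacc (S k) ltac:(lia)) as Hak1.
        set (s3 := setreg s2 (d + 3) (acc (S k))).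
        eapply runs_seq with (t1 := mac (G 0)) (t2 := 2 * mac (G 0)); [| |lia].
        { apply runs_Clear; [lia|]. apply mac_mono. unfold s3, s2, S_. clear - Hak. regs. }
        eapply runs_seq with (t1 := mac (G 0)) (t2 := mac (G 0)); [| |lia].
        { apply runs_MoveR with (v := G 0); try lia.
          unfold s3, s2, S_. clear - Hak1. regs. }
        eapply runs_eq; [apply runs_Inc; [lia|apply HU]|].
        { unfold s3, s2, S_. clear - Hk Hv. regs. }
        { unfold s3, s2, S_. clear - Hk Hv Hz3. st_eq. }
      * nia.
    + eapply runs_seq with (t1 := mac (G 0)) (t2 := mac (G 0)); [| |lia].
      { apply runs_Clear; [lia|]. apply mac_mono. unfold S_; regs. }
      pose proof (Hacc v (Nat.le_refl v)).
      eapply runs_eq; [apply runs_MoveR with (v := G 0); try lia|].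
      * unfold S_; regs.
      * unfold S_; st_eq.
Qed.

End Compile.

(** * Arithmetic and bounded quantifiers *)

Definition One : exp := Succ Zero.
Definition addE (a b : exp) : exp := Rec b a (Succ (Var 0)).
(** The accumulator is overwritten by the loop index, whose last value is [a - 1]. *)
Definition predE (a : exp) : exp := Rec a Zero (Var 1).
Definition subE (a b : exp) : exp := Rec b a (predE (Var 0)).
Definition mulE (a b : exp) : exp := LetE b (Rec (Lift a) Zero (addE (Var 0) (Var 2))).
Definition NotE (a : exp) : exp := Cond a Zero One.
Definition AndE (a b : exp) : exp := Cond a b Zero.
Definition OrE (a b : exp) : exp := Cond a One b.
Definition ImpE (a b : exp) : exp := Cond a b One.
Definition IffE (a b : exp) : exp := Cond a b (NotE b).
Definition leE (a b : exp) : exp := NotE (subE a b).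
Definition ltE (a b : exp) : exp := subE b a.
Definition eqE (a b : exp) : exp := AndE (leE a b) (leE b a).
(** [Rec] binds accumulator and index; [Lift] drops the accumulator, so that the bound variable is
    [Var 0] inside [p]. *)
Definition ExE (n p : exp) : exp := Rec n Zero (Cond (Var 0) One (Lift p)).
Definition AllE (n p : exp) : exp := NotE (ExE n (NotE p)).

(* Bound on all values, input length, base of the digit codes, number of slots,
   position of the edge matrix and position of the rule list in the input. *)
Definition gM : exp := Glob 0.
Definition gL : exp := Glob 1.
Definition gB : exp := Glob 2.
Definition gn : exp := Glob 3.
Definition gP : exp := Glob 4.
Definition gR : exp := Glob 5.

(** Subtracts the base, where possible, in each of [a] rounds. *)
Definition modB (a : exp) : exp :=
  LetE a (Rec (Var 0) (Var 0) (Cond (leE gB (Var 0)) (subE (Var 0) gB) (Var 0))).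
(** Counts the multiples of the base among [1, ..., a]. *)
Definition divB (a : exp) : exp :=
  Rec a Zero (Cond (modB (Succ (Var 1))) (Var 0) (Succ (Var 0))).
Definition digE (x k : exp) : exp := modB (Rec k x (divB (Var 0))).

Definition dg (B x k : nat) : nat := x / B ^ k mod B.

(** * Meaning of the derived operations *)

Section Arithmetic.
Variables (G : nat -> nat) (A : nat -> nat -> bool).
Notation ev := (eval G A).

Definition sat (e : exp) (env : list nat) : Prop := ev e env <> 0.

Lemma ev_Succ a env x : ev a env = x -> x < G 0 -> ev (Succ a) env = S x.
Proof. intros <- H. simpl. apply Nat.ltb_lt in H. rewrite H. reflexivity. Qed.

Lemma ev_add a b env x y : ev a env = x -> ev b env = y -> x + y <= G 0 ->
  ev (addE a b) env = x + y.
Proof.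
  intros Ea Eb. cbn [addE eval]. rewrite Ea, Eb. clear Ea Eb. revert x.
  induction y; intros x H; simpl; [lia|].
  rewrite IHy by lia. destruct (Nat.ltb_spec (x + y) (G 0)); lia.
Qed.

Lemma ev_pred a env : ev (predE a) env = pred (ev a env).
Proof. simpl. destruct (ev a env); reflexivity. Qed.

Lemma ev_sub a b env : ev (subE a b) env = ev a env - ev b env.
Proof.
  cbn [subE eval]. induction (ev b env) as [|y IH]; cbn [nat_rect]; [lia|].
  change (ev (predE (Var 0)) (nat_rect (fun _ => nat) (ev a env)
    (fun k acc => ev (predE (Var 0)) (acc :: k :: env)) y :: y :: env) = ev a env - S y).
  rewrite ev_pred. cbn [eval nth]. rewrite IH. lia.
Qed.

Lemma ev_mul a b env x y : ev a env = x -> ev b env = y -> x * y <= G 0 ->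
  ev (mulE a b) env = x * y.
Proof.
  intros Ea Eb. unfold mulE. cbn [eval tl]. rewrite Ea, Eb. clear Ea Eb.
  induction x; intros H; cbn [nat_rect]; [reflexivity|].
  rewrite IHx by lia. erewrite ev_add; [| reflexivity| reflexivity|]; simpl; lia.
Qed.

Lemma holds_nz a env x : ev a env = x -> (sat a env <-> x <> 0).
Proof. intros <-. reflexivity. Qed.

Lemma holds_lt a b env x y : ev a env = x -> ev b env = y ->
  (sat (ltE a b) env <-> x < y).
Proof. intros <- <-. unfold sat, ltE. rewrite ev_sub. lia. Qed.

(** The second equivalence may assume [P], so a later conjunct can rely on a bound asserted by an
    earlier one. In [relabelE] the partner of a slot must be known to be below [n] before its edges
    are read. *)
Lemma holds_And a b env P Q : (sat a env <-> P) -> (P -> (sat b env <-> Q)) ->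
  (sat (AndE a b) env <-> P /\ Q).
Proof.
  intros HP HQ. unfold sat, AndE in *. cbn [eval].
  destruct (Nat.eqb_spec (ev a env) 0) as [E|E]; intuition lia.
Qed.

Hypothesis HM1 : 1 <= G 0.

Lemma ev_One env : ev One env = 1.
Proof. simpl. destruct (Nat.ltb_spec 0 (G 0)); lia. Qed.

Lemma holds_Not a env P : (sat a env <-> P) -> (sat (NotE a) env <-> ~ P).
Proof.
  intros <-. unfold sat, NotE. cbn [eval].
  destruct (Nat.eqb_spec (ev a env) 0) as [E|E].
  - rewrite ev_One, E. lia.
  - lia.
Qed.

Lemma holds_Or a b env P Q : (sat a env <-> P) -> (sat b env <-> Q) ->
  (sat (OrE a b) env <-> P \/ Q).
Proof.
  intros HP HQ. unfold sat, OrE in *. cbn [eval].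
  destruct (Nat.eqb_spec (ev a env) 0) as [E|E]; rewrite ?ev_One; intuition lia.
Qed.

Lemma holds_Imp a b env P Q : (sat a env <-> P) -> (P -> (sat b env <-> Q)) ->
  (sat (ImpE a b) env <-> (P -> Q)).
Proof.
  intros HP HQ. unfold sat, ImpE in *. cbn [eval].
  destruct (Nat.eqb_spec (ev a env) 0) as [E|E]; rewrite ?ev_One; intuition lia.
Qed.

Lemma holds_Iff a b env P Q : (sat a env <-> P) -> (sat b env <-> Q) ->
  (sat (IffE a b) env <-> (P <-> Q)).
Proof.
  intros HP HQ. pose proof (holds_Not HQ) as HN.
  unfold sat, IffE in *. cbn [eval].
  destruct (Nat.eqb_spec (ev a env) 0) as [E|E]; [rewrite HN|rewrite HQ]; intuition lia.
Qed.

Lemma holds_Cond c a b env P Q R :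
  (sat c env <-> P) -> (P -> (sat a env <-> Q)) -> (~ P -> (sat b env <-> R)) ->
  (sat (Cond c a b) env <-> (P /\ Q) \/ (~ P /\ R)).
Proof.
  intros HP HQ HR. unfold sat in *. cbn [eval].
  destruct (Nat.eqb_spec (ev c env) 0) as [E|E]; intuition lia.
Qed.

Lemma holds_le a b env x y : ev a env = x -> ev b env = y ->
  (sat (leE a b) env <-> x <= y).
Proof.
  intros <- <-. unfold leE. rewrite holds_Not by (apply holds_nz, ev_sub). lia.
Qed.

Lemma holds_eq a b env x y : ev a env = x -> ev b env = y ->
  (sat (eqE a b) env <-> x = y).
Proof.
  intros Ha Hb. unfold eqE.
  rewrite holds_And by (intros; apply holds_le; eassumption). lia.
Qed.

Lemma holds_Ex n p env N P : ev n env = N ->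
  (forall i, i < N -> (sat p (i :: env) <-> P i)) ->
  (sat (ExE n p) env <-> exists i, i < N /\ P i).
Proof.
  intros En HP. unfold sat, ExE in *. cbn [eval tl nth]. rewrite En. clear En.
  induction N as [|N IH]; cbn [nat_rect].
  - split; [lia|]. intros (i & Hi & _); lia.
  - specialize (IH ltac:(intros; apply HP; lia)).
    destruct (Nat.eqb_spec (nat_rect (fun _ => nat) 0
       (fun k acc => if acc =? 0 then eval G A p (k :: env) else eval G A One (acc :: k :: env))
       N) 0) as [E|E].
    + rewrite HP by lia. split.
      * intros H. exists N. auto.
      * intros (i & Hi & Hp). destruct (Nat.eq_dec i N) as [->|]; auto.
        exfalso. apply IH in E; auto. exists i. split; [lia|auto].
    + rewrite ev_One. split; [|lia]. intros _. apply IH in E as (i & Hi & Hp).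
      exists i. auto.
Qed.

Lemma holds_All n p env N (P : nat -> Prop) : ev n env = N ->
  (forall i, i < N -> (sat p (i :: env) <-> P i)) ->
  (sat (AllE n p) env <-> forall i, i < N -> P i).
Proof.
  intros En HP. unfold AllE.
  rewrite holds_Not.
  2: { apply holds_Ex with (P := fun i => ~ sat p (i :: env)); [exact En|].
       intros i Hi. apply holds_Not. reflexivity. }
  split.
  - intros H i Hi. apply HP; auto. unfold sat.
    destruct (Nat.eq_dec (ev p (i :: env)) 0) as [E|]; auto.
    exfalso. apply H. exists i. split; auto.
  - intros H (i & Hi & Hn). apply Hn, HP; auto.
Qed.

Hypothesis HB : 1 <= G 2.

Lemma ev_modB a env : ev (modB a) env = ev a env mod G 2.
Proof.
  unfold modB. cbn [eval nth]. set (x := ev a env).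
  set (g := fun k acc => _).
  assert (forall j y, nat_rect (fun _ => nat) y g j = if y <? j * G 2 then y mod G 2
            else y - j * G 2) as Hit.
  { assert (forall k acc, g k acc = if acc <? G 2 then acc else acc - G 2) as Hg.
    { intros k acc. unfold g.
      destruct (Nat.eqb_spec (ev (leE gB (Var 0)) (acc :: k :: x :: env)) 0) as [E|E].
      - assert (~ (G 2 <= acc)) as Hl
          by (intros Hl; apply (@holds_le gB (Var 0) (acc :: k :: x :: env) (G 2) acc) in Hl; auto).
        change (acc = if acc <? G 2 then acc else acc - G 2).
        destruct (Nat.ltb_spec acc (G 2)); lia.
      - apply (@holds_le gB (Var 0) (acc :: k :: x :: env) (G 2) acc) in E; auto.
        change (ev (subE (Var 0) gB) (acc :: k :: x :: env)
          = if acc <? G 2 then acc else acc - G 2).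
        rewrite ev_sub. cbn [eval gB nth].
        change (2 <? NG) with true. cbv iota.
        destruct (Nat.ltb_spec acc (G 2)); lia. }
    induction j; intros y; cbn [nat_rect].
    - simpl. destruct (Nat.ltb_spec y 0); lia.
    - rewrite IHj, Hg.
      destruct (Nat.ltb_spec y (j * G 2)) as [H|H].
      + pose proof (Nat.mod_upper_bound y (G 2) ltac:(lia)).
        destruct (Nat.ltb_spec (y mod G 2) (G 2)); [|lia].
        destruct (Nat.ltb_spec y (S j * G 2)); [reflexivity|simpl in *; lia].
      + destruct (Nat.ltb_spec (y - j * G 2) (G 2)).
        * destruct (Nat.ltb_spec y (S j * G 2)); [|simpl in *; lia].
          apply (Nat.mod_unique y (G 2) j); lia.
        * destruct (Nat.ltb_spec y (S j * G 2)); simpl in *; lia. }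
  (* The [x] subtractions reach the remainder by the first case of [Hit] unless [x = 0] or the base
     is 1. *)
  rewrite Hit. destruct (Nat.ltb_spec x (x * G 2)); [reflexivity|].
  destruct x as [|x].
  - rewrite Nat.Div0.mod_0_l. lia.
  - assert (G 2 = 1) as E by nia. rewrite E, Nat.mod_1_r. lia.
Qed.

Lemma div_succ k b : 1 <= b ->
  S k / b = if S k mod b =? 0 then S (k / b) else k / b.
Proof.
  intros Hb. pose proof (Nat.div_mod k b ltac:(lia)) as E.
  pose proof (Nat.mod_upper_bound k b ltac:(lia)) as Hr.
  destruct (Nat.eq_dec (S (k mod b)) b) as [Er|Er].
  - assert (S k = b * S (k / b) + 0) as E' by lia.
    rewrite <- (Nat.mod_unique (S k) b (S (k / b)) 0) by lia.
    rewrite <- (Nat.div_unique (S k) b (S (k / b)) 0) by lia. reflexivity.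
  - rewrite <- (Nat.mod_unique (S k) b (k / b) (S (k mod b))) by lia.
    rewrite <- (Nat.div_unique (S k) b (k / b) (S (k mod b))) by lia. reflexivity.
Qed.

Lemma ev_divB a env x : ev a env = x -> x <= G 0 -> ev (divB a) env = x / G 2.
Proof.
  intros Ea Hx. unfold divB. cbn [eval nth]. rewrite Ea. clear Ea.
  assert (forall k, k <= x -> nat_rect (fun _ => nat) 0 (fun k acc =>
     if ev (modB (Succ (Var 1))) (acc :: k :: env) =? 0
     then if acc <? G 0 then S acc else acc else acc) k = k / G 2) as H.
  { induction k; intros Hk; cbn [nat_rect].
    - rewrite Nat.Div0.div_0_l. reflexivity.
    - rewrite IHk by lia. rewrite ev_modB.
      rewrite (@ev_Succ (Var 1) (k / G 2 :: k :: env) k) by (auto; lia).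
      rewrite div_succ by auto.
      destruct (S k mod G 2 =? 0); [|reflexivity].
      assert (k / G 2 <= k) by (apply Nat.Div0.div_le_upper_bound; nia).
      destruct (Nat.ltb_spec (k / G 2) (G 0)); lia. }
  exact (H x (Nat.le_refl x)).
Qed.

Lemma ev_dig a b env x k : ev a env = x -> ev b env = k -> x <= G 0 ->
  ev (digE a b) env = dg (G 2) x k.
Proof.
  intros Ea Eb Hx. unfold digE, dg. rewrite ev_modB. f_equal.
  change (nat_rect (fun _ => nat) (ev a env)
    (fun k acc => ev (divB (Var 0)) (acc :: k :: env)) (ev b env) = x / G 2 ^ k).
  rewrite Ea, Eb. clear Ea Eb. induction k; cbn [nat_rect Nat.pow].
  - rewrite Nat.div_1_r. reflexivity.
  - rewrite IHk. rewrite Nat.mul_comm, <- Nat.Div0.div_div.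
    apply ev_divB; [reflexivity|].
    assert (x / G 2 ^ k <= x); [|lia]. apply Nat.Div0.div_le_upper_bound.
    assert (G 2 ^ k <> 0) by (apply Nat.pow_nonzero; lia). nia.
Qed.
End Arithmetic.

Lemma dg_lt B x k : 1 <= B -> dg B x k < B.
Proof. intros. apply Nat.mod_upper_bound. lia. Qed.

(** Finite choice in arithmetic: witnesses for the single digits are packed into one number. Cuts,
    pairings, tuples and positions are all obtained in this way. *)
Lemma digit_choice B m (Q : nat -> nat -> Prop) : 1 <= B ->
  (forall k, k < m -> exists d, d < B /\ Q k d) ->
  exists x, x < B ^ m /\ forall k, k < m -> Q k (dg B x k).
Proof.
  intros HB. induction m as [|m IH]; intros HQ.
  - exists 0. simpl. split; [lia|]. intros; lia.
  - destruct IH as (x & Hx & Hd); [intros; apply HQ; lia|].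
    destruct (HQ m) as (d & Hlt & Hqd); [lia|].
    assert (B ^ m <> 0) as Hp by (apply Nat.pow_nonzero; lia).
    exists (d * B ^ m + x). split; [simpl; nia|].
    intros k Hk. unfold dg. destruct (Nat.eq_dec k m) as [->|Hne].
    + rewrite Nat.div_add_l by auto. rewrite (Nat.div_small x) by auto.
      rewrite Nat.add_0_r, Nat.mod_small; auto.
    + replace (d * B ^ m) with (d * B ^ (m - S k) * B * B ^ k).
      2: { replace m with (m - S k + (1 + k)) at 2 by lia.
           rewrite !Nat.pow_add_r, Nat.pow_1_r. ring. }
      rewrite Nat.div_add_l by (apply Nat.pow_nonzero; lia).
      rewrite Nat.add_comm, Nat.Div0.mod_add. apply Hd. lia.
Qed.

(** * Reading encoded data *)

Fixpoint bval (bs : list bool) : nat :=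
  match bs with [] => 0 | b :: bs => Nat.b2n b + 2 * bval bs end.

Lemma bval_bits_aux fuel : forall n, n <= fuel -> bval (bits_aux fuel n) = n.
Proof.
  induction fuel; intros n Hn; simpl.
  - lia.
  - destruct (Nat.eqb_spec n 0) as [->|]; [reflexivity|].
    cbn [bval]. rewrite IHfuel.
    + pose proof (Nat.div2_odd n). lia.
    + pose proof (Nat.div2_decr n fuel). lia.
Qed.

Lemma bval_skipn bs i b : nth_error bs i = Some b ->
  bval (skipn i bs) = Nat.b2n b + 2 * bval (skipn (S i) bs).
Proof.
  revert i; induction bs as [|c bs IH]; intros [|i] H; simpl in *; try discriminate.
  - injection H as ->. reflexivity.
  - apply IH, H.
Qed.

Lemma bval_skipn_le bs i : bval (skipn i bs) <= bval bs.
Proof.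
  revert i; induction bs as [|c bs IH]; intros [|i]; simpl; try lia.
  specialize (IH i). lia.
Qed.

Lemma bval_lt bs : bval bs < 2 ^ length bs.
Proof. induction bs as [|[] bs IH]; simpl in *; lia. Qed.

Definition nbits (v : nat) : list bool := bits_aux v v.

Lemma length_enc_nat v : length (enc_nat v) = 2 * length (nbits v) + 1.
Proof.
  unfold enc_nat, nbits. rewrite length_app. simpl. f_equal.
  induction (bits_aux v v); simpl in *; lia.
Qed.

(** Labels are written in binary, so they may be exponential in the input length; this bound is why
    a digit gets about as many bits as the input has. *)
Lemma enc_nat_value_lt v : v < 2 ^ length (enc_nat v).
Proof.
  rewrite length_enc_nat.
  rewrite <- (bval_bits_aux (Nat.le_refl v)) at 1.
  eapply Nat.lt_le_trans; [apply bval_lt|]. apply Nat.pow_le_mono_r; unfold nbits; lia.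
Qed.

(** Each bit is preceded by [true], hence the steps of two. There are fewer bits than [gL], and the
    surplus rounds idle at the terminating [false]. *)
Definition natEndE (p : exp) : exp :=
  Succ (Rec gL p (Cond (Orc false (Var 0)) (Succ (Succ (Var 0))) (Var 0))).

(* Horner's rule from the most significant bit, at distance [2 * j + 2] from the end. *)
Definition natValE (p : exp) : exp :=
  LetE p (LetE (natEndE (Var 0)) (Rec gL Zero
    (LetE (subE (Var 2) (Succ (Succ (addE (Var 1) (Var 1)))))
      (Cond (ltE (Var 4) (Var 0)) (addE (addE (Var 1) (Var 1)) (Orc false (Var 0))) (Var 1))))).

(* Position of the [i]-th item of a list of pairs encoded at [p]. *)
Definition pairPosE (i p : exp) : exp :=
  Rec i p (Cond (Orc false (Var 0)) (natEndE (natEndE (Succ (Var 0)))) (Var 0)).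
(** Asking for an item beyond the last one stops at the terminator of the list. *)
Definition listEndE (p : exp) : exp := Succ (pairPosE gL p).
(** Without movement rules the first tag bit alone separates creation from relabeling. *)
Definition ruleEndE (q : exp) : exp :=
  LetE (Succ (Succ q)) (Cond (Lift (Orc false q)) (natEndE (listEndE (Var 0)))
    (natEndE (natEndE (natEndE (natEndE (Var 0)))))).
Definition rulePosE (i : exp) : exp :=
  Rec i gR (Cond (Orc false (Var 0)) (ruleEndE (Succ (Var 0))) (Var 0)).
(** Starts behind the node count; the two successors skip the activity and strength bits in front of
    a label. *)
Definition nodePosE (k : exp) : exp :=
  Rec k (natEndE Zero) (natEndE (Succ (Succ (Var 0)))).

Lemma length_list_le X (e : X -> list bool) l : length l < length (enc_list e l).
Proof.
  unfold enc_list. rewrite length_app. simpl.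
  induction l; simpl; [lia|]. rewrite length_app. lia.
Qed.

Lemma firstn_split X (l : list X) i x : nth_error l i = Some x ->
  exists l2, l = firstn i l ++ x :: l2 /\ firstn (S i) l = firstn i l ++ [x].
Proof.
  intros E. destruct (nth_error_split l i E) as (l1 & l2 & -> & <-). exists l2.
  rewrite !firstn_app, firstn_all, Nat.sub_diag.
  replace (S (length l1) - length l1) with 1 by lia.
  rewrite (@firstn_all2 X (S (length l1)) l1) by lia. simpl. rewrite app_nil_r. auto.
Qed.

(** * Correctness of the parsing expressions *)

Section Parsing.
Variables (G : nat -> nat) (A : nat -> nat -> bool).
Notation ev := (eval G A).

Definition at_pos (p : nat) (l : list bool) : Prop :=
  forall k b, nth_error l k = Some b -> A 0 (p + k) = b.

Lemma at_app p l1 l2 : at_pos p (l1 ++ l2) <-> at_pos p l1 /\ at_pos (p + length l1) l2.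
Proof.
  split.
  - intros H. split.
    + intros k b Hk. apply H. apply nth_error_app_l, Hk.
    + intros k b Hk. rewrite <- Nat.add_assoc. apply H.
      rewrite nth_error_app2 by lia. rewrite <- Hk. f_equal. lia.
  - intros [H1 H2] k b Hk. destruct (Nat.lt_ge_cases k (length l1)).
    + rewrite nth_error_app1 in Hk by auto. auto.
    + rewrite nth_error_app2 in Hk by auto. apply H2 in Hk. rewrite <- Hk. f_equal. lia.
Qed.

Lemma at_cons p b l : at_pos p (b :: l) <-> A 0 p = b /\ at_pos (S p) l.
Proof.
  rewrite (at_app p [b] l). simpl. rewrite Nat.add_1_r.
  split; intros [H1 H2]; split; auto.
  - rewrite <- (H1 0 b eq_refl). f_equal; lia.
  - intros [|k] c Hk; simpl in Hk; [|destruct k; discriminate].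
    injection Hk as <-. rewrite Nat.add_0_r. auto.
Qed.

Lemma at_nat_bits p v : at_pos p (enc_nat v) ->
  (forall i b, nth_error (nbits v) i = Some b ->
     A 0 (p + 2 * i) = true /\ A 0 (p + 2 * i + 1) = b) /\
  A 0 (p + 2 * length (nbits v)) = false.
Proof.
  unfold enc_nat, nbits. generalize (bits_aux v v) as bs. clear v.
  intros bs. revert p. induction bs as [|c bs IH]; intros p H; simpl in H.
  - rewrite at_cons in H. split.
    + intros [|i] b Hi; discriminate.
    + simpl. rewrite Nat.add_0_r. apply H.
  - rewrite !at_cons in H. destruct H as (H0 & H1 & H2). apply IH in H2 as [H2 H3]. split.
    + intros [|i] b Hi; simpl in Hi.
      * injection Hi as <-. simpl. rewrite Nat.add_0_r, Nat.add_1_r. auto.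
      * apply H2 in Hi. replace (p + 2 * S i) with (S (S p) + 2 * i) by lia. exact Hi.
    + rewrite <- H3. f_equal. simpl. lia.
Qed.

(** Keeps [Succ] from saturating: the parsers form positions up to [G 1] and, in [natValE], the
    offset [2 * k + 2] for [k < G 1]. *)
Hypothesis HM : 2 * G 1 + 4 <= G 0.

Lemma ev_natEnd a env p v : ev a env = p -> at_pos p (enc_nat v) ->
  p + length (enc_nat v) <= G 1 -> ev (natEndE a) env = p + length (enc_nat v).
Proof.
  intros Ea Hat HL. apply at_nat_bits in Hat as [H1 H2].
  rewrite length_enc_nat in *. unfold natEndE.
  rewrite ev_Succ with (x := p + 2 * length (nbits v)); [lia| |lia].
  cbn [eval gL nth]. change (1 <? NG) with true. cbv iota. rewrite Ea. clear Ea.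
  set (g := fun k acc : nat => _).
  assert (Hg : forall k, nat_rect (fun _ => nat) p g k = p + 2 * Nat.min k (length (nbits v))).
  { induction k; cbn [nat_rect]; [simpl; lia|]. rewrite IHk. unfold g.
    cbn [Nat.b2n]. destruct (Nat.lt_ge_cases k (length (nbits v))) as [Hk|Hk].
    - rewrite !Nat.min_l by lia.
      destruct (nth_error (nbits v) k) as [b|] eqn:E; [|apply nth_error_None in E; lia].
      apply H1 in E as [-> _]. cbn [Nat.b2n Nat.eqb].
      destruct (Nat.ltb_spec (p + 2 * k) (G 0)); [|lia].
      destruct (Nat.ltb_spec (S (p + 2 * k)) (G 0)); lia.
    - rewrite !Nat.min_r by lia. rewrite H2. reflexivity. }
  rewrite Hg, Nat.min_r; lia.
Qed.

Lemma ev_natVal a env p v : ev a env = p -> at_pos p (enc_nat v) ->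
  p + length (enc_nat v) <= G 1 -> v <= G 0 -> ev (natValE a) env = v.
Proof.
  intros Ea Hat HL Hv. unfold natValE. cbn [eval]. rewrite Ea.
  rewrite (@ev_natEnd (Var 0) (p :: env) p v) by auto.
  apply at_nat_bits in Hat as [H1 H2].
  rewrite length_enc_nat in *. set (n := length (nbits v)) in *.
  assert (Hbv : bval (nbits v) = v) by (apply bval_bits_aux; auto).
  change (ev gL (p + (2 * n + 1) :: p :: env)) with (G 1).
  set (g := fun k acc : nat => _).
  assert (Hg : forall k, k <= G 1 ->
    nat_rect (fun _ => nat) 0 g k = bval (skipn (n - k) (nbits v))).
  { induction k; intros Hk; cbn [nat_rect].
    - rewrite Nat.sub_0_r. unfold n. rewrite skipn_all. reflexivity.
    - rewrite IHk by lia. clear IHk.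
      (* The guard holds exactly while bits remain, that is for [k < n]; afterwards the computed
         address is at most [p] and the rounds idle. *)
      assert (forall acc, g k acc = if p <? p + (2 * n + 1) - S (S (k + k))
         then ev (addE (addE (Var 1) (Var 1)) (Orc false (Var 0)))
           ((p + (2 * n + 1) - S (S (k + k))) :: acc :: k :: (p + (2 * n + 1)) :: p :: env)
         else acc) as Hgk.
      { intros acc. unfold g.
        assert (ev (subE (Var 2) (Succ (Succ (addE (Var 1) (Var 1)))))
          (acc :: k :: (p + (2 * n + 1)) :: p :: env) = p + (2 * n + 1) - S (S (k + k))) as Es.
        { rewrite ev_sub. f_equal. apply ev_Succ; [|lia]. apply ev_Succ; [|lia].
          apply ev_add; auto. lia. }
        rewrite Es.
        set (q := p + (2 * n + 1) - S (S (k + k))) in *.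
        pose proof (@holds_lt G A (Var 4) (Var 0)
          (q :: acc :: k :: p + (2 * n + 1) :: p :: env) p q eq_refl eq_refl) as Hlt.
        unfold sat in Hlt.
        destruct (Nat.eqb_spec (ev (ltE (Var 4) (Var 0))
          (q :: acc :: k :: p + (2 * n + 1) :: p :: env)) 0) as [E|E];
        destruct (Nat.ltb_spec p q); try reflexivity; exfalso; intuition lia. }
      rewrite Hgk. clear Hgk.
      destruct (Nat.lt_ge_cases k n) as [Hkn|Hkn].
      + destruct (Nat.ltb_spec p (p + (2 * n + 1) - S (S (k + k)))); [|lia].
        destruct (nth_error (nbits v) (n - S k)) as [b|] eqn:E;
          [|apply nth_error_None in E; unfold n in *; lia].
        pose proof (bval_skipn _ _ E) as Hb.
        replace (S (n - S k)) with (n - k) in Hb by lia.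
        apply H1 in E as [_ E].
        pose proof (bval_skipn_le (nbits v) (n - S k)). rewrite Hbv in *.
        rewrite Hb.
        erewrite ev_add.
        2: { apply ev_add; [reflexivity|reflexivity|]. cbn [eval nth]. lia. }
        2: { cbn [eval nth Nat.b2n].
             replace (p + (2 * n + 1) - S (S (k + k))) with (p + 2 * (n - S k) + 1) by lia.
             rewrite E. reflexivity. }
        all: cbn [eval nth]; lia.
      + destruct (Nat.ltb_spec p (p + (2 * n + 1) - S (S (k + k)))); [lia|].
        f_equal. f_equal. lia. }
  rewrite Hg by lia. replace (n - G 1) with 0 by lia. exact Hbv.
Qed.

(** Common to rule lists and pair lists: [F] skips one item, and after the last item the loop idles
    at the terminator. *)
Lemma chain_list X (e : X -> list bool) (F : nat -> nat -> nat) (l : list X) p :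
  (forall k q x, In x l -> at_pos (S q) (e x) -> S q + length (e x) <= G 1 ->
     F k q = S q + length (e x)) ->
  at_pos p (enc_list e l) -> p + length (enc_list e l) <= G 1 ->
  forall i, nat_rect (fun _ => nat) p
      (fun k acc => if Nat.b2n (A 0 acc) =? 0 then acc else F k acc) i
    = p + length (flat_map (fun x => true :: e x) (firstn i l)).
Proof.
  intros HF Hat HL i.
  induction i; cbn [nat_rect]; [simpl; lia|]. rewrite IHi. clear IHi.
  unfold enc_list in *.
  destruct (nth_error l i) as [x|] eqn:E.
  - destruct (firstn_split l i E) as (l2 & El & E2).
    rewrite E2, flat_map_app, length_app. rewrite El in Hat, HL.
    rewrite flat_map_app in Hat, HL. simpl in Hat, HL.
    rewrite !length_app in HL. simpl in HL. rewrite length_app in HL.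
    rewrite <- app_assoc in Hat. apply at_app in Hat as [_ Hat]. simpl in Hat.
    rewrite at_cons, <- app_assoc, at_app in Hat. destruct Hat as (-> & Hx & _).
    cbn [Nat.b2n Nat.eqb]. rewrite HF with (x := x); auto.
    + simpl. rewrite app_nil_r. lia.
    + eapply nth_error_In; eauto.
    + lia.
  - apply nth_error_None in E. rewrite !firstn_all2 by lia.
    apply at_app in Hat as [_ Hat]. rewrite at_cons in Hat. destruct Hat as [-> _].
    reflexivity.
Qed.

Lemma at_list_item X (e : X -> list bool) (l : list X) p i x :
  at_pos p (enc_list e l) -> p + length (enc_list e l) <= G 1 -> nth_error l i = Some x ->
  let q := p + length (flat_map (fun x => true :: e x) (firstn i l)) in
  A 0 q = true /\ at_pos (S q) (e x) /\ S q + length (e x) <= G 1.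
Proof.
  intros Hat HL E. unfold enc_list in *.
  destruct (firstn_split l i E) as (l2 & El & _). rewrite El in Hat, HL.
  rewrite flat_map_app in Hat, HL. simpl in Hat, HL.
  rewrite !length_app in HL. simpl in HL. rewrite length_app in HL.
  rewrite <- app_assoc in Hat. apply at_app in Hat as [_ Hat]. simpl in Hat.
  rewrite at_cons, <- app_assoc, at_app in Hat. destruct Hat as (Hq & Hx & _).
  repeat split; auto. lia.
Qed.

Lemma at_list_end X (e : X -> list bool) (l : list X) p i :
  at_pos p (enc_list e l) -> length l <= i ->
  A 0 (p + length (flat_map (fun x => true :: e x) (firstn i l))) = false.
Proof.
  intros Hat Hi. rewrite firstn_all2 by auto.
  apply at_app in Hat as [_ Hat]. rewrite at_cons in Hat. apply Hat.
Qed.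

Definition enc_pair (p : nat * nat) : list bool := enc_nat (fst p) ++ enc_nat (snd p).
Definition pair_pos (pp : list (nat * nat)) (p i : nat) : nat :=
  p + length (flat_map (fun x => true :: enc_pair x) (firstn i pp)).

Lemma ev_two_nats a env q x y : ev a env = q -> at_pos q (enc_nat x ++ enc_nat y) ->
  q + length (enc_nat x ++ enc_nat y) <= G 1 ->
  ev (natEndE (natEndE a)) env = q + length (enc_nat x ++ enc_nat y).
Proof.
  intros Ea Hat HL. rewrite at_app in Hat. rewrite length_app in *.
  rewrite ev_natEnd with (p := q + length (enc_nat x)) (v := y);
    [lia| |apply Hat|lia].
  apply ev_natEnd; try tauto. lia.
Qed.

Lemma ev_pairPos a b env pp p i : ev a env = i -> ev b env = p ->
  at_pos p (enc_list enc_pair pp) -> p + length (enc_list enc_pair pp) <= G 1 ->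
  ev (pairPosE a b) env = pair_pos pp p i.
Proof.
  intros Ea Eb Hat HL. unfold pairPosE. cbn [eval]. rewrite Ea, Eb. clear Ea Eb.
  apply (@chain_list _ enc_pair
    (fun k acc => ev (natEndE (natEndE (Succ (Var 0)))) (acc :: k :: env))); auto.
  intros k q x _ Hx Hq. apply ev_two_nats; auto.
  apply ev_Succ; auto. unfold enc_pair in *. lia.
Qed.

Lemma ev_listEnd b env pp p : ev b env = p ->
  at_pos p (enc_list enc_pair pp) -> p + length (enc_list enc_pair pp) <= G 1 ->
  ev (listEndE b) env = p + length (enc_list enc_pair pp).
Proof.
  intros Eb Hat HL. pose proof (length_list_le enc_pair pp).
  assert (pair_pos pp p (G 1) = pred (p + length (enc_list enc_pair pp))) as E.
  { unfold pair_pos. rewrite firstn_all2 by lia. unfold enc_list. rewrite length_app.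
    simpl. lia. }
  unfold listEndE. rewrite ev_Succ with (x := pair_pos pp p (G 1)); [lia| |lia].
  apply ev_pairPos; auto.
Qed.

Lemma ev_ruleEnd a env q r : ~ is_move r -> ev a env = q -> at_pos q (enc_rule r) ->
  q + length (enc_rule r) <= G 1 -> ev (ruleEndE a) env = q + length (enc_rule r).
Proof.
  intros Hr Ea Hat HL. unfold ruleEndE. cbn [eval tl].
  assert (ev (Succ (Succ a)) env = S (S q)) as E2.
  { destruct r; simpl in HL; rewrite ?length_app in HL; simpl in HL;
      (apply ev_Succ; [apply ev_Succ; [auto|lia]|lia]). }
  change (ev (Cond (Lift (Orc false a)) (natEndE (listEndE (Var 0)))
    (natEndE (natEndE (natEndE (natEndE (Var 0)))))) (ev (Succ (Succ a)) env :: env) =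
    q + length (enc_rule r)).
  rewrite E2. cbn [eval tl Nat.b2n]. rewrite Ea.
  destruct r as [x y z w| |pp c s]; [| exfalso; apply Hr; exact I |].
  - simpl enc_rule in *. rewrite !at_cons in Hat. destruct Hat as (-> & _ & Hat).
    cbn [Nat.b2n Nat.eqb]. rewrite app_assoc in Hat, HL |- *.
    simpl length in *. rewrite at_app in Hat. rewrite !length_app in *.
    erewrite ev_two_nats; [| |exact (proj2 Hat)|rewrite length_app; lia]; [rewrite length_app; lia|].
    erewrite ev_two_nats; [| |exact (proj1 Hat)|]; rewrite ?length_app; auto; lia.
  - simpl enc_rule in *. rewrite !at_cons in Hat. destruct Hat as (-> & _ & Hat).
    cbn [Nat.b2n Nat.eqb]. rewrite at_app in Hat. simpl length in *. rewrite !length_app in *.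
    fold enc_pair in *.
    erewrite ev_natEnd; [| |exact (proj2 Hat)|]; [lia| |lia].
    apply ev_listEnd; auto; [apply Hat|lia].
Qed.

Definition rule_pos (R : list rule) (i : nat) : nat :=
  G 5 + length (flat_map (fun x => true :: enc_rule x) (firstn i R)).

Lemma ev_rulePos a env R i : no_move R -> ev a env = i ->
  at_pos (G 5) (enc_list enc_rule R) -> G 5 + length (enc_list enc_rule R) <= G 1 ->
  ev (rulePosE a) env = rule_pos R i.
Proof.
  intros HR Ea Hat HL. unfold rulePosE. cbn [eval]. rewrite Ea. clear Ea.
  apply (@chain_list _ enc_rule
    (fun k acc => ev (ruleEndE (Succ (Var 0))) (acc :: k :: env))); auto.
  intros k q x Hin Hx Hq. apply ev_ruleEnd; auto.
  apply ev_Succ; auto. lia.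
Qed.

Definition enc_node (N : network) (v : nat) : list bool :=
  act N v :: strong N v :: enc_nat (lab N v).
Definition node_pos (N : network) (k : nat) : nat :=
  length (enc_nat (length (nodes N))) +
  length (flat_map (enc_node N) (firstn k (nodes N))).

Lemma at_node N k v : at_pos 0 (enc_network N) -> length (enc_network N) <= G 1 ->
  nth_error (nodes N) k = Some v ->
  at_pos (node_pos N k) (enc_node N v) /\
  node_pos N (S k) = node_pos N k + length (enc_node N v) /\ node_pos N (S k) <= G 1.
Proof.
  intros Hat HL E. unfold enc_network in *.
  destruct (firstn_split _ _ E) as (l2 & El & E2).
  unfold node_pos. rewrite E2, flat_map_app.
  change (flat_map (fun v => act N v :: strong N v :: enc_nat (lab N v)))
    with (flat_map (enc_node N)) in *.
  apply at_app in Hat as [_ Hat]. apply at_app in Hat as [Hat _].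
  rewrite !length_app in HL.
  assert (flat_map (enc_node N) (nodes N) = flat_map (enc_node N) (firstn k (nodes N)) ++
    enc_node N v ++ flat_map (enc_node N) l2) as Ef
    by (rewrite El at 1; rewrite flat_map_app; reflexivity).
  rewrite Ef in Hat, HL. rewrite !length_app in HL.
  apply at_app in Hat as [_ Hat]. apply at_app in Hat as [Hat _].
  rewrite length_app. cbn [flat_map]. rewrite app_nil_r.
  split; [exact Hat|]. lia.
Qed.

Lemma ev_nodePos a env N k : at_pos 0 (enc_network N) -> length (enc_network N) <= G 1 ->
  k <= length (nodes N) -> ev a env = k -> ev (nodePosE a) env = node_pos N k.
Proof.
  intros Hat HL Hk Ea. unfold nodePosE. cbn [eval]. rewrite Ea. clear Ea.
  induction k; cbn [nat_rect].
  - unfold node_pos. cbn [firstn flat_map length]. rewrite Nat.add_0_r.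
    unfold enc_network in *. rewrite length_app in HL.
    change (length (enc_nat (length (nodes N)))) with (0 + length (enc_nat (length (nodes N)))).
    apply ev_natEnd; auto; [|lia]. apply at_app in Hat. apply Hat.
  - rewrite IHk by lia.
    destruct (nth_error (nodes N) k) as [v|] eqn:E; [|apply nth_error_None in E; lia].
    destruct (at_node _ _ Hat HL E) as (H1 & H2 & H3).
    unfold enc_node in H1. rewrite !at_cons in H1. destruct H1 as (_ & _ & H1).
    rewrite H2 in *. unfold enc_node in *. simpl length in *.
    rewrite ev_natEnd with (p := S (S (node_pos N k))) (v := lab N v); auto; try lia.
    apply ev_Succ; [apply ev_Succ; auto; lia|lia].
Qed.

End Parsing.

(** * Positions and moves as formulas *)

(* A position with [n] slots is coded by a number [x] in base [B]: digit [k] is the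
   state of slot [k] (0 free, 1 weak, 2 strong), digit [n + k] its label and
   digit [2 n + k n + l] tells whether slots [k] and [l] are adjacent. *)
Section Coding.
Variables n B M L : nat.
Notation dg := (dg B).

(** The states after the deletion of slot [e]. Slots are below [n], so [e = n] stands for no
    deletion. *)
Definition vst (x e k : nat) : nat := if k =? e then 0 else dg x k.
Definition vlb (x k : nat) : nat := dg x (n + k).
Definition ved (x k l : nat) : nat := dg x (n + n + (k * n + l)).

(** Connectedness without reachability: a set of slots, coded by the nonzero digits of [X], with
    live slots inside and outside must be crossed by an edge. *)
Definition CutFree (s : nat -> nat) (ed : nat -> nat -> nat) : Prop :=
  forall X, X < M ->
    (exists i, i < n /\ s i <> 0 /\ dg X i <> 0) ->
    (exists j, j < n /\ s j <> 0 /\ ~ dg X j <> 0) ->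
    exists i, i < n /\ exists j, j < n /\
      s i <> 0 /\ s j <> 0 /\ dg X i <> 0 /\ ~ dg X j <> 0 /\ ed i j <> 0.

Section Moves.
Variables (s l : nat -> nat) (ed : nat -> nat -> nat).
Variables (zs zl : nat -> nat) (zed : nat -> nat -> nat).

Definition SkipRel : Prop :=
  forall k, k < n -> zs k = s k /\ zl k = l k /\ forall h, h < n -> zed k h = ed k h.

(* [dg m k = S t] says that slots [k] and [t] form a relabeled pair. *)
Definition RelabelRel (a b c d : nat) : Prop :=
  exists m, m < M /\ forall k, k < n ->
    zs k = s k /\ (forall h, h < n -> zed k h = ed k h) /\
    (dg m k <> 0 ->
      pred (dg m k) < n /\ pred (dg m k) <> k /\ s k <> 0 /\ s (pred (dg m k)) <> 0 /\
      ed k (pred (dg m k)) <> 0 /\ l k = a /\ l (pred (dg m k)) = b /\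
      dg m (pred (dg m k)) = 0 /\ (forall h, h < n -> dg m h = dg m k -> h = k) /\
      zl k = c) /\
    (forall h, h < n -> dg m h = S k -> zl k = d) /\
    (dg m k = 0 -> (forall h, h < n -> dg m h <> S k) -> zl k = l k).

Definition CreateRel (pp : list (nat * nat)) (c : nat) (sb : bool) : Prop :=
  exists u, u < M /\ exists j, j < n /\ s j = 0 /\
    (forall i, i < L -> i < length pp ->
       dg u i < n /\ s (dg u i) = 2 /\ l (dg u i) = fst (nth i pp (0, 0)) /\
       forall i', i' < i -> dg u i' <> dg u i) /\
    zs j = (if sb then 2 else 1) /\ zl j = c /\
    forall k, k < n ->
      (k <> j -> zs k = s k /\
        (forall i, i < L -> i < length pp -> dg u i = k -> zl k = snd (nth i pp (0, 0))) /\
        ((forall i, i < L -> i < length pp -> dg u i <> k) -> zl k = l k)) /\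
      forall h, h < n ->
        (k = j /\ (zed k h <> 0 <-> exists i, i < L /\ i < length pp /\ dg u i = h)) \/
        (k <> j /\
          ((h = j /\ (zed k h <> 0 <-> exists i, i < L /\ i < length pp /\ dg u i = k)) \/
           (h <> j /\ zed k h = ed k h))).

Definition RuleRel (r : rule) : Prop :=
  match r with
  | Relabel a b c d => RelabelRel a b c d
  | Create pp c sb => CreateRel pp c sb
  | Move _ _ => False
  end.

End Moves.

Definition SuccRel (R : list rule) (x e z : nat) : Prop :=
  SkipRel (vst x e) (vlb x) (ved x) (dg z) (vlb z) (ved z) \/
  exists i, i < L /\ i < length R /\
    RuleRel (vst x e) (vlb x) (ved x) (dg z) (vlb z) (ved z) (nth i R (Move 0 0)).

(** Connectedness is tested before the deletion, with [vst x n], and after it, with [vst x e]. After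
    the answer of Constructor it is left to the step at the successor [z]. *)
Definition LoseStep (R : list rule) (T : nat -> bool) (x : nat) : Prop :=
  ~ CutFree (vst x n) (ved x) \/
  exists e, e < n /\ dg x e = 1 /\
    (~ CutFree (vst x e) (ved x) \/ forall z, z < M -> SuccRel R x e z -> T z = true).

Definition InitRel (N : network) (x : nat) : Prop :=
  forall k, k < n ->
    dg x k = (if act N (nth k (nodes N) 0) then if strong N (nth k (nodes N) 0) then 2 else 1
              else 0) /\
    vlb x k = lab N (nth k (nodes N) 0) /\
    forall h, h < n -> ved x k h =
      Nat.b2n (edge N (nth k (nodes N) 0) (nth h (nodes N) 0)
               || edge N (nth h (nodes N) 0) (nth k (nodes N) 0)).

End Coding.

(** * The relations written as expressions *)

Definition Two : exp := Succ One.
Definition u2 (e : exp) : exp := Lift (Lift e).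
Definition u3 (e : exp) : exp := Lift (u2 e).
Definition u4 (e : exp) : exp := Lift (u3 e).
Definition u5 (e : exp) : exp := Lift (u4 e).
Definition stE (x e k : exp) : exp := Cond (eqE k e) Zero (digE x k).
Definition lbE (x k : exp) : exp := digE x (addE gn k).
Definition edE (x k l : exp) : exp := digE x (addE (addE gn gn) (addE (mulE k gn) l)).

(** The formulas from here on copy the connectives of the relations above, with loops for the
    bounded quantifiers, so that each equivalence follows by descending both sides in parallel. The
    arguments are weakened by [u2], [u3] and so on, once for every binder they pass. *)
Definition cutfreeE (x e : exp) : exp :=
  AllE gM
    (ImpE (ExE gn (AndE (stE (u2 x) (u2 e) (Var 0)) (digE (Var 1) (Var 0))))
    (ImpE (ExE gn (AndE (stE (u2 x) (u2 e) (Var 0)) (NotE (digE (Var 1) (Var 0)))))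
      (ExE gn (ExE gn
        (AndE (stE (u3 x) (u3 e) (Var 1)) (AndE (stE (u3 x) (u3 e) (Var 0))
        (AndE (digE (Var 2) (Var 1)) (AndE (NotE (digE (Var 2) (Var 0)))
          (edE (u3 x) (Var 1) (Var 0)))))))))).

Definition skipE (x e z : exp) : exp :=
  AllE gn (AndE (eqE (digE (Lift z) (Var 0)) (stE (Lift x) (Lift e) (Var 0)))
    (AndE (eqE (lbE (Lift z) (Var 0)) (lbE (Lift x) (Var 0)))
      (AllE gn (eqE (edE (u2 z) (Var 1) (Var 0)) (edE (u2 x) (Var 1) (Var 0)))))).

Definition relabelE (x e z a b c d : exp) : exp :=
  ExE gM (AllE gn
    (AndE (eqE (digE (u2 z) (Var 0)) (stE (u2 x) (u2 e) (Var 0)))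
    (AndE (AllE gn (eqE (edE (u3 z) (Var 1) (Var 0)) (edE (u3 x) (Var 1) (Var 0))))
    (AndE (ImpE (digE (Var 1) (Var 0))
      (let t := predE (digE (Var 1) (Var 0)) in
       AndE (ltE t gn) (AndE (NotE (eqE t (Var 0)))
       (AndE (stE (u2 x) (u2 e) (Var 0)) (AndE (stE (u2 x) (u2 e) t)
       (AndE (edE (u2 x) (Var 0) t) (AndE (eqE (lbE (u2 x) (Var 0)) (u2 a))
       (AndE (eqE (lbE (u2 x) t) (u2 b)) (AndE (eqE (digE (Var 1) t) Zero)
       (AndE (AllE gn (ImpE (eqE (digE (Var 2) (Var 0)) (digE (Var 2) (Var 1)))
               (eqE (Var 0) (Var 1))))
         (eqE (lbE (u2 z) (Var 0)) (u2 c))))))))))))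
    (AndE (AllE gn (ImpE (eqE (digE (Var 2) (Var 0)) (Succ (Var 1)))
             (eqE (lbE (u3 z) (Var 1)) (u3 d))))
      (ImpE (eqE (digE (Var 1) (Var 0)) Zero)
        (ImpE (AllE gn (NotE (eqE (digE (Var 2) (Var 0)) (Succ (Var 1)))))
           (eqE (lbE (u2 z) (Var 0)) (lbE (u2 x) (Var 0)))))))))).

(** The continuation bit in front of item [i]; past the end of the list the position is that of the
    terminator, which is [false]. *)
Definition validE (p i : exp) : exp := Orc false (pairPosE i p).
Definition preE (p i : exp) : exp := natValE (Succ (pairPosE i p)).
Definition postE (p i : exp) : exp := natValE (natEndE (Succ (pairPosE i p))).

Definition createE (x e z sb p c : exp) : exp :=
  ExE gM (ExE gn
    (AndE (eqE (stE (u2 x) (u2 e) (Var 0)) Zero)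
    (AndE (AllE gL (ImpE (validE (u3 p) (Var 0))
       (let ui := digE (Var 2) (Var 0) in
        AndE (ltE ui gn) (AndE (eqE (stE (u3 x) (u3 e) ui) Two)
        (AndE (eqE (lbE (u3 x) ui) (preE (u3 p) (Var 0)))
          (AllE (Var 0) (NotE (eqE (digE (Var 3) (Var 0)) (digE (Var 3) (Var 1))))))))))
    (AndE (eqE (digE (u2 z) (Var 0)) (Cond (u2 sb) Two One))
    (AndE (eqE (lbE (u2 z) (Var 0)) (u2 c))
    (AllE gn
      (AndE (ImpE (NotE (eqE (Var 0) (Var 1)))
        (AndE (eqE (digE (u3 z) (Var 0)) (stE (u3 x) (u3 e) (Var 0)))
        (AndE (AllE gL (ImpE (validE (u4 p) (Var 0)) (ImpE (eqE (digE (Var 3) (Var 0)) (Var 1))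
                 (eqE (lbE (u4 z) (Var 1)) (postE (u4 p) (Var 0))))))
          (ImpE (AllE gL (ImpE (validE (u4 p) (Var 0))
                   (NotE (eqE (digE (Var 3) (Var 0)) (Var 1)))))
             (eqE (lbE (u3 z) (Var 0)) (lbE (u3 x) (Var 0)))))))
      (AllE gn
        (Cond (eqE (Var 1) (Var 2))
          (IffE (edE (u4 z) (Var 1) (Var 0))
            (ExE gL (AndE (validE (u5 p) (Var 0)) (eqE (digE (Var 4) (Var 0)) (Var 1)))))
        (Cond (eqE (Var 0) (Var 2))
          (IffE (edE (u4 z) (Var 1) (Var 0))
            (ExE gL (AndE (validE (u5 p) (Var 0)) (eqE (digE (Var 4) (Var 0)) (Var 2)))))
          (eqE (edE (u4 z) (Var 1) (Var 0)) (edE (u4 x) (Var 1) (Var 0))))))))))))).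

Definition succE (x e z : exp) : exp :=
  OrE (skipE x e z)
    (ExE gL (LetE (rulePosE (Var 0))
      (let p := Succ (Succ (Succ (Var 0))) in
       AndE (Orc false (Var 0))
        (Cond (Orc false (Succ (Var 0)))
          (createE (u2 x) (u2 e) (u2 z) (Orc false (Succ (Succ (Var 0)))) p
             (natValE (listEndE p)))
          (relabelE (u2 x) (u2 e) (u2 z) (natValE p) (natValE (natEndE p))
             (natValE (natEndE (natEndE p))) (natValE (natEndE (natEndE (natEndE p))))))))).

Definition loseE (x : exp) : exp :=
  OrE (NotE (cutfreeE x gn))
    (ExE gn (AndE (eqE (digE (Lift x) (Var 0)) One)
      (OrE (NotE (cutfreeE (Lift x) (Var 0)))
        (AllE gM (ImpE (succE (u2 x) (Var 1) (Var 0)) (Orc true (Var 0))))))).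

Definition initE (x : exp) : exp :=
  AllE gn (LetE (nodePosE (Var 0))
    (AndE (eqE (digE (u2 x) (Var 1))
             (Cond (Orc false (Var 0)) (Cond (Orc false (Succ (Var 0))) Two One) Zero))
    (AndE (eqE (lbE (u2 x) (Var 1)) (natValE (Succ (Succ (Var 0)))))
      (AllE gn (eqE (edE (u3 x) (Var 2) (Var 0))
                  (Orc false (addE gP (addE (mulE (Var 2) gn) (Var 0))))))))).

Definition acceptE : exp := ExE gM (AndE (initE (Var 0)) (NotE (Orc true (Var 0)))).

Lemma nth_error_matrix (f : nat -> nat -> bool) (l1 l2 : list nat) k h :
  k < length l1 -> h < length l2 ->
  nth_error (flat_map (fun u => map (f u) l2) l1) (k * length l2 + h) =
  Some (f (nth k l1 0) (nth h l2 0)).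
Proof.
  revert k. induction l1 as [|u l1 IH]; intros k Hk Hh; simpl in Hk; [lia|].
  destruct k as [|k]; simpl.
  - apply nth_error_app_l. rewrite nth_error_map.
    rewrite (nth_error_nth' l2 0 Hh). reflexivity.
  - rewrite nth_error_app2; rewrite length_map; [|lia].
    rewrite <- IH by lia. f_equal. lia.
Qed.

(** * The expressions define the intended relations *)

Section Formulas.
Variables (G : nat -> nat) (A : nat -> nat -> bool).
Notation ev := (eval G A).
Notation holds := (sat G A).
Notation n := (G 3).
Notation B := (G 2).
Notation M := (G 0).
Notation L := (G 1).
Hypothesis HB : 1 <= B.
Hypothesis HM : 2 * L + 4 <= M.
Hypothesis H2L : 2 ^ L <= M.
Hypothesis HnL : n <= L.
(** Digit indices [n + n + (k * n + l)] and addresses in the edge matrix are at most quadratic in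
    [L]; this keeps their computation from saturating. *)
Hypothesis HLL : (L + 3) * (L + 3) <= M.

Lemma M_pos : 1 <= M. Proof. lia. Qed.

Lemma ev_st x e k env vx ve vk : ev x env = vx -> ev e env = ve -> ev k env = vk ->
  vx <= M -> ev (stE x e k) env = vst B vx ve vk.
Proof.
  intros Ex Ee Ek Hx. unfold stE, vst. cbn [eval].
  pose proof (@holds_eq G A M_pos k e env vk ve Ek Ee) as H. unfold sat in H.
  rewrite (@ev_dig G A M_pos HB x k env vx vk Ex Ek Hx).
  destruct (Nat.eqb_spec (ev (eqE k e) env) 0); destruct (Nat.eqb_spec vk ve); intuition lia.
Qed.

Lemma ev_lb x k env vx vk : ev x env = vx -> ev k env = vk -> vx <= M -> vk < n ->
  ev (lbE x k) env = vlb n B vx vk.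
Proof.
  intros Ex Ek Hx Hk. unfold lbE, vlb. apply ev_dig; auto using M_pos.
  apply ev_add; auto. lia.
Qed.

Lemma ev_ed x k l env vx vk vl : ev x env = vx -> ev k env = vk -> ev l env = vl ->
  vx <= M -> vk < n -> vl < n -> ev (edE x k l) env = ved n B vx vk vl.
Proof.
  intros Ex Ek El Hx Hk Hl. unfold edE, ved. apply ev_dig; auto using M_pos.
  assert (vk * n <= L * L) by nia.
  apply ev_add; [apply ev_add; auto; lia| |nia].
  apply ev_add; [apply ev_mul; auto; lia|auto|nia].
Qed.

Lemma ev_Two env : ev Two env = 2.
Proof. apply ev_Succ; [|lia]. apply ev_One, M_pos. Qed.

Lemma ev_pred' a env x : ev a env = x -> ev (predE a) env = pred x.
Proof. intros <-. apply ev_pred. Qed.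

(** Hooks of [evs] and [fo], filled in once the readers of pair lists are available. *)
Ltac ev_extra := fail.
Ltac sat_extra := fail.

Ltac evs :=
  lazymatch goal with
  | |- eval _ _ (stE _ _ _) _ = _ => eapply ev_st; [evs|evs|evs|lia]
  | |- eval _ _ (lbE _ _) _ = _ => eapply ev_lb; [evs|evs|lia|lia]
  | |- eval _ _ (edE _ _ _) _ = _ => eapply ev_ed; [evs|evs|evs|lia|lia|lia]
  | |- eval _ _ (digE _ _) _ = _ => eapply ev_dig; [exact M_pos|exact HB|evs|evs|lia]
  | |- eval _ _ (predE _) _ = _ => eapply ev_pred'; evs
  | |- eval _ _ (Succ _) _ = _ => eapply ev_Succ; [evs|lia]
  | |- eval _ _ Two _ = _ => eapply ev_Two
  | |- _ => first [ev_extra|reflexivity|eassumption|idtac]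
  end.

Ltac fo :=
  lazymatch goal with
  | |- sat _ _ (AllE _ _) _ <-> _ =>
      eapply holds_All; [exact M_pos|evs|intros ? ?; fo]
  | |- sat _ _ (ExE _ _) _ <-> _ =>
      eapply holds_Ex; [exact M_pos|evs|intros ? ?; fo]
  | |- sat _ _ (AndE _ _) _ <-> _ => eapply holds_And; [fo|intros ?; fo]
  | |- sat _ _ (OrE _ _) _ <-> _ => eapply holds_Or; [exact M_pos|fo|fo]
  | |- sat _ _ (ImpE _ _) _ <-> _ => eapply holds_Imp; [exact M_pos|fo|intros ?; fo]
  | |- sat _ _ (IffE _ _) _ <-> _ => eapply holds_Iff; [exact M_pos|fo|fo]
  | |- sat _ _ (NotE _) _ <-> _ => eapply holds_Not; [exact M_pos|fo]
  | |- sat _ _ (eqE _ _) _ <-> _ => eapply holds_eq; [exact M_pos|evs|evs]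
  | |- sat _ _ (ltE _ _) _ <-> _ => eapply holds_lt; [evs|evs]
  | |- sat _ _ (stE _ _ _) _ <-> _ => eapply holds_nz; evs
  | |- sat _ _ (Cond _ _ _) _ <-> _ => eapply holds_Cond; [fo|intros ?; fo|intros ?; fo]
  | |- _ => first [sat_extra|eapply holds_nz; evs]
  end.

Lemma holds_cutfree x e env vx ve : ev x env = vx -> ev e env = ve -> vx <= M ->
  (holds (cutfreeE x e) env <-> CutFree n B M (vst B vx ve) (ved n B vx)).
Proof.
  intros Ex Ee Hx. unfold cutfreeE, CutFree. fo.
Qed.

Lemma holds_skip x e z env vx ve vz : ev x env = vx -> ev e env = ve -> ev z env = vz ->
  vx <= M -> vz <= M ->
  (holds (skipE x e z) env <->
   SkipRel n (vst B vx ve) (vlb n B vx) (ved n B vx) (dg B vz) (vlb n B vz) (ved n B vz)).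
Proof.
  intros Ex Ee Ez Hx Hz. unfold skipE, SkipRel. fo.
Qed.

Lemma holds_relabel x e z a b c d env vx ve vz va vb vc vd :
  ev x env = vx -> ev e env = ve -> ev z env = vz -> ev a env = va -> ev b env = vb ->
  ev c env = vc -> ev d env = vd -> vx <= M -> vz <= M ->
  (holds (relabelE x e z a b c d) env <->
   RelabelRel n B M (vst B vx ve) (vlb n B vx) (ved n B vx)
     (dg B vz) (vlb n B vz) (ved n B vz) va vb vc vd).
Proof.
  intros Ex Ee Ez Ea Eb Ec Ed Hx Hz. unfold relabelE, RelabelRel. cbv zeta. fo.
Qed.

Notation at_pos := (at_pos A).

Lemma ev_natVal' a env p v : ev a env = p -> at_pos p (enc_nat v) ->
  p + length (enc_nat v) <= L -> ev (natValE a) env = v.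
Proof.
  intros Ea Hat HL. apply ev_natVal with (p := p); auto.
  pose proof (enc_nat_value_lt v).
  assert (2 ^ length (enc_nat v) <= 2 ^ L) by (apply Nat.pow_le_mono_r; lia). lia.
Qed.

Section Create.
Variables (pp : list (nat * nat)) (vp : nat).
Hypothesis Hat : at_pos vp (enc_list enc_pair pp).
Hypothesis Hlen : vp + length (enc_list enc_pair pp) <= L.

Lemma holds_valid p i env vi : ev p env = vp -> ev i env = vi ->
  (holds (validE p i) env <-> vi < length pp).
Proof.
  intros Ep Ei. unfold validE, sat. cbn [eval Nat.b2n].
  rewrite (@ev_pairPos G A HM i p env pp vp vi) by auto.
  destruct (Nat.lt_ge_cases vi (length pp)) as [H|H].
  - destruct (nth_error pp vi) as [x|] eqn:E; [|apply nth_error_None in E; lia].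
    destruct (@at_list_item G A HM _ enc_pair pp vp vi x Hat Hlen E) as (H1 & _).
    unfold pair_pos. rewrite H1. simpl. lia.
  - pose proof (@at_list_end A _ enc_pair pp vp vi Hat H) as H1.
    unfold pair_pos. rewrite H1. simpl. lia.
Qed.

Lemma at_pair i : i < length pp -> let q := S (pair_pos pp vp i) in
  at_pos q (enc_nat (fst (nth i pp (0, 0)))) /\
  at_pos (q + length (enc_nat (fst (nth i pp (0, 0))))) (enc_nat (snd (nth i pp (0, 0)))) /\
  q + length (enc_nat (fst (nth i pp (0, 0)))) + length (enc_nat (snd (nth i pp (0, 0)))) <= L.
Proof.
  intros Hi. destruct (nth_error pp i) as [x|] eqn:E; [|apply nth_error_None in E; lia].
  rewrite (nth_error_nth pp i (0, 0) E).
  destruct (@at_list_item G A HM _ enc_pair pp vp i x Hat Hlen E) as (_ & H1 & H2).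
  change (at_pos (S (pair_pos pp vp i)) (enc_nat (fst x) ++ enc_nat (snd x))) in H1.
  change (S (pair_pos pp vp i) + length (enc_nat (fst x) ++ enc_nat (snd x)) <= L) in H2.
  rewrite at_app in H1. rewrite length_app in H2. split; [|split]; try apply H1. lia.
Qed.

Lemma ev_pre p i env vi : ev p env = vp -> ev i env = vi -> vi < length pp ->
  ev (preE p i) env = fst (nth vi pp (0, 0)).
Proof.
  intros Ep Ei Hi. destruct (at_pair Hi) as (H1 & H2 & H3).
  unfold preE. eapply ev_natVal'; [|exact H1|lia].
  apply ev_Succ; [|lia]. apply ev_pairPos; auto.
Qed.

Lemma ev_post p i env vi : ev p env = vp -> ev i env = vi -> vi < length pp ->
  ev (postE p i) env = snd (nth vi pp (0, 0)).
Proof.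
  intros Ep Ei Hi. destruct (at_pair Hi) as (H1 & H2 & H3).
  unfold postE. eapply ev_natVal'; [|exact H2|lia].
  apply ev_natEnd; auto; [|lia].
  apply ev_Succ; [|lia]. apply ev_pairPos; auto.
Qed.

Lemma ev_kind sb env (b : bool) : ev sb env = Nat.b2n b ->
  ev (Cond sb Two One) env = if b then 2 else 1.
Proof.
  intros E. cbn [eval]. rewrite E. destruct b; cbn [Nat.b2n Nat.eqb].
  - apply ev_Two.
  - apply ev_One, M_pos.
Qed.

Ltac ev_extra ::=
  lazymatch goal with
  | |- eval _ _ (preE _ _) _ = _ => eapply ev_pre; [evs|evs|lia]
  | |- eval _ _ (postE _ _) _ = _ => eapply ev_post; [evs|evs|lia]
  | |- eval _ _ (Cond _ Two One) _ = _ => eapply ev_kind; evs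
  end.
Ltac sat_extra ::=
  lazymatch goal with |- sat _ _ (validE _ _) _ <-> _ => eapply holds_valid; evs end.

Lemma holds_create x e z sb p c env vx ve vz (b : bool) vc :
  ev x env = vx -> ev e env = ve -> ev z env = vz -> ev sb env = Nat.b2n b ->
  ev p env = vp -> ev c env = vc -> vx <= M -> vz <= M ->
  (holds (createE x e z sb p c) env <->
   CreateRel n B M L (vst B vx ve) (vlb n B vx) (ved n B vx)
     (dg B vz) (vlb n B vz) (ved n B vz) pp vc b).
Proof.
  intros Ex Ee Ez Es Ep Ec Hx Hz. unfold createE, CreateRel. cbv zeta. fo.
Qed.
End Create.

Section Succ.
Variable R : list rule.
Hypothesis HR : no_move R.
Hypothesis HatR : at_pos (G 5) (enc_list enc_rule R).
Hypothesis HlenR : G 5 + length (enc_list enc_rule R) <= L.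

Lemma holds_rule x e z env vx ve vz q r :
  ev x env = vx -> ev e env = ve -> ev z env = vz -> vx <= M -> vz <= M ->
  ~ is_move r -> at_pos (S q) (enc_rule r) -> S q + length (enc_rule r) <= L ->
  let p := Succ (Succ (Succ (Var 0))) in
  (holds (Cond (Orc false (Succ (Var 0)))
          (createE (Lift x) (Lift e) (Lift z) (Orc false (Succ (Succ (Var 0)))) p
             (natValE (listEndE p)))
          (relabelE (Lift x) (Lift e) (Lift z) (natValE p) (natValE (natEndE p))
             (natValE (natEndE (natEndE p))) (natValE (natEndE (natEndE (natEndE p))))))
     (q :: env) <->
   RuleRel n B M L (vst B vx ve) (vlb n B vx) (ved n B vx)
     (dg B vz) (vlb n B vz) (ved n B vz) r).
Proof.
  intros Ex Ee Ez Hx Hz Hr Hat Hlen p.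
  assert (HS : S (S (S q)) <= L).
  { destruct r; simpl in Hlen; lia. }
  (* At [q] stands the continuation bit of the rule list; the two tag bits follow, and the data of
     the rule begin at [q + 3]. *)
  assert (E1 : ev (Succ (Var 0)) (q :: env) = S q) by (apply ev_Succ; auto; lia).
  assert (E2 : ev (Succ (Succ (Var 0))) (q :: env) = S (S q)) by (apply ev_Succ; auto; lia).
  assert (E3 : ev p (q :: env) = S (S (S q))) by (apply ev_Succ; auto; lia).
  destruct r as [a b c d| |pp c sb]; [|exfalso; apply Hr; exact I|].
  - simpl enc_rule in Hat, Hlen. rewrite !at_cons, !at_app in Hat.
    destruct Hat as (Hq & _ & Ha & Hb & Hc & Hd).
    simpl length in Hlen. rewrite !length_app in Hlen.
    unfold sat. cbn [eval Nat.b2n]. cbn [eval] in E1. rewrite E1, Hq.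
    cbn [Nat.b2n Nat.eqb].
    assert (F1 : ev (natEndE p) (q :: env) = S (S (S q)) + length (enc_nat a))
      by (apply ev_natEnd; auto; lia).
    assert (F2 : ev (natEndE (natEndE p)) (q :: env)
       = S (S (S q)) + length (enc_nat a) + length (enc_nat b))
      by (apply ev_natEnd; auto; lia).
    assert (F3 : ev (natEndE (natEndE (natEndE p))) (q :: env)
       = S (S (S q)) + length (enc_nat a) + length (enc_nat b) + length (enc_nat c))
      by (apply ev_natEnd; auto; lia).
    apply holds_relabel; auto; eapply ev_natVal'; eauto; lia.
  - simpl enc_rule in Hat, Hlen. rewrite !at_cons, !at_app in Hat.
    destruct Hat as (Hq & Hs & Hl & Hc).
    simpl length in Hlen. rewrite !length_app in Hlen.
    unfold sat. cbn [eval Nat.b2n]. cbn [eval] in E1. rewrite E1, Hq.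
    cbn [Nat.b2n Nat.eqb].
    fold enc_pair in Hl, Hc, Hlen.
    apply holds_create with (vp := S (S (S q))); auto.
    + lia.
    + cbn [eval Nat.b2n]. cbn [eval] in E2. rewrite E2, Hs. reflexivity.
    + eapply ev_natVal'; [|exact Hc|lia]. apply ev_listEnd; auto. lia.
Qed.

Lemma holds_succ x e z env vx ve vz : ev x env = vx -> ev e env = ve -> ev z env = vz ->
  vx <= M -> vz <= M ->
  (holds (succE x e z) env <-> SuccRel n B M L R vx ve vz).
Proof.
  intros Ex Ee Ez Hx Hz. unfold succE, SuccRel. cbv zeta.
  apply holds_Or; [exact M_pos|apply holds_skip; auto|].
  apply holds_Ex; [exact M_pos|reflexivity|]. intros i Hi.
  unfold sat. cbn [eval].
  rewrite (@ev_rulePos G A HM (Var 0) (i :: env) R i) by auto.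
  apply holds_And.
  - unfold sat. cbn [eval nth Nat.b2n].
    destruct (Nat.lt_ge_cases i (length R)) as [H|H].
    + destruct (nth_error R i) as [r|] eqn:E; [|apply nth_error_None in E; lia].
      destruct (@at_list_item G A HM _ enc_rule R (G 5) i r HatR HlenR E) as (H1 & _).
      unfold rule_pos. rewrite H1. simpl. lia.
    + pose proof (@at_list_end A _ enc_rule R (G 5) i HatR H) as H1.
      unfold rule_pos. rewrite H1. simpl. lia.
  - intros H. destruct (nth_error R i) as [r|] eqn:E; [|apply nth_error_None in E; lia].
    rewrite (nth_error_nth R i (Move 0 0) E).
    destruct (@at_list_item G A HM _ enc_rule R (G 5) i r HatR HlenR E) as (_ & H1 & H2).
    apply (holds_rule (Lift x) (Lift e) (Lift z)); auto.
    apply HR. eapply nth_error_In; eauto.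
Qed.

Lemma holds_table z env vz : ev z env = vz -> (holds (Orc true z) env <-> A 1 vz = true).
Proof.
  intros Ez. unfold sat. cbn [eval Nat.b2n]. rewrite Ez.
  destruct (A 1 vz); simpl; split; congruence.
Qed.

Lemma holds_lose x env vx : ev x env = vx -> vx <= M ->
  (holds (loseE x) env <-> LoseStep n B M L R (A 1) vx).
Proof.
  intros Ex Hx. unfold loseE, LoseStep.
  apply holds_Or; [exact M_pos|apply holds_Not; [exact M_pos|apply holds_cutfree; auto]|].
  apply holds_Ex; [exact M_pos|reflexivity|]. intros e He.
  apply holds_And; [apply holds_eq; [exact M_pos|evs|apply ev_One, M_pos]|]. intros _.
  apply holds_Or; [exact M_pos|apply holds_Not; [exact M_pos|apply holds_cutfree; auto]|].
  apply holds_All; [exact M_pos|reflexivity|]. intros z Hz.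
  apply holds_Imp; [exact M_pos|apply holds_succ; auto; lia|]. intros _.
  apply holds_table. reflexivity.
Qed.
End Succ.

Section Init.
Variable N : network.
Hypothesis HatN : at_pos 0 (enc_network N).
Hypothesis HlenN : length (enc_network N) <= L.
Hypothesis HnN : n = length (nodes N).
Hypothesis HG4 : G 4 = node_pos N n.

Lemma at_matrix k h : k < n -> h < n ->
  A 0 (node_pos N n + (k * n + h)) =
  (edge N (nth k (nodes N) 0) (nth h (nodes N) 0)
   || edge N (nth h (nodes N) 0) (nth k (nodes N) 0)).
Proof.
  intros Hk Hh. unfold enc_network in HatN. rewrite !at_app in HatN.
  destruct HatN as (_ & _ & H).
  assert (node_pos N n = 0 + length (enc_nat (length (nodes N))) +
    length (flat_map (fun v => act N v :: strong N v :: enc_nat (lab N v)) (nodes N))) as E.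
  { unfold node_pos. rewrite HnN, firstn_all. reflexivity. }
  rewrite <- E in H. apply H. rewrite HnN in *. apply nth_error_matrix; auto.
Qed.

Lemma holds_init x env vx : ev x env = vx -> vx <= M ->
  (holds (initE x) env <-> InitRel n B N vx).
Proof.
  intros Ex Hx. unfold initE, InitRel.
  apply holds_All; [exact M_pos|reflexivity|]. intros k Hk.
  unfold sat. cbn [eval].
  rewrite (@ev_nodePos G A HM (Var 0) (k :: env) N k) by (auto; lia).
  destruct (nth_error (nodes N) k) as [v|] eqn:E; [|apply nth_error_None in E; lia].
  rewrite (nth_error_nth (nodes N) k 0 E).
  destruct (@at_node G A HM N k v HatN HlenN E) as (H1 & H2 & H3).
  unfold enc_node in H1. rewrite !at_cons in H1. destruct H1 as (Ha & Hs & Hl).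
  rewrite H2 in H3. unfold enc_node in H3. simpl length in H3.
  set (q := node_pos N k) in *.
  assert (E1 : ev (Succ (Var 0)) (q :: k :: env) = S q) by (apply ev_Succ; auto; lia).
  assert (E2 : ev (Succ (Succ (Var 0))) (q :: k :: env) = S (S q)) by (apply ev_Succ; auto; lia).
  apply holds_And.
  - apply holds_eq; [exact M_pos|evs|].
    transitivity (if act N v then ev (Cond (Orc false (Succ (Var 0))) Two One) (q :: k :: env)
                  else 0).
    + cbn [eval nth Nat.b2n]. rewrite Ha. destruct (act N v); reflexivity.
    + destruct (act N v); auto. apply ev_kind. cbn [eval Nat.b2n].
      cbn [eval] in E1. rewrite E1, Hs. reflexivity.
  - intros _. apply holds_And.
    + apply holds_eq; [exact M_pos|evs|]. eapply ev_natVal'; [exact E2|exact Hl|lia].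
    + intros _. apply holds_All; [exact M_pos|reflexivity|]. intros h Hh.
      apply holds_eq; [exact M_pos|evs|].
      cbn [eval Nat.b2n]. rewrite <- (nth_error_nth (nodes N) k 0 E).
      rewrite <- at_matrix by auto. f_equal. f_equal.
      assert (node_pos N n <= L).
      { unfold enc_network in HlenN. rewrite !length_app in HlenN.
        unfold node_pos. rewrite HnN, firstn_all.
        change (enc_node N) with (fun v => act N v :: strong N v :: enc_nat (lab N v)). lia. }
      assert (k * n <= L * L) by nia.
      apply ev_add; [exact HG4| |nia].
      apply ev_add; [apply ev_mul; auto; nia|reflexivity|nia].
Qed.

Lemma holds_accept env :
  (holds acceptE env <-> exists x, x < M /\ InitRel n B N x /\ ~ A 1 x = true).
Proof.
  unfold acceptE. apply holds_Ex; [exact M_pos|reflexivity|]. intros x Hx.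
  apply holds_And; [apply holds_init; auto; lia|]. intros _.
  apply holds_Not; [exact M_pos|]. apply holds_table. reflexivity.
Qed.
End Init.

End Formulas.

(** * Coded positions and networks *)

Section Represent.
Variable n : nat.

(* Slot [k] stands for the node [f k]; inactive nodes have no slot. *)
Record Rep (N : network) (s l : nat -> nat) (ed : nat -> nat -> nat) (f : nat -> nat) : Prop := {
  rep_node : forall k, k < n -> s k <> 0 -> isActive N (f k) /\
    s k = (if strong N (f k) then 2 else 1) /\ lab N (f k) = l k;
  rep_inj : forall k h, k < n -> s k <> 0 -> h < n -> s h <> 0 -> f k = f h -> k = h;
  rep_surj : forall v, isActive N v -> exists k, k < n /\ s k <> 0 /\ f k = v;
  rep_adj : forall k h, k < n -> s k <> 0 -> h < n -> s h <> 0 -> k <> h ->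
    (ed k h <> 0 <-> adj N (f k) (f h)) }.

Lemma Rep_ext N s l ed f s' l' ed' : Rep N s l ed f ->
  (forall k, k < n -> s' k = s k) -> (forall k, k < n -> s k <> 0 -> l' k = l k) ->
  (forall k h, k < n -> h < n -> ed' k h = ed k h) -> Rep N s' l' ed' f.
Proof.
  intros [H1 H2 H3 H4] Es El Ee. split.
  - intros k Hk Hs. rewrite Es in * by auto. rewrite El by auto. auto.
  - intros k h Hk Hs Hh Hs'. rewrite Es in * by auto. auto.
  - intros v Hv. destruct (H3 v Hv) as (k & Hk & Hs & Hf). exists k. rewrite Es; auto.
  - intros k h Hk Hs Hh Hs'. rewrite Es in * by auto. rewrite Ee by auto. auto.
Qed.

(** The naming [f] is kept and slot [e] merely becomes free: [Rep] never consults the label and edge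
    digits of a free slot, so stale ones may stay. *)
Lemma Rep_delete N s l ed f e : Rep N s l ed f -> e < n -> s e <> 0 ->
  Rep (mkNet (filter (fun x => negb (Nat.eqb x (f e))) (nodes N))
         (edge N) (act N) (strong N) (lab N))
      (fun k => if k =? e then 0 else s k) l ed f.
Proof.
  intros [H1 H2 H3 H4] He Hse.
  assert (HIn : forall v, In v (filter (fun x => negb (Nat.eqb x (f e))) (nodes N)) <->
    In v (nodes N) /\ v <> f e).
  { intros v. rewrite filter_In, negb_true_iff, Nat.eqb_neq. tauto. }
  assert (Hne : forall k, k < n -> s k <> 0 -> k <> e -> f k <> f e).
  { intros k Hk Hs Hne E. apply Hne. auto. }
  split; simpl.
  - intros k Hk Hs. destruct (Nat.eqb_spec k e); [lia|].
    destruct (H1 k Hk Hs) as ([Hv Ha] & Hst & Hl). repeat split; auto.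
    apply HIn. split; auto.
  - intros k h Hk Hs Hh Hsh. destruct (Nat.eqb_spec k e), (Nat.eqb_spec h e); try lia. auto.
  - intros v [Hv Ha]. apply HIn in Hv as [Hv Hne']. destruct (H3 v) as (k & Hk & Hs & Hf).
    + split; auto.
    + exists k. destruct (Nat.eqb_spec k e); [congruence|auto].
  - intros k h Hk Hs Hh Hsh Hkh. destruct (Nat.eqb_spec k e), (Nat.eqb_spec h e); try lia.
    rewrite H4 by auto. unfold adj, inV; simpl. rewrite !HIn.
    pose proof (Hne k Hk Hs n0). pose proof (Hne h Hh Hsh n1). tauto.
Qed.

Lemma Rep_relab N s l ed f lab' l' : Rep N s l ed f ->
  (forall k, k < n -> s k <> 0 -> lab' (f k) = l' k) ->
  Rep (mkNet (nodes N) (edge N) (act N) (strong N) lab') s l' ed f.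
Proof.
  intros [H1 H2 H3 H4] Hl. split; auto.
  - intros k Hk Hs. destruct (H1 k Hk Hs) as (Ha & Hst & _). auto.
Qed.

Lemma relab_in l ups x y : NoDup (map fst ups) -> In (x, y) ups -> relab l ups x = y.
Proof.
  unfold relab. induction ups as [|[a b] ups IH]; simpl; [tauto|].
  intros Hnd [E|Hin].
  - injection E as -> ->. rewrite Nat.eqb_refl. reflexivity.
  - inversion Hnd as [|? ? Hni Hnd']; subst.
    destruct (Nat.eqb_spec a x) as [->|]; [|auto].
    exfalso. apply Hni. apply in_map_iff. exists (x, y). auto.
Qed.

Lemma relab_notin l ups x : ~ In x (map fst ups) -> relab l ups x = l x.
Proof.
  unfold relab. induction ups as [|[a b] ups IH]; simpl; [auto|].
  intros Hni. destruct (Nat.eqb_spec a x) as [->|]; [tauto|auto].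
Qed.

Definition ends (ps : list (nat * nat)) : list nat := flat_map (fun p => [fst p; snd p]) ps.

Lemma in_ends ps x : In x (ends ps) <-> exists p, In p ps /\ (x = fst p \/ x = snd p).
Proof.
  unfold ends. rewrite in_flat_map. simpl. firstorder.
Qed.

(** Distinct endpoints make the pairs a partial injection with disjoint domain and range. *)
Lemma NoDup_ends ps x y x' y' : NoDup (ends ps) -> In (x, y) ps -> In (x', y') ps ->
  x <> y' /\ (x = x' -> y = y') /\ (y = y' -> x = x').
Proof.
  induction ps as [|[a b] ps IH]; simpl; [tauto|].
  intros Hnd. inversion Hnd as [|? ? Ha Hnd1]; subst. inversion Hnd1 as [|? ? Hb Hnd2]; subst.
  fold (ends ps) in *. simpl in Ha.
  assert (HE : forall c d, In (c, d) ps -> a <> c /\ a <> d /\ b <> c /\ b <> d).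
  { intros c d Hin. repeat split; intros ->.
    - apply Ha. right. apply in_ends. exists (c, d). auto.
    - apply Ha. right. apply in_ends. exists (c, d). auto.
    - apply Hb. apply in_ends. exists (c, d). auto.
    - apply Hb. apply in_ends. exists (c, d). auto. }
  intros [E|H1] [E'|H2].
  - injection E as -> ->. injection E' as -> ->. repeat split; auto; intros ->; tauto.
  - injection E as -> ->. destruct (HE _ _ H2) as (? & ? & ? & ?). repeat split; congruence.
  - injection E' as -> ->. destruct (HE _ _ H1) as (? & ? & ? & ?). repeat split; congruence.
  - auto.
Qed.

Lemma NoDup_ends_map (K : list nat) g1 g2 : NoDup K ->
  (forall k h, In k K -> In h K -> g1 k = g1 h -> k = h) ->
  (forall k h, In k K -> In h K -> g2 k = g2 h -> k = h) ->
  (forall k h, In k K -> In h K -> g1 k <> g2 h) ->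
  NoDup (ends (map (fun k => (g1 k, g2 k)) K)).
Proof.
  induction K as [|k K IH]; intros Hnd I1 I2 I3; simpl; [constructor|].
  inversion Hnd as [|? ? Hni Hnd']; subst.
  assert (HE : forall x, In x (ends (map (fun k => (g1 k, g2 k)) K)) ->
    exists h, In h K /\ (x = g1 h \/ x = g2 h)).
  { intros x Hx. apply in_ends in Hx as (p & Hp & Hx). apply in_map_iff in Hp as (h & <- & Hh).
    exists h. auto. }
  constructor; [|constructor].
  - intros [E|Hin].
    + symmetry in E. revert E. apply I3; simpl; auto.
    + apply HE in Hin as (h & Hh & [E|E]).
      * apply I1 in E; simpl; auto. congruence.
      * revert E. apply I3; simpl; auto.
  - intros Hin. apply HE in Hin as (h & Hh & [E|E]).
    + symmetry in E. revert E. apply I3; simpl; auto.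
    + apply I2 in E; simpl; auto. congruence.
  - apply IH; auto; intros; [apply I1|apply I2|apply I3]; simpl; auto.
Qed.

Section Relabel.
Variables (N : network) (s l : nat -> nat) (ed : nat -> nat -> nat) (f : nat -> nat).
Variables (c d : nat) (ps : list (nat * nat)) (m l' : nat -> nat).
Hypothesis HN : Rep N s l ed f.
Hypothesis Hnd : NoDup (ends ps).
Hypothesis Hps : forall x y, In (x, y) ps ->
  exists k, k < n /\ s k <> 0 /\ m k <> 0 /\ x = f k /\ pred (m k) < n /\ s (pred (m k)) <> 0 /\
    y = f (pred (m k)).
Hypothesis Hm : forall k, k < n -> m k <> 0 -> In (f k, f (pred (m k))) ps.
Hypothesis Hc : forall k, k < n -> m k <> 0 -> l' k = c.
Hypothesis Hd : forall k h, k < n -> h < n -> m h = S k -> l' k = d.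
Hypothesis Hl : forall k, k < n -> m k = 0 -> (forall h, h < n -> m h <> S k) -> l' k = l k.

(** A slot is first in a pair ([m k <> 0]), second in one ([m h = S k] for some [h]), or in none.
    Since the endpoints are distinct, [relab] finds the entry that belongs to the case. *)
Lemma Rep_relabel :
  Rep (mkNet (nodes N) (edge N) (act N) (strong N)
        (relab (lab N) (flat_map (fun p => [(fst p, c); (snd p, d)]) ps))) s l' ed f.
Proof.
  apply Rep_relab with l; auto. intros k Hk Hs.
  set (ups := flat_map _ ps).
  assert (Hfst : map fst ups = ends ps).
  { unfold ups, ends. clear. induction ps as [|p q IH]; simpl; congruence. }
  destruct (Nat.eq_dec (m k) 0) as [E|E].
  - destruct (classic (exists h, h < n /\ m h = S k)) as [(h & Hh & Eh)|Hno].
    + rewrite (Hd Hk Hh Eh). apply relab_in; [rewrite Hfst; auto|].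
      assert (m h <> 0) as Hmh by lia. pose proof (Hm Hh Hmh) as Hin. rewrite Eh in Hin.
      apply in_flat_map. exists (f h, f (pred (S k))). simpl. auto.
    + rewrite Hl; auto.
      2: { intros h Hh Eh. apply Hno. eauto. }
      rewrite relab_notin; [apply HN; auto|]. rewrite Hfst.
      intros Hin. apply in_ends in Hin as ([x y] & Hp & Hxy). simpl in Hxy.
      destruct (Hps _ _ Hp) as (h & Hh & Hsh & Hmh & Ex & Ht & Hst & Ey).
      destruct Hxy as [Hx|Hx].
      * assert (k = h) by (eapply rep_inj; eauto; congruence). congruence.
      * assert (k = pred (m h)) by (eapply rep_inj; eauto; congruence).
        apply Hno. exists h. split; auto. lia.
  - rewrite Hc by auto. apply relab_in; [rewrite Hfst; auto|].
    apply in_flat_map. exists (f k, f (pred (m k))). simpl. auto.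
Qed.
End Relabel.

Lemma fresh_not_in N : ~ In (fresh N) (nodes N).
Proof.
  unfold fresh. intros H.
  assert (HA : forall l x, In x l -> x <= list_max l).
  { clear. induction l; simpl; [tauto|]. intros x [->|H]; [lia|]. apply IHl in H. lia. }
  apply HA in H. lia.
Qed.

Section Create.
Variables (N : network) (s l : nat -> nat) (ed : nat -> nat -> nat) (f : nat -> nat).
Variables (pp : list (nat * nat)) (c : nat) (sb : bool) (us : list nat) (u : nat -> nat) (j : nat).
Variables (zs zl : nat -> nat) (zed : nat -> nat -> nat).
Hypothesis HN : Rep N s l ed f.
Hypothesis Hj : j < n.
Hypothesis Hsj : s j = 0.
Hypothesis Hlen : length us = length pp.
Hypothesis Hnd : NoDup us.
Hypothesis Hus : forall i, i < length pp ->
  u i < n /\ s (u i) <> 0 /\ nth_error us i = Some (f (u i)).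
Hypothesis Hzj : zs j = if sb then 2 else 1.
Hypothesis Hlj : zl j = c.
Hypothesis Hzs : forall k, k < n -> k <> j -> zs k = s k.
Hypothesis Hzl1 : forall k i, k < n -> k <> j -> i < length pp -> u i = k ->
  zl k = snd (nth i pp (0, 0)).
Hypothesis Hzl2 : forall k, k < n -> k <> j -> (forall i, i < length pp -> u i <> k) ->
  zl k = l k.
Hypothesis He1 : forall h, h < n ->
  (zed j h <> 0 <-> exists i, i < length pp /\ u i = h).
Hypothesis He2 : forall k, k < n -> k <> j ->
  (zed k j <> 0 <-> exists i, i < length pp /\ u i = k).
Hypothesis He3 : forall k h, k < n -> k <> j -> h < n -> h <> j -> zed k h = ed k h.

Lemma in_us v : In v us <-> exists i, i < length pp /\ v = f (u i).
Proof.
  split.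
  - intros H. apply In_nth_error in H as (i & Hi).
    assert (i < length pp) as Hl by (rewrite <- Hlen; apply nth_error_Some; congruence).
    exists i. split; auto. destruct (Hus Hl) as (_ & _ & E). congruence.
  - intros (i & Hi & ->). destruct (Hus Hi) as (_ & _ & E). eapply nth_error_In; eauto.
Qed.

(** Slot [j] is free, so redirecting [f] at [j] to the fresh node disturbs no live slot. Freshness
    and [NoDup us] make the keys of the update list distinct, so [relab] reads the intended
    entries. *)
Lemma Rep_create :
  let z := fresh N in
  Rep (mkNet (z :: nodes N)
         (fun x y => if Nat.eqb x z then existsb (Nat.eqb y) us
                     else if Nat.eqb y z then existsb (Nat.eqb x) us
                     else edge N x y)
         (fun x => if Nat.eqb x z then true else act N x)
         (fun x => if Nat.eqb x z then sb else strong N x)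
         (relab (lab N) ((z, c) :: combine us (map snd pp))))
      zs zl zed (fun k => if k =? j then z else f k).
Proof.
  intros z. pose proof (fresh_not_in N) as Hz. fold z in Hz.
  pose proof HN as [H1 H2 H3 H4].
  assert (Hfz : forall k, k < n -> s k <> 0 -> f k <> z).
  { intros k Hk Hs E. destruct (H1 k Hk Hs) as ([Hin _] & _). unfold inV in Hin. congruence. }
  assert (Hold : forall k, k < n -> zs k <> 0 -> k <> j -> s k <> 0).
  { intros k Hk Hzk Hkj. rewrite <- Hzs; auto. }
  assert (Huse : forall k, k < n -> s k <> 0 ->
     ((exists i, i < length pp /\ u i = k) <-> existsb (Nat.eqb (f k)) us = true)).
  { intros k Hk Hs. rewrite existsb_exists. split.
    - intros (i & Hi & E). exists (f k). split; [|apply Nat.eqb_refl].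
      apply in_us. exists i. subst; auto.
    - intros (v & Hv & E). apply Nat.eqb_eq in E. subst v. apply in_us in Hv as (i & Hi & E).
      exists i. split; auto. destruct (Hus Hi) as (? & ? & _). symmetry. auto. }
  assert (Hcomb : map fst (combine us (map snd pp)) = us).
  { clear - Hlen. revert pp Hlen. induction us as [|a us' IH]; intros [|q pp] Hlen; simpl in *;
      try discriminate; [reflexivity|]. f_equal. apply IH. lia. }
  assert (HndA : NoDup (map fst ((z, c) :: combine us (map snd pp)))).
  { simpl. rewrite Hcomb. constructor; auto. intros Hin. apply in_us in Hin as (i & Hi & E).
    destruct (Hus Hi) as (? & ? & _). symmetry in E. revert E. apply Hfz; auto. }
  split.
  - intros k Hk Hs. cbn [strong lab]. destruct (Nat.eqb_spec k j) as [->|Hkj].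
    + rewrite Nat.eqb_refl. split; [|split].
      * split; [left; reflexivity|simpl; rewrite Nat.eqb_refl; reflexivity].
      * exact Hzj.
      * rewrite Hlj. apply relab_in; [exact HndA|left; reflexivity].
    + pose proof (Hold k Hk Hs Hkj) as Hsk. pose proof (Hfz k Hk Hsk) as Hne.
      apply Nat.eqb_neq in Hne as Hneb. rewrite Hneb.
      destruct (H1 k Hk Hsk) as ([Hin Ha] & Hst & Hl). split; [|split].
      * split; [right; exact Hin|simpl; rewrite Hneb; exact Ha].
      * rewrite Hzs; auto.
      * destruct (classic (exists i, i < length pp /\ u i = k)) as [(i & Hi & E)|Hno].
        -- rewrite (Hzl1 Hk Hkj Hi E). apply relab_in; [exact HndA|]. right.
           destruct (Hus Hi) as (_ & _ & Eu). rewrite E in Eu.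
           assert (nth_error (combine us (map snd pp)) i = Some (f k, snd (nth i pp (0, 0)))) as En.
           { clear - Eu Hi Hlen. revert pp i Hlen Hi Eu.
             induction us as [|a us' IH]; intros [|q pp] i Hlen Hi Eu; simpl in *; try lia.
             destruct i as [|i]; simpl in *.
             - congruence.
             - apply IH; auto; lia. }
           eapply nth_error_In; eauto.
        -- rewrite relab_notin.
           ++ rewrite Hl. symmetry. apply Hzl2; auto. intros i Hi E. apply Hno. eauto.
           ++ simpl. rewrite Hcomb. intros [E|Hin']; [congruence|].
              apply in_us in Hin' as (i & Hi & E). apply Hno. exists i. split; auto.
              destruct (Hus Hi) as (? & ? & _). symmetry. auto.
  - intros k h Hk Hs Hh Hsh. destruct (Nat.eqb_spec k j) as [->|Hkj];
      destruct (Nat.eqb_spec h j) as [->|Hhj]; intros E; auto.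
    + exfalso. symmetry in E. revert E. apply Hfz; auto.
    + exfalso. revert E. apply Hfz; auto.
  - intros v [Hin Ha]. simpl in *. destruct (Nat.eqb_spec v z) as [->|Hne].
    + exists j. rewrite Nat.eqb_refl. repeat split; auto. rewrite Hzj. destruct sb; lia.
    + destruct (H3 v) as (k & Hk & Hs & E).
      * split; auto. destruct Hin; [congruence|auto].
      * exists k. assert (k <> j) as Hkj by congruence. rewrite Hzs by auto.
        apply Nat.eqb_neq in Hkj. rewrite Hkj. auto.
  - intros k h Hk Hs Hh Hsh Hkh. unfold adj, inV. simpl.
    destruct (Nat.eqb_spec k j) as [->|Hkj]; destruct (Nat.eqb_spec h j) as [->|Hhj];
      [congruence| | |].
    + pose proof (Hold h Hh Hsh Hhj) as Hsk. pose proof (Hfz h Hh Hsk) as Hne.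
      rewrite Nat.eqb_refl. apply Nat.eqb_neq in Hne as Hneb. rewrite Hneb, orb_diag.
      rewrite He1, Huse by auto. destruct (H1 h Hh Hsk) as ([Hin _] & _). unfold inV in Hin.
      intuition congruence.
    + pose proof (Hold k Hk Hs Hkj) as Hsk. pose proof (Hfz k Hk Hsk) as Hne.
      rewrite Nat.eqb_refl. apply Nat.eqb_neq in Hne as Hneb. rewrite Hneb, orb_diag.
      rewrite He2, Huse by auto. destruct (H1 k Hk Hsk) as ([Hin _] & _). unfold inV in Hin.
      intuition congruence.
    + pose proof (Hold k Hk Hs Hkj) as Hsk. pose proof (Hold h Hh Hsh Hhj) as Hsh'.
      pose proof (Hfz k Hk Hsk) as Hne1. pose proof (Hfz h Hh Hsh') as Hne2.
      apply Nat.eqb_neq in Hne1 as Hneb1. apply Nat.eqb_neq in Hne2 as Hneb2.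
      rewrite Hneb1, Hneb2. rewrite He3, H4 by auto. unfold adj, inV.
      intuition congruence.
Qed.
End Create.
End Represent.

(** Only some naming of the slots is required, so one code stands for all networks of the same
    shape, whatever their node names. *)
Definition Codes (n B : nat) (N : network) (x : nat) : Prop :=
  exists f, Rep n N (dg B x) (vlb n B x) (ved n B x) f.

Lemma init_codes n B N x : NoDup (nodes N) -> n = length (nodes N) -> InitRel n B N x ->
  Codes n B N x.
Proof.
  intros Hnd Hn Hi. exists (fun k => nth k (nodes N) 0). split.
  - intros k Hk Hs. destruct (Hi k Hk) as (E1 & E2 & _). rewrite E1 in *.
    destruct (act N (nth k (nodes N) 0)) eqn:Ea; [|congruence].
    split; [split; [apply nth_In; lia|auto]|auto].
  - intros k h Hk _ Hh _ E. apply (proj1 (NoDup_nth (nodes N) 0) Hnd); auto; lia.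
  - intros v [Hin Ha]. destruct (In_nth _ _ 0 Hin) as (k & Hk & E). exists k.
    split; [lia|split; [|auto]]. destruct (Hi k) as (E1 & _); [lia|]. rewrite E1, E, Ha.
    destruct (strong N v); lia.
  - intros k h Hk Hs Hh Hsh Hkh. destruct (Hi k Hk) as (_ & _ & E). rewrite E by auto.
    unfold adj, inV. destruct (_ || _); simpl; split; try congruence; intros H.
    + repeat split; try (apply nth_In; lia). intros E'. apply Hkh.
      apply (proj1 (NoDup_nth (nodes N) 0) Hnd); auto; lia.
    + destruct H as (_ & _ & _ & H). discriminate.
Qed.

(** * The game played on codes *)

Section Game.
Variables (n B M L : nat) (R : list rule).
Hypothesis HnB : n < B.
Hypothesis H2B : 2 < B.
Hypothesis HnM : B ^ n <= M.
Hypothesis HLM : B ^ L <= M.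
Hypothesis HcM : B ^ (n + n + n * n) <= M.
Hypothesis HRL : length R <= L.
Hypothesis Hmove : no_move R.
Hypothesis HrelB : forall a b c d, In (Relabel a b c d) R -> c < B /\ d < B.
Hypothesis HcrB : forall pp c sb, In (Create pp c sb) R ->
  length pp <= L /\ c < B /\ forall q, In q pp -> snd q < B.

Notation dg := (dg B).
Notation Rep := (Rep n).
Notation Codes := (Codes n B).
Notation CutFree := (CutFree n B M).

(** Forward, a path cannot leave a set that no edge crosses. Backward, the component of a node is
    such a set, so it contains every active node. *)
Lemma connected_iff N s l ed f : Rep N s l ed f -> (connected N <-> CutFree s ed).
Proof.
  intros HN. pose proof HN as [H1 H2 H3 H4]. split.
  - intros Hc X _ (i & Hi & Hsi & Hxi) (j & Hj & Hsj & Hxj).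
    apply NNPP. intros Hno.
    assert (Hreach : forall v, clos_refl_trans nat (active_adj N) (f i) v ->
      exists k, k < n /\ s k <> 0 /\ f k = v /\ dg X k <> 0).
    { intros v Hv. apply clos_rt_rtn1 in Hv. induction Hv as [|v w Hvw Hv IH].
      - exists i. auto.
      - destruct IH as (k & Hk & Hsk & Ek & Hxk). destruct Hvw as (Hadj & _ & Haw).
        destruct (H3 w Haw) as (h & Hh & Hsh & Eh).
        exists h. repeat split; auto. intros Hxh. apply Hno.
        exists k. split; auto. exists h. repeat split; auto. apply H4; auto; [congruence|].
        rewrite Ek, Eh. exact Hadj. }
    destruct (Hreach (f j)) as (k & Hk & Hsk & Ek & Hxk).
    + apply Hc; [apply H1|apply H1]; auto.
    + apply H2 in Ek; auto. subst k. auto.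
  - intros HCF u v Hu Hv. destruct (H3 u Hu) as (i & Hi & Hsi & Ei).
    destruct (H3 v Hv) as (j & Hj & Hsj & Ej).
    (* The cut is the set of slots whose nodes are reachable from [f i]. *)
    destruct (@digit_choice B n (fun k d =>
      (d <> 0 <-> clos_refl_trans nat (active_adj N) (f i) (f k)))) as (X & HX & HXd); [lia| |].
    { intros k _. destruct (classic (clos_refl_trans nat (active_adj N) (f i) (f k))).
      - exists 1. split; [lia|]. intuition lia.
      - exists 0. split; [lia|]. intuition lia. }
    apply NNPP. intros Hno.
    destruct (HCF X) as (k & Hk & h & Hh & Hsk & Hsh & Hxk & Hxh & He).
    + lia.
    + exists i. repeat split; auto. apply HXd; auto. apply rt_refl.
    + exists j. repeat split; auto. rewrite HXd, Ei, Ej by auto. exact Hno.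
    + apply Hxh. rewrite HXd by auto. apply rt_trans with (f k).
      * apply HXd; auto.
      * apply rt_step. assert (k <> h) by (intros ->; auto).
        split; [apply H4; auto|]. split; [apply H1|apply H1]; auto.
Qed.

Lemma position_code zs zl zed :
  (forall k, k < n -> zs k < B /\ zl k < B /\ forall h, h < n -> zed k h < B) ->
  exists z, z < M /\ forall k, k < n ->
    dg z k = zs k /\ vlb n B z k = zl k /\ forall h, h < n -> ved n B z k h = zed k h.
Proof.
  intros Hlt.
  destruct (@digit_choice B (n + n + n * n) (fun p d =>
     (p < n -> d = zs p) /\ (forall k, k < n -> p = n + k -> d = zl k) /\
     (forall k h, k < n -> h < n -> p = n + n + (k * n + h) -> d = zed k h)))
    as (z & Hz & Hzd).
  - lia.
  - intros p Hp. destruct (Nat.lt_ge_cases p n) as [H|H].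
    { exists (zs p). split; [apply Hlt; auto|]. split; [auto|split]; intros; lia. }
    destruct (Nat.lt_ge_cases p (n + n)) as [H'|H'].
    { exists (zl (p - n)). split; [apply Hlt; lia|].
      split; [intros; lia|split]; intros; [f_equal; lia|lia]. }
    assert (n <> 0) as Hn0 by lia.
    (* In the block of adjacency digits, quotient and remainder by [n] recover row and column. *)
    set (r := p - (n + n)). pose proof (Nat.div_mod r n Hn0) as Er.
    pose proof (Nat.mod_upper_bound r n Hn0).
    assert (r / n < n) by (apply Nat.Div0.div_lt_upper_bound; unfold r; lia).
    exists (zed (r / n) (r mod n)). split; [apply Hlt; auto|].
    split; [intros; lia|split]; [intros; lia|].
    intros k h Hk Hh Ep. assert (r = n * k + h) as Er' by (unfold r; lia).
    rewrite (Nat.div_unique r n k h Hh Er'), (Nat.mod_unique r n k h Hh Er').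
    reflexivity.
  - exists z. split; [lia|]. intros k Hk.
    assert (k * n + n <= n * n) by nia. split; [|split].
    + apply (Hzd k); lia.
    + apply (Hzd (n + k)); lia.
    + intros h Hh. apply (Hzd (n + n + (k * n + h))); lia.
Qed.

Section Step.
Variables (N : network) (s l : nat -> nat) (ed : nat -> nat -> nat) (f : nat -> nat).
Hypothesis HN : Rep N s l ed f.
Hypothesis HlB : forall k, k < n -> s k < B /\ l k < B /\ forall h, h < n -> ed k h < B.

Lemma rule_sound r zs zl zed : In r R -> RuleRel n B M L s l ed zs zl zed r ->
  exists N' f', cmove R N N' /\ Rep N' zs zl zed f'.
Proof.
  intros Hr HRel. destruct r as [a b c d| |pp c sb]; [|destruct HRel|]; simpl in HRel.
  - destruct HRel as (m & Hm & HRel).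
    pose (K := filter (fun k => negb (dg m k =? 0)) (seq 0 n)).
    assert (HK : forall k, In k K <-> k < n /\ dg m k <> 0).
    { intros k. unfold K. rewrite filter_In, in_seq, negb_true_iff, Nat.eqb_neq. intuition lia. }
    pose (ps := map (fun k => (f k, f (pred (dg m k)))) K).
    assert (Hpair : forall k, In k K -> k < n /\ dg m k <> 0 /\ s k <> 0 /\
       pred (dg m k) < n /\ s (pred (dg m k)) <> 0 /\ dg m (pred (dg m k)) = 0 /\
       forall h, h < n -> dg m h = dg m k -> h = k).
    { intros k Hk. apply HK in Hk as [Hk Hmk]. destruct (HRel k Hk) as (_ & _ & H1 & _).
      specialize (H1 Hmk). tauto. }
    assert (Hnd : NoDup (ends ps)).
    { apply NoDup_ends_map; [apply NoDup_filter, seq_NoDup| | |]; intros k h Hk Hh E;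
        apply Hpair in Hk as (Hk & Hmk & Hs & Ht & Hst & Hz & Hu);
        apply Hpair in Hh as (Hh & Hmh & Hs' & Ht' & Hst' & Hz' & Hu');
        apply (rep_inj HN) in E; auto.
      - symmetry. apply Hu; auto. lia.
      - congruence. }
    assert (HREP : Rep (mkNet (nodes N) (edge N) (act N) (strong N)
        (relab (lab N) (flat_map (fun p => [(fst p, c); (snd p, d)]) ps))) s zl ed f).
    { apply Rep_relabel with (l := l) (m := dg m); auto.
      - intros x y Hin. apply in_map_iff in Hin as (k & E & Hk). injection E as <- <-.
        apply HK in Hk as [Hk Hmk]. destruct (HRel k Hk) as (_ & _ & H1 & _).
        specialize (H1 Hmk). exists k. tauto.
      - intros k Hk Hmk. apply in_map_iff. exists k. split; auto. apply HK; auto.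
      - intros k Hk Hmk. destruct (HRel k Hk) as (_ & _ & H1 & _). specialize (H1 Hmk). tauto.
      - intros k h Hk Hh E. destruct (HRel k Hk) as (_ & _ & _ & H1 & _). eauto.
      - intros k Hk E Hno. destruct (HRel k Hk) as (_ & _ & _ & _ & H1). auto. }
    assert (HREP' : Rep (mkNet (nodes N) (edge N) (act N) (strong N)
        (relab (lab N) (flat_map (fun p => [(fst p, c); (snd p, d)]) ps))) zs zl zed f).
    { apply Rep_ext with (1 := HREP); auto.
      - intros k Hk. destruct (HRel k Hk) as (E & _). exact E.
      - intros k h Hk Hh. destruct (HRel k Hk) as (_ & E & _). auto. }
    (* The all-zero pairing relabels nothing, whereas a relabeling move demands at least one pair;
       Constructor then skips. *)
    destruct ps as [|p0 ps0] eqn:Eps.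
    + exists N, f. split; [apply c_skip|]. destruct N; exact HREP'.
    + do 2 eexists. split; [|exact HREP']. rewrite <- Eps in *.
      eapply c_relabel; eauto; [congruence|].
      intros p Hp. apply in_map_iff in Hp as (k & <- & Hk). simpl.
      apply HK in Hk as [Hk Hmk]. destruct (HRel k Hk) as (_ & _ & H1 & _).
      destruct (H1 Hmk) as (Ht & Htk & Hs & Hst & He & Ha & Hb & _).
      split; [eapply rep_adj; eauto|].
      destruct (rep_node HN Hk Hs) as (Hact & _ & El).
      destruct (rep_node HN Ht Hst) as (Hact' & _ & El').
      repeat split; try apply Hact; try apply Hact'; congruence.
  - destruct HRel as (u & Hu & j & Hj & Hsj & Hpre & Hzj & Hlj & HRel).
    destruct (HcrB _ _ _ Hr) as (HppL & _).
    pose (us := map (fun i => f (dg u i)) (seq 0 (length pp))).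
    assert (Hlen : length us = length pp) by (unfold us; rewrite length_map, length_seq; auto).
    assert (Hnth : forall i, i < length pp -> nth_error us i = Some (f (dg u i))).
    { intros i Hi. unfold us. rewrite nth_error_map, nth_error_nth' with (d := 0)
        by (rewrite length_seq; auto). rewrite seq_nth by auto. reflexivity. }
    assert (Hlive : forall i, i < length pp -> dg u i < n /\ s (dg u i) = 2 /\
      l (dg u i) = fst (nth i pp (0, 0)) /\ forall i', i' < i -> dg u i' <> dg u i).
    { intros i Hi. apply Hpre; lia. }
    assert (Hnd : NoDup us).
    { apply NoDup_nth_error. intros i i' Hi E. rewrite Hlen in Hi.
      rewrite Hnth in E by auto.
      assert (i' < length pp) as Hi' by (rewrite <- Hlen; apply nth_error_Some; congruence).
      rewrite Hnth in E by auto. injection E as E.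
      destruct (Hlive i Hi) as (L1 & L2 & _ & L3), (Hlive i' Hi') as (L1' & L2' & _ & L3').
      assert (dg u i = dg u i') as Ed by (eapply rep_inj; eauto; lia).
      destruct (Nat.lt_trichotomy i i') as [H|[H|H]]; auto.
      - apply L3' in H. congruence.
      - apply L3 in H. congruence. }
    do 2 eexists. split.
    + eapply c_create with (us := us); eauto.
      intros i v Hv. assert (i < length pp) as Hi by (rewrite <- Hlen; apply nth_error_Some; congruence).
      rewrite Hnth in Hv by auto. injection Hv as <-.
      destruct (Hlive i Hi) as (L1 & L2 & L3 & _).
      destruct (@rep_node _ _ _ _ _ _ HN (dg u i) L1) as (Hact & Hst & El); [lia|].
      split.
      * split; auto. destruct (strong N (f (dg u i))); [auto|lia].
      * exists (nth i pp (0, 0)). split; [apply nth_error_nth'; auto|congruence].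
    + apply Rep_create with (s := s) (l := l) (ed := ed) (f := f) (u := dg u) (j := j); auto.
      * intros i Hi. destruct (Hlive i Hi) as (L1 & L2 & _). repeat split; auto. lia.
      * intros k Hk Hkj. destruct (HRel k Hk) as (E & _). apply E; auto.
      * intros k i Hk Hkj Hi E. destruct (HRel k Hk) as (E' & _).
        destruct (E' Hkj) as (_ & E1 & _). apply E1; auto. lia.
      * intros k Hk Hkj Hno. destruct (HRel k Hk) as (E & _).
        destruct (E Hkj) as (_ & _ & E1). apply E1; auto.
      * intros h Hh. destruct (HRel j Hj) as (_ & H). destruct (H h Hh) as [[_ E]|[E _]]; [|congruence].
        rewrite E. split; intros (i & Hi); exists i; intuition lia.
      * intros k Hk Hkj. destruct (HRel k Hk) as (_ & H).
        destruct (H j Hj) as [[E _]|[_ [[_ E]|[E _]]]]; try congruence.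
        rewrite E. split; intros (i & Hi); exists i; intuition lia.
      * intros k h Hk Hkj Hh Hhj. destruct (HRel k Hk) as (_ & H).
        destruct (H h Hh) as [[E _]|[_ [[E _]|[_ E]]]]; try congruence.
Qed.

(** The free slot [e] is the one vacated by the deletion; it receives a created node. Since the
    labels in the rules are below [B], the new position again has a code below [M]. *)
Lemma cmove_complete N' e : e < n -> s e = 0 -> cmove R N N' ->
  exists z, z < M /\
   (SkipRel n s l ed (dg z) (vlb n B z) (ved n B z) \/
    exists r, In r R /\ RuleRel n B M L s l ed (dg z) (vlb n B z) (ved n B z) r) /\
   exists f', Rep N' (dg z) (vlb n B z) (ved n B z) f'.
Proof.
  intros He Hse Hmv.
  destruct Hmv as [|a b c d ps Hin Hne Hnd Hps|a b u v Hin|pp c sb us Hin Hlen Hnd Hus z0].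
  - destruct (position_code s l ed HlB) as (z & Hz & Hzd). exists z. split; auto. split.
    + left. intros k Hk. apply Hzd, Hk.
    + exists f. apply Rep_ext with (1 := HN); intros; apply Hzd; auto.
  - fold (ends ps) in Hnd. destruct (HrelB _ _ _ _ Hin) as [HcB HdB].
    assert (Hslot : forall x y, In (x, y) ps -> exists k t, k < n /\ s k <> 0 /\ f k = x /\
       t < n /\ s t <> 0 /\ f t = y /\ k <> t /\ ed k t <> 0 /\ l k = a /\ l t = b).
    { intros x y Hp. destruct (Hps (x, y) Hp) as (Hadj & Hax & Hay & Ex & Ey). simpl in *.
      destruct (rep_surj HN Hax) as (k & Hk & Hsk & Ek).
      destruct (rep_surj HN Hay) as (t & Ht & Hst & Et).
      assert (k <> t) as Hkt by (destruct Hadj as (_ & _ & Hxy & _); congruence).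
      exists k, t. repeat split; auto.
      - apply (rep_adj HN); auto. congruence.
      - destruct (rep_node HN Hk Hsk) as (_ & _ & El). congruence.
      - destruct (rep_node HN Ht Hst) as (_ & _ & El). congruence. }
    (* Digit [k] becomes [S t] if the nodes of slots [k] and [t] form a pair in this order, and 0 if
       [k] is first in no pair; [S t <= n < B] makes it a digit. *)
    destruct (@digit_choice B n (fun k d =>
      (d = 0 /\ forall y, ~ (s k <> 0 /\ In (f k, y) ps)) \/
      (d <> 0 /\ s k <> 0 /\ pred d < n /\ s (pred d) <> 0 /\ In (f k, f (pred d)) ps)))
      as (m & Hm & Hmd); [lia| |].
    { intros k Hk. destruct (classic (exists y, s k <> 0 /\ In (f k, y) ps)) as [(y & Hsk & Hy)|Hno].
      - destruct (Hslot _ _ Hy) as (k' & t & Hk' & Hsk' & Ek & Ht & Hst & Et & _).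
        exists (S t). split; [lia|]. right. simpl. rewrite Et. auto.
      - exists 0. split; [lia|]. left. split; auto. intros y Hy. apply Hno. eauto. }
    assert (Hm1 : forall k, k < n -> dg m k <> 0 -> s k <> 0 /\ pred (dg m k) < n /\
       s (pred (dg m k)) <> 0 /\ In (f k, f (pred (dg m k))) ps).
    { intros k Hk Hmk. destruct (Hmd k Hk) as [[E _]|H]; [congruence|tauto]. }
    assert (Hm2 : forall k y, k < n -> s k <> 0 -> In (f k, y) ps -> dg m k <> 0).
    { intros k y Hk Hsk Hy. destruct (Hmd k Hk) as [[_ H]|H]; [|tauto].
      exfalso. apply (H y). auto. }
    pose (hit := fun k => existsb (fun h => dg m h =? S k) (seq 0 n)).
    assert (Hhit : forall k, hit k = true <-> exists h, h < n /\ dg m h = S k).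
    { intros k. unfold hit. rewrite existsb_exists. split; intros (h & H1 & H2); exists h.
      - apply in_seq in H1. apply Nat.eqb_eq in H2. split; auto. lia.
      - split; [apply in_seq; lia|apply Nat.eqb_eq; auto]. }
    pose (l' := fun k => if dg m k =? 0 then if hit k then d else l k else c).
    destruct (@position_code s l' ed) as (z & Hz & Hzd).
    { intros k Hk. destruct (HlB Hk) as (? & ? & ?). repeat split; auto. unfold l'.
      destruct (dg m k =? 0); [destruct (hit k)|]; auto. }
    assert (Hlc : forall k, dg m k <> 0 -> l' k = c).
    { intros k Hk. unfold l'. apply Nat.eqb_neq in Hk. rewrite Hk. reflexivity. }
    assert (Hld : forall k h, k < n -> h < n -> dg m h = S k -> l' k = d).
    { intros k h Hk Hh E. unfold l'.
      assert (hit k = true) as -> by (apply Hhit; eauto).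
      destruct (Nat.eqb_spec (dg m k) 0) as [|Hmk]; auto. exfalso.
      destruct (@Hm1 h Hh) as (_ & _ & _ & I1); [lia|].
      destruct (@Hm1 k Hk Hmk) as (_ & _ & _ & I2). rewrite E in I1. simpl in I1.
      destruct (NoDup_ends _ _ _ _ _ Hnd I2 I1) as (Hx & _). congruence. }
    assert (Hll : forall k, k < n -> dg m k = 0 -> (forall h, h < n -> dg m h <> S k) -> l' k = l k).
    { intros k Hk E Hno. unfold l'. rewrite E. simpl.
      destruct (hit k) eqn:Eh; auto. apply Hhit in Eh as (h & Hh & Eh). exfalso. eapply Hno; eauto. }
    exists z. split; auto. split.
    + right. exists (Relabel a b c d). split; auto. exists m. split; [lia|].
      intros k Hk. destruct (Hzd k Hk) as (Z1 & Z2 & Z3). rewrite Z2.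
      split; [exact Z1|split; [exact Z3|split; [|split; [eauto|auto]]]].
      intros Hmk. destruct (@Hm1 k Hk Hmk) as (I1 & I2 & I3 & I4).
      destruct (Hslot _ _ I4) as (k' & t & Hk' & Hsk' & Ek & Ht & Hst & Et & Hkt & He' & La & Lb).
      apply (rep_inj HN) in Ek; auto. apply (rep_inj HN) in Et; auto. subst k' t.
      repeat split; auto.
      * destruct (Nat.eq_dec (dg m (pred (dg m k))) 0) as [|Hne']; auto. exfalso.
        destruct (@Hm1 _ I2 Hne') as (_ & _ & _ & I5).
        destruct (NoDup_ends _ _ _ _ _ Hnd I5 I4) as (Hx & _). congruence.
      * intros h Hh E. destruct (@Hm1 h Hh) as (J1 & J2 & J3 & J4); [congruence|].
        rewrite E in J4. destruct (NoDup_ends _ _ _ _ _ Hnd J4 I4) as (_ & _ & Hx).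
        apply (rep_inj HN); auto.
    + exists f. apply Rep_ext with (s := s) (l := l') (ed := ed); try (intros; apply Hzd; auto).
      apply Rep_relabel with (l := l) (m := dg m); auto.
      * intros x y Hp. destruct (Hslot _ _ Hp) as (k & t & Hk & Hsk & Ek & Ht & Hst & Et & _).
        subst x y. pose proof (@Hm2 k _ Hk Hsk Hp) as Hmk.
        destruct (@Hm1 k Hk Hmk) as (I1 & I2 & I3 & I4).
        destruct (NoDup_ends _ _ _ _ _ Hnd Hp I4) as (_ & Hx & _).
        exists k. repeat split; auto.
      * intros k Hk Hmk. apply Hm1; auto.
  - exfalso. apply (Hmove _ Hin). exact I.
  - destruct (HcrB _ _ _ Hin) as (HppL & HcB & HqB).
    assert (Hslot : forall i, i < length pp -> exists k, k < n /\ s k = 2 /\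
       l k = fst (nth i pp (0, 0)) /\ nth_error us i = Some (f k)).
    { intros i Hi. destruct (nth_error us i) as [v|] eqn:E;
        [|apply nth_error_None in E; lia].
      destruct (Hus i v E) as ([Hact Hst] & q & Eq & El).
      destruct (rep_surj HN Hact) as (k & Hk & Hsk & Ek). subst v.
      destruct (rep_node HN Hk Hsk) as (_ & E2 & E3). rewrite Hst in E2.
      exists k. repeat split; auto. rewrite (nth_error_nth pp i (0, 0) Eq). congruence. }
    (* The tuple is taken with [L] digits, padded with 0 beyond [length pp], so that its bound
       [B ^ L] does not depend on the rule. *)
    destruct (@digit_choice B L (fun i k => i < length pp -> k < n /\ s k = 2 /\
       l k = fst (nth i pp (0, 0)) /\ nth_error us i = Some (f k))) as (u & Hu & Hud); [lia| |].
    { intros i _. destruct (Nat.lt_ge_cases i (length pp)) as [Hi|Hi].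
      - destruct (Hslot i Hi) as (k & Hk & H). exists k. split; [lia|auto].
      - exists 0. split; lia. }
    assert (Hud' : forall i, i < length pp -> dg u i < n /\ s (dg u i) = 2 /\
       l (dg u i) = fst (nth i pp (0, 0)) /\ nth_error us i = Some (f (dg u i))).
    { intros i Hi. apply Hud; auto. lia. }
    assert (Huinj : forall i i', i < length pp -> i' < length pp -> dg u i = dg u i' -> i = i').
    { intros i i' Hi Hi' E. destruct (Hud' i Hi) as (_ & _ & _ & E1).
      destruct (Hud' i' Hi') as (_ & _ & _ & E2).
      apply (proj1 (NoDup_nth_error us) Hnd); [lia|congruence]. }
    (* The inverse of the tuple: it decides which slots are creators, and thus their new labels and
       the edges of the new node. *)
    pose (who := fun k => find (fun i => dg u i =? k) (seq 0 (length pp))).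
    assert (Hwho1 : forall k i, who k = Some i -> i < length pp /\ dg u i = k).
    { intros k i E. apply find_some in E as [E1 E2]. apply in_seq in E1.
      apply Nat.eqb_eq in E2. split; auto. lia. }
    assert (Hwho2 : forall k, who k = None -> forall i, i < length pp -> dg u i <> k).
    { intros k E i Hi. apply Nat.eqb_neq. apply (find_none _ _ E). apply in_seq. lia. }
    pose (b2 := fun k => match who k with Some _ => 1 | None => 0 end).
    assert (Hb2 : forall k, b2 k <> 0 <-> exists i, i < length pp /\ dg u i = k).
    { intros k. unfold b2. destruct (who k) as [i|] eqn:E.
      - split; [|lia]. intros _. exists i. apply Hwho1, E.
      - split; [lia|]. intros (i & Hi & Ei). exfalso. eapply Hwho2; eauto. }
    pose (zs := fun k => if k =? e then if sb then 2 else 1 else s k).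
    pose (zl := fun k => if k =? e then c else
      match who k with Some i => snd (nth i pp (0, 0)) | None => l k end).
    pose (zed := fun k h => if k =? e then b2 h else if h =? e then b2 k else ed k h).
    assert (Hb2B : forall k, b2 k < B) by (intros k; unfold b2; destruct (who k); lia).
    destruct (@position_code zs zl zed) as (z & Hz & Hzd).
    { intros k Hk. destruct (HlB Hk) as (? & ? & ?). unfold zs, zl, zed.
      destruct (k =? e); [|destruct (who k) as [i|] eqn:E]; repeat split; auto.
      - destruct sb; lia.
      - apply HqB, nth_In. apply Hwho1 in E. tauto.
      - intros h Hh. destruct (h =? e); auto.
      - intros h Hh. destruct (h =? e); auto. }
    assert (Ezj : zs e = if sb then 2 else 1) by (unfold zs; rewrite Nat.eqb_refl; auto).
    assert (Elj : zl e = c) by (unfold zl; rewrite Nat.eqb_refl; auto).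
    assert (Ezs : forall k, k <> e -> zs k = s k).
    { intros k Hk. unfold zs. apply Nat.eqb_neq in Hk. rewrite Hk. auto. }
    assert (Ezl1 : forall k i, k <> e -> i < length pp -> dg u i = k -> zl k = snd (nth i pp (0, 0))).
    { intros k i Hk Hi Ei. unfold zl. apply Nat.eqb_neq in Hk. rewrite Hk.
      destruct (who k) as [i'|] eqn:E.
      - apply Hwho1 in E as [Hi' Ei']. assert (i = i') by (apply Huinj; auto; congruence). congruence.
      - exfalso. eapply Hwho2; eauto. }
    assert (Ezl2 : forall k, k <> e -> (forall i, i < length pp -> dg u i <> k) -> zl k = l k).
    { intros k Hk Hno. unfold zl. apply Nat.eqb_neq in Hk. rewrite Hk.
      destruct (who k) as [i'|] eqn:E; auto. apply Hwho1 in E as [Hi' Ei'].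
      exfalso. eapply Hno; eauto. }
    assert (Ee1 : forall h, zed e h <> 0 <-> exists i, i < length pp /\ dg u i = h).
    { intros h. unfold zed. rewrite Nat.eqb_refl. apply Hb2. }
    assert (Ee2 : forall k, k <> e -> zed k e <> 0 <-> exists i, i < length pp /\ dg u i = k).
    { intros k Hk. unfold zed. apply Nat.eqb_neq in Hk. rewrite Hk, Nat.eqb_refl. apply Hb2. }
    assert (Ee3 : forall k h, k <> e -> h <> e -> zed k h = ed k h).
    { intros k h Hk Hh. unfold zed. apply Nat.eqb_neq in Hk, Hh. rewrite Hk, Hh. auto. }
    exists z. split; auto. split.
    + right. exists (Create pp c sb). split; auto. exists u. split; [lia|].
      exists e. split; auto. split; auto. split; [|split; [|split]].
      * intros i _ Hi. destruct (Hud' i Hi) as (U1 & U2 & U3 & U4). repeat split; auto.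
        intros i' Hi' E. apply Huinj in E; lia.
      * rewrite <- Ezj. apply Hzd; auto.
      * rewrite <- Elj. apply Hzd; auto.
      * intros k Hk. destruct (Hzd k Hk) as (Z1 & Z2 & Z3). rewrite Z1, Z2. split.
        -- intros Hke. split; [auto|split; [intros; eauto|]].
           intros Hno. apply Ezl2; auto. intros i Hi. apply Hno; lia.
        -- intros h Hh. rewrite Z3 by auto.
           assert (HexL : forall k, (exists i, i < length pp /\ dg u i = k) <->
              exists i, i < L /\ i < length pp /\ dg u i = k).
           { intros k0. split; intros (i & Hi); exists i; intuition lia. }
           destruct (Nat.eq_dec k e) as [->|Hke].
           ++ left. split; auto. rewrite Ee1. apply HexL.
           ++ right. split; auto. destruct (Nat.eq_dec h e) as [->|Hhe].
              ** left. split; auto. rewrite Ee2 by auto. apply HexL.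
              ** right. auto.
    + eexists. apply Rep_ext with (s := zs) (l := zl) (ed := zed);
        try (intros; apply Hzd; auto).
      apply Rep_create with (s := s) (l := l) (ed := ed) (f := f) (u := dg u) (j := e); auto.
      * intros i Hi. destruct (Hud' i Hi) as (U1 & U2 & U3 & U4). repeat split; auto. lia.
Qed.
End Step.

Lemma digits_lt x e k : vst B x e k < B /\ vlb n B x k < B /\ forall h, h < n -> ved n B x k h < B.
Proof.
  unfold vst, vlb, ved. repeat split; intros.
  - destruct (k =? e); [lia|]. apply dg_lt. lia.
  - apply dg_lt. lia.
  - apply dg_lt. lia.
Qed.

Lemma Codes_full N x : Codes N x -> exists f, Rep N (vst B x n) (vlb n B x) (ved n B x) f.
Proof.
  intros [f H]. exists f. apply Rep_ext with (1 := H); auto.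
  intros k Hk. unfold vst. destruct (Nat.eqb_spec k n); [lia|auto].
Qed.

Lemma Codes_delete N x f e : Rep N (dg x) (vlb n B x) (ved n B x) f -> e < n -> dg x e <> 0 ->
  Rep (mkNet (filter (fun y => negb (Nat.eqb y (f e))) (nodes N))
         (edge N) (act N) (strong N) (lab N)) (vst B x e) (vlb n B x) (ved n B x) f.
Proof. intros H He Hx. apply (Rep_delete H He Hx). Qed.

(** Destructor deletes the node of slot [e]. Any answer of a winning Constructor would lead to a
    safe network with a code [z], and the step says that [z] is marked, hence lost. *)
Lemma lose_step_sound T x N :
  (forall z, z < M -> T z = true -> forall N', Codes N' z -> ~ safeD R N') ->
  x < M -> LoseStep n B M L R T x -> Codes N x -> ~ safeD R N.
Proof.
  intros HT Hx HL HC Hsafe. inversion Hsafe as [N0 Hconn Hmv E]; subst.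
  destruct HL as [HL|(e & He & Hxe & HL)].
  - destruct (Codes_full HC) as [f Hf]. apply HL. apply (connected_iff Hf); auto.
  - destruct HC as [f Hf].
    assert (dg x e <> 0) as Hne by lia.
    pose proof (Codes_delete Hf He Hne) as Hdel.
    destruct (rep_node Hf He Hne) as (Hact & Hst & _).
    assert (isWeak N (f e)) as Hweak.
    { split; auto. destruct (strong N (f e)); [lia|auto]. }
    pose proof (Hmv _ (d_delete Hweak)) as HsC.
    inversion HsC as [N1 N2 Hconn1 Hcm Hsafe2 E1]; subst.
    destruct HL as [HL|HL].
    + apply HL. apply (connected_iff Hdel); auto.
    + assert (vst B x e e = 0) as Hfree by (unfold vst; rewrite Nat.eqb_refl; reflexivity).
      destruct (cmove_complete Hdel (fun k _ => digits_lt x e k) He Hfree Hcm)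
        as (z & Hz & Hrel & HC2).
      apply (HT z Hz) with (N' := N2); auto. apply HL; auto.
      destruct Hrel as [Hrel|(r & Hr & Hrel)]; [left; auto|right].
      apply In_nth_error in Hr as (i & Hi). exists i.
      assert (i < length R) by (apply nth_error_Some; congruence).
      rewrite (nth_error_nth R i (Move 0 0) Hi). repeat split; auto. lia.
Qed.

(* Destructor may skip, but Constructor can then skip as well. *)
Lemma safeD_coind (P : network -> Prop) :
  (forall N, P N -> connected N /\ forall v, isWeak N v ->
     let N' := mkNet (filter (fun x => negb (Nat.eqb x v)) (nodes N))
                     (edge N) (act N) (strong N) (lab N) in
     connected N' /\ exists N'', cmove R N' N'' /\ P N'') ->
  forall N, P N -> safeD R N.
Proof.
  intros HP. cofix IH. intros N HN. destruct (HP N HN) as [Hc Hd].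
  constructor; [exact Hc|]. intros N' Hmv. destruct Hmv as [|v Hv].
  - apply safeC_intro with N; [exact Hc|apply c_skip|]. apply IH. exact HN.
  - destruct (Hd v Hv) as (Hc' & N'' & Hcm & HN''). apply safeC_intro with N''; auto.
Qed.

(** Being coded by an unmarked number is an invariant for [safeD_coind]: if after some deletion no
    answer led to an unmarked code, the closed table would have [x] marked. *)
Lemma unlost_safe (T : nat -> bool) :
  (forall x, x < M -> LoseStep n B M L R T x -> T x = true) ->
  forall N x, x < M -> T x <> true -> Codes N x -> safeD R N.
Proof.
  intros HT N x Hx Htx HC.
  apply safeD_coind with (P := fun N => exists x, x < M /\ T x <> true /\ Codes N x); [|eauto].
  clear N x Hx Htx HC. intros N (x & Hx & Htx & HC).
  assert (Hno : ~ LoseStep n B M L R T x) by auto.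
  split.
  - destruct (Codes_full HC) as [f Hf]. apply (connected_iff Hf).
    apply NNPP. intros H. apply Hno. left. auto.
  - intros v Hv. destruct HC as [f Hf]. destruct Hv as [Hact Hst].
    destruct (rep_surj Hf Hact) as (e & He & Hne & Ee). subst v.
    pose proof (Codes_delete Hf He Hne) as Hdel.
    destruct (rep_node Hf He Hne) as (_ & Hs & _). rewrite Hst in Hs.
    intros N'. split.
    + apply (connected_iff Hdel). apply NNPP. intros H. apply Hno. right. exists e. auto.
    + apply NNPP. intros H. apply Hno. right. exists e. split; auto. split; auto. right.
      intros z Hz Hrel. destruct (T z) eqn:Ez; auto. exfalso. apply H.
      destruct Hrel as [Hrel|(i & _ & Hi & Hrel)].
      * exists N'. split; [apply c_skip|]. exists z. split; auto. split; [congruence|].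
        exists f. apply Rep_ext with (1 := Hdel); intros; apply Hrel; auto.
      * destruct (@rule_sound _ _ _ _ _ Hdel (nth i R (Move 0 0)) (dg z) (vlb n B z) (ved n B z))
          as (N2 & f2 & Hcm & HR2); auto.
        { apply nth_In; auto. }
        exists N2. split; auto. exists z. split; auto. split; [congruence|]. exists f2. auto.
Qed.

Lemma init_exists N : n = length (nodes N) -> (forall v, In v (nodes N) -> lab N v < B) ->
  exists x, x < M /\ InitRel n B N x.
Proof.
  intros Hn Hl.
  destruct (@position_code
    (fun k => if act N (nth k (nodes N) 0) then if strong N (nth k (nodes N) 0) then 2 else 1
              else 0)
    (fun k => lab N (nth k (nodes N) 0))
    (fun k h => Nat.b2n (edge N (nth k (nodes N) 0) (nth h (nodes N) 0)
               || edge N (nth h (nodes N) 0) (nth k (nodes N) 0)))) as (x & Hx & H).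
  - intros k Hk. repeat split.
    + destruct (act _ _); [destruct (strong _ _)|]; lia.
    + apply Hl, nth_In. lia.
    + intros h Hh. destruct (_ || _); simpl; lia.
  - exists x. split; auto.
Qed.
End Game.

(** * The input phase *)

Section Reading.
Variables K L : nat.
Hypothesis HK : 20 < K.
Variable w : list bool.
Hypothesis Hw : length w = L.

Definition erase_right : tcmd :=
  Sq (Act (fun _ => (None, GoR))) (WhileS is_some_sym (goR 1)).
(** Register 1 is the write index and ends up as the input length. Array cells start as [false], so
    a [false] bit only advances the index. *)
Definition store (b : bool) : tcmd :=
  if b then Sq (SetArr K 1 0 true) (Inc K 1) else Inc K 1.
(** The first bit is treated apart: the walk to the left in [read_body] stops at an already consumed
    cell, and there is none before cell 0. This command also finds the end of the input and sets the
    flag of column 0. The bit is remembered in the control, by duplicating the code behind the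
    test. *)
Definition start_cmd : tcmd :=
  let go := Sq erase_right (Sq (goR 1) (write (Some true))) in
  IfS is_true_sym (Sq go (store true)) (Sq go (store false)).
Definition read_body : tcmd :=
  Sq (WhileS is_some_sym (goL 1)) (Sq (goR 1)
    (Sq (IfS is_true_sym (Sq (Sq erase_right (goR 1)) (store true))
                         (Sq (Sq erase_right (goR 1)) (store false)))
        (goL 2))).
Definition read_cmd : tcmd := Sq (goL 2) (Sq (WhileS is_some_sym read_body) (goR 2)).

Definition reading (rm : list bool) : mstate :=
  mkS (upd (fun _ => 0) 1 (L - length rm))
      (fun a p => (a =? 0) && (p <? L - length rm) && nth p w false) rm.

(** The bit [b] has left the input cells but is not yet in the array; only the control of the
    program knows it. *)
Definition before_store (b : bool) (rm : list bool) : mstate :=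
  mkS (reg (reading (b :: rm))) (arr (reading (b :: rm))) rm.

Lemma nth_suffix pre b rm : w = pre ++ b :: rm ->
  nth (L - S (length rm)) w false = b /\ L - S (length rm) = length pre /\
  L - length rm = S (length pre).
Proof.
  intros E. rewrite <- Hw, E, length_app. simpl.
  replace (length pre + S (length rm) - S (length rm)) with (length pre) by lia.
  split; [|lia]. rewrite app_nth2, Nat.sub_diag by lia. reflexivity.
Qed.

Lemma runs_store pre b rm : w = pre ++ b :: rm ->
  runs K L (store b) (before_store b rm) (reading rm) (2 * unit_time K L).
Proof.
  intros E. destruct (nth_suffix _ _ _ E) as (Hn & Hl & Hl').
  assert (Hp : length pre <= L) by lia.
  pose proof (unit_time_mono K Hp) as Hu.
  assert (reg (before_store b rm) 1 = length pre) as Er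
    by (simpl; unfold upd; simpl; exact Hl).
  assert (Hext : forall s', reg s' = upd (reg (before_store b rm)) 1 (S (length pre)) ->
    arr s' = arr (reading rm) -> rem s' = rm -> s' = reading rm).
  { intros [r a m] Hr Ha Hm. simpl in *. subst. unfold reading. f_equal.
    apply functional_extensionality. intros k. unfold upd. destruct (k =? 1); [lia|reflexivity]. }
  assert (Harr : upd (arr (before_store b rm)) 0 (upd (arr (before_store b rm) 0) (length pre) b)
     = arr (reading rm)).
  { apply functional_extensionality; intros a. apply functional_extensionality; intros p.
    simpl. unfold upd. destruct (Nat.eqb_spec a 0) as [->|]; simpl.
    - rewrite Hl, Hl'. destruct (Nat.eqb_spec p (length pre)) as [->|].
      + rewrite (proj2 (Nat.ltb_lt _ _)) by lia. rewrite <- Hl. auto.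
      + destruct (Nat.ltb_spec p (length pre)), (Nat.ltb_spec p (S (length pre))); auto; lia.
    - reflexivity. }
  unfold store. destruct b.
  - eapply runs_seq with (t1 := unit_time K L) (t2 := unit_time K L); [| |lia].
    + apply runs_SetArr; try lia. rewrite Er. lia.
    + rewrite Er. eapply runs_eq; [apply runs_Inc; [lia|]|].
      * change (unit_time K (reg (before_store true rm) 1) <= unit_time K L). rewrite Er. lia.
      * apply Hext; [|exact Harr|reflexivity]. simpl. rewrite Hl. reflexivity.
  - eapply runs_eq; [apply runs_Inc; [lia|]|].
    + rewrite Er. lia.
    + apply Hext; [|rewrite <- Harr|reflexivity].
      * rewrite Er. reflexivity.
      * apply functional_extensionality; intros a. apply functional_extensionality; intros p.
        simpl. unfold upd. destruct (Nat.eqb_spec a 0) as [->|]; simpl; auto.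
        rewrite Hl. destruct (Nat.eqb_spec p (length pre)) as [->|]; simpl; auto.
        rewrite Nat.ltb_irrefl. reflexivity.
Qed.

Lemma exec_right f : forall k p, (forall i, i < k -> is_some_sym (f (p + i)) = true) ->
  is_some_sym (f (p + k)) = false ->
  exec (WhileS is_some_sym (goR 1)) f p f (p + k) (3 * k + 1).
Proof.
  induction k; intros p H1 H2.
  - rewrite Nat.add_0_r in *. apply ex_while_end. auto.
  - eapply exec_time.
    + eapply ex_while_step; [|apply exec_goR|].
      * specialize (H1 0 ltac:(lia)). rewrite Nat.add_0_r in H1. exact H1.
      * replace (p + S k) with (p + 1 + k) by lia. apply IHk.
        -- intros i Hi. rewrite <- Nat.add_assoc. apply H1. lia.
        -- rewrite <- H2. f_equal. f_equal. lia.
    + lia.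
Qed.

Lemma exec_left f : forall k p, (forall i, i < k -> is_some_sym (f (p + S i)) = true) ->
  is_some_sym (f p) = false ->
  exec (WhileS is_some_sym (goL 1)) f (p + k) f p (3 * k + 1).
Proof.
  induction k; intros p H1 H2.
  - rewrite Nat.add_0_r in *. apply ex_while_end. auto.
  - eapply exec_time.
    + eapply ex_while_step; [|apply exec_goL|].
      * apply H1. lia.
      * replace (p + S k - 1) with (p + k) by lia. apply IHk; auto.
    + lia.
Qed.

Lemma low_unread pre b rm p : w = pre ++ b :: rm ->
  low L (b :: rm) p = if p <? length pre then None else nth_error (b :: rm) (p - length pre).
Proof.
  intros E. destruct (nth_suffix _ _ _ E) as (_ & Hl & _). unfold low. simpl length. rewrite Hl.
  reflexivity.
Qed.

Lemma low_erase pre b rm p : w = pre ++ b :: rm ->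
  low L rm p = if p =? length pre then None else low L (b :: rm) p.
Proof.
  intros E. rewrite (low_unread _ _ _ p E). destruct (nth_suffix _ _ _ E) as (_ & Hl & Hl'). unfold low.
  rewrite Hl'. destruct (Nat.eqb_spec p (length pre)) as [->|].
  - rewrite (proj2 (Nat.ltb_lt _ _)) by lia. reflexivity.
  - destruct (Nat.ltb_spec p (length pre)), (Nat.ltb_spec p (S (length pre))); try lia; auto.
    replace (p - length pre) with (S (p - S (length pre))) by lia. reflexivity.
Qed.

Lemma nth_error_is_some (l : list bool) i : i < length l -> is_some_sym (nth_error l i) = true.
Proof.
  intros H. destruct (nth_error l i) eqn:E; auto. apply nth_error_None in E. lia.
Qed.

Lemma exec_erase_right f pre b rm : w = pre ++ b :: rm ->
  (forall p, p <= L -> f p = low L (b :: rm) p) ->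
  exec erase_right f (length pre) (upd f (length pre) None) L (3 * length rm + 2).
Proof.
  intros E Hf. pose proof Hw as HL. rewrite E, length_app in HL. simpl in HL.
  set (f1 := upd f (length pre) None).
  assert (Hf1 : forall p, p <= L -> f1 p = low L rm p).
  { intros p Hp. rewrite (low_erase _ _ _ p E). unfold f1, upd.
    destruct (p =? length pre); auto. }
  assert (Hc : L - length rm = S (length pre)) by lia.
  eapply exec_time; [eapply ex_seq; [apply ex_act|]|].
  - cbn [fst snd mv]. fold f1. replace L with (S (length pre) + length rm) by lia.
    apply exec_right.
    + intros i Hi. rewrite Hf1 by lia. unfold low. rewrite Hc.
      destruct (Nat.ltb_spec (S (length pre) + i) (S (length pre))); [lia|].
      replace (S (length pre) + i - S (length pre)) with i by lia.
      apply nth_error_is_some, Hi.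
    + rewrite Hf1 by lia. unfold low. rewrite Hc.
      destruct (Nat.ltb_spec (S (length pre) + length rm) (S (length pre))); [lia|].
      replace (S (length pre) + length rm - S (length pre)) with (length rm) by lia.
      rewrite (proj2 (nth_error_None rm (length rm))) by lia. reflexivity.
  - lia.
Qed.

Lemma Tape_erase f pre b rm : w = pre ++ b :: rm ->
  Tape K L (reading (b :: rm)) f ->
  Tape K L (before_store b rm) (upd f (length pre) None).
Proof.
  intros E (H1 & H2 & H3). pose proof Hw as HL. rewrite E, length_app in HL. simpl in HL.
  assert (Hne : forall c i, upd f (length pre) None (pos K L c i) = f (pos K L c i)).
  { intros c i. unfold upd, pos. destruct (Nat.eqb_spec (S L + (c * S K + i)) (length pre)); auto.
    lia. }
  split; [|split].
  - intros p Hp. simpl rem. rewrite (low_erase _ _ _ p E). unfold upd.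
    destruct (p =? length pre); auto.
  - intros c. rewrite Hne. apply H2.
  - intros i c Hi. rewrite Hne. apply H3, Hi.
Qed.

Lemma exec_start pre b rm : w = pre ++ b :: rm -> pre = [] ->
  exists f t, exec start_cmd (input_tape w) 0 f (pos K L 0 0) t /\
    t <= 3 * L + 10 + 2 * unit_time K L /\ Tape K L (reading rm) f.
Proof.
  intros E ->. simpl in E. pose proof Hw as HL. rewrite E in HL. simpl in HL.
  set (f1 := upd (input_tape w) 0 None).
  set (f2 := upd f1 (S L) (Some true)).
  assert (HT : Tape K L (before_store b rm) f2).
  (* Blank tape behind the flag already represents empty arrays and registers of value 0. *)
  { assert (Hbig : forall p, S L < p -> f2 p = None).
    { intros p Hp. unfold f2, f1, upd, input_tape.
      destruct (Nat.eqb_spec p (S L)); [lia|]. destruct (Nat.eqb_spec p 0); [lia|].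
      apply nth_error_None. lia. }
    split; [|split].
    - intros p Hp. simpl rem. unfold f2, f1, upd, input_tape, low.
      destruct (Nat.eqb_spec p (S L)); [lia|].
      replace (L - length rm) with 1 by lia. destruct p as [|p]; [reflexivity|].
      simpl. rewrite E, Nat.sub_0_r. reflexivity.
    - intros [|c]; unfold pos; simpl.
      + unfold f2, upd. replace (S (L + 0)) with (S L) by lia. rewrite Nat.eqb_refl. reflexivity.
      + apply Hbig. lia.
    - intros i c Hi. unfold pos. rewrite Hbig by lia.
      destruct i as [|[|i]]; simpl trk; unfold upd; simpl.
      + replace (L - S (length rm)) with 0 by lia. reflexivity.
      + reflexivity.
      + replace (L - S (length rm)) with 0 by lia. destruct (i =? 1); reflexivity. }
  destruct (@runs_store [] b rm E _ HT) as (f3 & t3 & E3 & Ht3 & HT3).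
  assert (HE : exec (Sq (Sq erase_right (Sq (goR 1) (write (Some true)))) (store b))
     (input_tape w) 0 f3 (pos K L 0 0) (3 * length rm + 2 + (2 + 1) + t3)).
  { eapply ex_seq; [|exact E3]. eapply ex_seq.
    - apply (@exec_erase_right (input_tape w) [] b rm E).
      intros p Hp. unfold low, input_tape. simpl length. replace (L - S (length rm)) with 0 by lia.
      simpl. rewrite Nat.sub_0_r, E. reflexivity.
    - eapply ex_seq; [apply exec_goR|].
      replace (L + 1) with (S L) by lia. eapply exec_pos.
      + apply exec_write.
      + unfold pos. lia. }
  exists f3. eexists. split; [|split; [|exact HT3]].
  - unfold start_cmd. cbv zeta. destruct b.
    + apply ex_if_true; [unfold input_tape; rewrite E; reflexivity|exact HE].
    + apply ex_if_false; [unfold input_tape; rewrite E; reflexivity|exact HE].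
  - lia.
Qed.

Lemma exec_read_body pre b rm f : w = pre ++ b :: rm -> pre <> [] ->
  Tape K L (reading (b :: rm)) f ->
  exists f' t, exec read_body f (L - 1) f' (L - 1) t /\
    t <= 6 * L + 20 + 2 * unit_time K L /\ Tape K L (reading rm) f'.
Proof.
  intros E Hpre HT. pose proof Hw as HL. rewrite E, length_app in HL. simpl in HL.
  assert (0 < length pre) as Hp0 by (destruct pre; [congruence|simpl; lia]).
  pose proof HT as (H1 & _ & _).
  assert (Hlow : forall p, p <= L -> f p = if p <? length pre then None else
     nth_error (b :: rm) (p - length pre)).
  { intros p Hp. rewrite <- (low_unread _ _ _ p E). apply H1, Hp. }
  pose proof (@Tape_erase f pre b rm E HT) as HT2.
  destruct (@runs_store pre b rm E _ HT2) as (f3 & t3 & E3 & Ht3 & HT3).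
  exists f3. eexists. split; [|split; [|exact HT3]].
  - eapply ex_seq.
    { replace (L - 1) with (length pre - 1 + S (length rm)) by lia. apply exec_left.
      - intros i Hi. rewrite Hlow by lia.
        destruct (Nat.ltb_spec (length pre - 1 + S i) (length pre)); [lia|].
        apply nth_error_is_some. simpl. lia.
      - rewrite Hlow by lia. rewrite (proj2 (Nat.ltb_lt _ _)) by lia. reflexivity. }
    eapply ex_seq; [apply exec_goR|].
    replace (length pre - 1 + 1) with (length pre) by lia.
    assert (f (length pre) = Some b) as Hb.
    { rewrite Hlow by lia. rewrite Nat.ltb_irrefl, Nat.sub_diag. reflexivity. }
    assert (HE : exec (Sq (Sq erase_right (goR 1)) (store b)) f (length pre) f3 (pos K L 0 0)
       (3 * length rm + 2 + 2 + t3)).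
    { eapply ex_seq; [|exact E3]. eapply ex_seq.
      - apply exec_erase_right with (b := b) (rm := rm); auto.
      - eapply exec_pos; [apply exec_goR|]. unfold pos. lia. }
    eapply ex_seq.
    + destruct b.
      * apply ex_if_true; [rewrite Hb; reflexivity|exact HE].
      * apply ex_if_false; [rewrite Hb; reflexivity|exact HE].
    + eapply exec_pos; [apply exec_goL|]. unfold pos. lia.
  - lia.
Qed.

Lemma exec_read_loop : forall rm pre f, w = pre ++ rm -> pre <> [] ->
  Tape K L (reading rm) f ->
  exists f' t, exec (WhileS is_some_sym read_body) f (L - 1) f' (L - 1) t /\
    t <= length rm * (6 * L + 21 + 2 * unit_time K L) + 1 /\ Tape K L (reading []) f'.
Proof.
  induction rm as [|b rm IH]; intros pre f E Hpre HT.
  - exists f, 1. split; [|split; [lia|exact HT]]. apply ex_while_end.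
    destruct HT as (H1 & _). rewrite H1 by lia. unfold low. simpl.
    destruct (_ <? _); [reflexivity|]. destruct (L - 1 - (L - 0)); reflexivity.
  - destruct (@exec_read_body pre b rm f E Hpre HT) as (f1 & t1 & E1 & Ht1 & HT1).
    destruct (IH (pre ++ [b]) f1) as (f2 & t2 & E2 & Ht2 & HT2); auto.
    { rewrite <- app_assoc. exact E. }
    { destruct pre; discriminate. }
    exists f2. eexists. split; [|split; [|exact HT2]].
    + eapply ex_while_step; [|exact E1|exact E2].
      destruct HT as (H1 & _). rewrite H1 by lia. simpl rem. rewrite (low_unread _ _ _ _ E).
      pose proof Hw as HL. rewrite E, length_app in HL. simpl in HL.
      destruct (Nat.ltb_spec (L - 1) (length pre)); [lia|].
      apply nth_error_is_some. simpl. lia.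
    + simpl length. lia.
Qed.

Lemma exec_input : w <> [] ->
  exists f t, exec (Sq start_cmd read_cmd) (input_tape w) 0 f (pos K L 0 0) t /\
    t <= (L + 2) * (6 * L + 40 + 2 * unit_time K L) /\ Tape K L (reading []) f.
Proof.
  intros Hne. destruct w as [|b rm] eqn:E; [congruence|]. rewrite <- E in *.
  pose proof Hw as HL. rewrite E in HL. simpl in HL.
  destruct (@exec_start [] b rm E eq_refl) as (f1 & t1 & E1 & Ht1 & HT1).
  destruct (@exec_read_loop rm [b] f1 E) as (f2 & t2 & E2 & Ht2 & HT2); auto; [discriminate|].
  exists f2. eexists. split; [|split; [|exact HT2]].
  - eapply ex_seq; [exact E1|]. eapply ex_seq; [apply exec_goL|].
    replace (pos K L 0 0 - 2) with (L - 1) by (unfold pos; lia).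
    eapply ex_seq; [exact E2|]. eapply exec_pos; [apply exec_goR|]. unfold pos; lia.
  - assert (length rm * (6 * L + 21 + 2 * unit_time K L) <= L * (6 * L + 40 + 2 * unit_time K L))
      by (apply Nat.mul_le_mono; lia). lia.
Qed.
End Reading.

(** * Computing the table of lost positions *)

Section Program.
Variables K L : nat.
Hypothesis HK : 20 < K.

Notation runs := (runs K L).
Notation macK := (mac K).

Definition Double : tcmd :=
  Sq (WhileNZ 0 (Sq (Dec K 0) (Sq (Inc K 6) (Inc K 6)))) (MoveR K 6 0).

Lemma runs_Double s m : reg s 6 = 0 -> 2 * reg s 0 <= m ->
  runs Double s (setreg s 0 (2 * reg s 0)) (2 * macK m).
Proof.
  intros H6 Hm.
  pose (S_ := fun k => setreg (setreg s 0 (reg s 0 - k)) 6 (2 * k)).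
  eapply runs_seq with (s2 := S_ (reg s 0)) (t1 := macK m) (t2 := macK m); [| |lia].
  - replace s with (S_ 0) at 1 by (unfold S_; st_eq).
    eapply runs_weaken;
      [eapply runs_For with (t := unit_time K m + unit_time K m) (u := unit_time K m); [lia| | |]|].
    + unfold S_; intros; regs.
    + intros k Hk. eapply runs_seq; [| |apply Nat.le_refl].
      * apply runs_Inc; [lia|]. apply unit_time_mono. unfold S_; regs.
      * eapply runs_eq; [apply runs_Inc; [lia|]|unfold S_; st_eq].
        apply unit_time_mono. unfold S_; regs.
    + apply unit_time_mono. lia.
    + unfold mac. nia.
  - eapply runs_eq.
    + apply runs_MoveR with (v := m); try lia. unfold S_; regs.
    + unfold S_; st_eq.
Qed.

(** The program multiplies register 0 by [2 ^ a], with scratch registers 6 and those from [j] on.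
    [Repeat] multiplies [a] by [L + 2], so three nested repetitions of [Double] reach the exponent
    of [M]. *)
Definition grows (Mx : nat) (m : tcmd) (j a t : nat) : Prop :=
  forall s, reg s 1 = L -> reg s 6 = 0 -> (forall k, j <= k -> reg s k = 0) ->
    reg s 0 * 2 ^ a <= Mx ->
    runs m s (setreg s 0 (reg s 0 * 2 ^ a)) t.

Definition Repeat (r : nat) (m : tcmd) : tcmd :=
  Sq (Copy K 1 r 6) (Sq (Inc K r) (Sq (Inc K r) (WhileNZ r (Sq (Dec K r) m)))).

Lemma grows_Repeat Mx m r a t : 7 <= r -> r < 10 -> L + 2 <= Mx -> grows Mx m (S r) a t ->
  grows Mx (Repeat r m) r ((L + 2) * a) ((L + 2) * (t + 2 * macK Mx) + 5 * macK Mx).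
Proof.
  intros Hr Hr' HL Hg s H1 H6 Hz Hle.
  assert (HU : forall v, v <= Mx -> unit_time K v <= macK Mx) by (intros; apply mac_unit; auto).
  assert (reg s r = 0) as Hr0 by (apply Hz; lia).
  pose (S_ := fun k => setreg (setreg s r (L + 2 - k)) 0 (reg s 0 * 2 ^ (k * a))).
  eapply runs_seq with (s2 := setreg s r L) (t1 := 2 * macK Mx)
    (t2 := (L + 2) * (t + 2 * macK Mx) + 3 * macK Mx); [| |lia].
  { eapply runs_eq; [apply runs_Copy with (v := Mx); lia|rewrite H1; reflexivity]. }
  eapply runs_seq with (s2 := setreg s r (S L)) (t1 := macK Mx)
    (t2 := (L + 2) * (t + 2 * macK Mx) + 2 * macK Mx); [| |lia].
  { eapply runs_eq; [apply runs_Inc; [lia|]|].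
    - apply HU. regs.
    - st_eq. }
  eapply runs_seq with (s2 := S_ 0) (t1 := macK Mx)
    (t2 := (L + 2) * (t + 2 * macK Mx) + macK Mx); [| |lia].
  { eapply runs_eq; [apply runs_Inc; [lia|]|].
    - apply HU. regs.
    - unfold S_; simpl Nat.pow. st_eq. }
  eapply runs_eq with (s' := S_ (L + 2)).
  2: { unfold S_. st_eq. }
  eapply runs_weaken; [apply runs_For with (n := L + 2) (t := t) (u := macK Mx); [lia| | |auto]|lia].
  - intros k Hk. unfold S_; regs.
  - intros k Hk. set (s1 := setreg (S_ k) r (L + 2 - S k)).
    assert (Epow : reg s 0 * 2 ^ (k * a) * 2 ^ a = reg s 0 * 2 ^ (S k * a)).
    { rewrite <- Nat.mul_assoc, <- Nat.pow_add_r. do 2 f_equal. lia. }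
    assert (reg s1 0 = reg s 0 * 2 ^ (k * a)) as E0 by (unfold s1, S_; regs).
    eapply runs_eq; [apply Hg|].
    + unfold s1, S_; regs.
    + unfold s1, S_; regs.
    + intros j Hj. specialize (Hz j). unfold s1, S_; regs; apply Hz; lia.
    + rewrite E0, Epow. eapply Nat.le_trans; [|exact Hle].
      apply Nat.mul_le_mono_l, Nat.pow_le_mono_r; [lia|]. apply Nat.mul_le_mono_r. lia.
    + rewrite E0, Epow. unfold s1, S_. st_eq.
Qed.

Definition Grow : tcmd := Sq (Inc K 0) (Repeat 7 (Repeat 8 (Repeat 9 Double))).

(** The factor [L + 2] of each nested loop is rounded up to [m], so that the bound depends on [m]
    alone. *)
Definition grow_time (m : nat) : nat :=
  let t0 := 2 * macK m in
  let t1 := m * (t0 + 2 * macK m) + 5 * macK m in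
  let t2 := m * (t1 + 2 * macK m) + 5 * macK m in
  m * (t2 + 2 * macK m) + 6 * macK m.

Lemma runs_Grow s m : m = 2 ^ ((L + 2) * ((L + 2) * (L + 2))) -> reg s 1 = L ->
  (forall k, k <> 1 -> reg s k = 0) -> runs Grow s (setreg s 0 m) (grow_time m).
Proof.
  intros Em H1 Hz.
  assert (HLm : L + 2 <= m).
  { rewrite Em. eapply Nat.le_trans; [apply Nat.lt_le_incl, (Nat.pow_gt_lin_r 2); lia|].
    apply Nat.pow_le_mono_r; nia. }
  assert (G0 : grows m Double 10 1 (2 * macK m)).
  { intros s' H1' H6' Hz' Hle. rewrite Nat.pow_1_r in *. rewrite Nat.mul_comm.
    apply runs_Double; auto. lia. }
  pose proof (@grows_Repeat m Double 9 1 _ ltac:(lia) ltac:(lia) HLm G0) as G1.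
  pose proof (@grows_Repeat m _ 8 _ _ ltac:(lia) ltac:(lia) HLm G1) as G2.
  pose proof (@grows_Repeat m _ 7 _ _ ltac:(lia) ltac:(lia) HLm G2) as G3.
  assert (HU : forall v, v <= m -> unit_time K v <= macK m) by (intros; apply mac_unit; auto).
  assert (reg s 0 = 0) as E0 by (apply Hz; lia).
  rewrite Nat.mul_1_r in G3.
  eapply runs_seq with (s2 := setreg s 0 1) (t1 := macK m).
  - eapply runs_eq; [apply runs_Inc; [lia|]|].
    + apply HU. lia.
    + rewrite E0. reflexivity.
  - eapply runs_eq; [apply G3|].
    + regs.
    + pose proof (Hz 6). regs; auto.
    + intros k Hk. pose proof (Hz k). regs; auto.
    + change (reg (setreg s 0 1) 0) with 1. lia.
    + change (reg (setreg s 0 1) 0) with 1. rewrite Nat.mul_1_l, <- Em. st_eq.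
  - unfold grow_time. cbv zeta. set (u := macK m) in *. clearbody u.
    assert (forall x, (L + 2) * x <= m * x) as Hmul by (intros; apply Nat.mul_le_mono_r, HLm).
    set (t0 := 2 * u) in *.
    set (t1 := m * (t0 + 2 * u) + 5 * u). set (t1' := (L + 2) * (t0 + 2 * u) + 5 * u).
    assert (t1' <= t1) by (unfold t1, t1'; specialize (Hmul (t0 + 2 * u)); lia).
    set (t2 := m * (t1 + 2 * u) + 5 * u). set (t2' := (L + 2) * (t1' + 2 * u) + 5 * u).
    assert (t2' <= t2).
    { unfold t2, t2'. assert ((L + 2) * (t1' + 2 * u) <= m * (t1 + 2 * u))
        by (apply Nat.mul_le_mono; lia). lia. }
    assert ((L + 2) * (t2' + 2 * u) <= m * (t2 + 2 * u)) by (apply Nat.mul_le_mono; lia). lia.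
Qed.

Definition SetGlob (k : nat) (e : exp) : tcmd := Sq (compile K e [] NG) (MoveR K NG k).

Lemma runs_SetGlob s k e : 0 < k -> k < NG -> reg s k = 0 -> 1 <= reg s 0 ->
  (forall j, NG <= j -> reg s j = 0) -> (forall j, reg s j <= reg s 0) ->
  NG + need e + 2 < K ->
  runs (SetGlob k e) s (setreg s k (eval (reg s) (arr s) e [])) (cost K (reg s 0) e + macK (reg s 0)).
Proof.
  intros Hk0 Hk E0 H1 Hz HM Hn.
  assert (eval (reg s) (arr s) e [] <= reg s 0) as Hle by (apply ev_le; auto).
  pose proof (Hz NG (Nat.le_refl NG)) as Hng.
  eapply runs_seq; [apply compile_ok with (G := reg s) (A := arr s); auto| |apply Nat.le_refl].
  cbn [map]. set (v := eval (reg s) (arr s) e []) in *.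
  eapply runs_eq; [apply runs_MoveR with (v := reg s 0); unfold NG in *; try lia|].
  - regs.
  - unfold NG in *. st_eq.
Qed.

Definition baseE : exp := Rec (Succ (Succ gL)) One (addE (Var 0) (Var 0)).
(** The order matters: [nodePosE gn] reads the node count just stored, and the rule list starts
    [n * n] bits after the edge matrix. *)
Definition SetGlobs : tcmd :=
  Sq (SetGlob 2 baseE) (Sq (SetGlob 3 (natValE Zero)) (Sq (SetGlob 4 (nodePosE gn))
    (SetGlob 5 (addE gP (mulE gn gn))))).

(* Registers 6 and 7 count rounds and codes, register 8 is the code [x] being updated. *)
Definition stepE : exp := loseE (Var 0).
Definition Update : tcmd :=
  Sq (compile K stepE [8] 9) (Sq (IfNZ 9 (Sq (Clear K 9) (SetArr K 8 1 true)) noop) (Inc K 8)).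
Definition Round : tcmd :=
  Sq (Copy K 0 7 9) (Sq (WhileNZ 7 (Sq (Dec K 7) Update)) (Clear K 8)).
Definition Solve : tcmd := Sq (Copy K 0 6 9) (WhileNZ 6 (Sq (Dec K 6) Round)).

Section Solver.
Variable G : nat -> nat.
Hypothesis HG1 : 1 <= G 0.
Hypothesis HG : forall k, k < NG -> G k <= G 0.
Hypothesis Hneed : 9 + need stepE + 2 < K.
Notation M := (G 0).

(** Marks are set in place, so later codes of a round already see the marks made earlier in it.
    Array 1 is the table, array 0 the input. *)
Definition update (A : nat -> nat -> bool) (x : nat) : nat -> nat -> bool :=
  if eval G A stepE [x] =? 0 then A else upd A 1 (upd (A 1) x true).
Definition updates (A : nat -> nat -> bool) (x : nat) : nat -> nat -> bool :=
  nat_rect (fun _ => nat -> nat -> bool) A (fun y A' => update A' y) x.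
Definition round (A : nat -> nat -> bool) : nat -> nat -> bool := updates A M.

Definition solving (a b x : nat) (A : nat -> nat -> bool) : mstate :=
  mkS (fun k => if k <? NG then G k else
        match k with 6 => a | 7 => b | 8 => x | _ => 0 end) A [].

Ltac sol := apply mstate_ext; [|reflexivity|reflexivity]; intros k;
  cbn [reg solving setreg setarr]; unfold upd;
  do 10 (destruct k as [|k]; [reflexivity|]); reflexivity.

Lemma reg_solving_le a b x A : a <= M -> b <= M -> x <= M -> forall k, reg (solving a b x A) k <= M.
Proof.
  intros Ha Hb Hx k. simpl. destruct (Nat.ltb_spec k NG); auto.
  unfold NG in *. do 9 (destruct k as [|k]; [simpl; lia|]). simpl; lia.
Qed.

Definition update_time : nat := cost K M stepE + 4 * macK M.

Lemma runs_Update a b x A : a <= M -> b <= M -> x < M ->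
  runs Update (solving a b x A) (solving a b (S x) (update A x)) update_time.
Proof.
  intros Ha Hb Hx.
  assert (HU : forall v, v <= M -> unit_time K v <= macK M) by (intros; apply mac_unit; auto).
  set (s := solving a b x A).
  assert (Hle : forall k, reg s k <= M) by (apply reg_solving_le; auto; lia).
  assert (Hv : eval G A stepE [x] <= M) by (apply ev_le; auto; repeat constructor; lia).
  set (v := eval G A stepE [x]) in *.
  pose proof (mac_pos K M) as Hmp.
  eapply runs_seq with (s2 := setreg s 9 v) (t1 := cost K M stepE) (t2 := 4 * macK M);
    [| |unfold update_time; lia].
  { change v with (eval G A stepE (map (reg s) [8])).
    apply compile_ok with (G := G) (A := A); auto.
    - intros k Hk. simpl. do 9 (destruct k as [|k]; [lia|]). reflexivity.
    - intros k Hk. simpl. apply Nat.ltb_lt in Hk. rewrite Hk. reflexivity. }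
  eapply runs_seq with (s2 := solving a b x (update A x)) (t1 := 3 * macK M) (t2 := macK M);
    [| |lia].
  - eapply runs_weaken; [apply runs_IfNZ with (t := 2 * macK M); [lia|]|].
    + change (reg (setreg s 9 v) 9) with v. unfold update. fold v.
      destruct (Nat.eqb_spec v 0) as [E|E].
      * rewrite E. eapply runs_eq; [apply runs_noop; lia|]. unfold s. sol.
      * eapply runs_seq with (t1 := macK M) (t2 := macK M); [apply runs_Clear; [lia|]| |lia].
        -- apply mac_mono. exact Hv.
        -- eapply runs_eq; [apply runs_SetArr; try lia|].
           ++ change (unit_time K x <= macK M). apply HU. lia.
           ++ unfold s. sol.
    + specialize (HU 0 ltac:(lia)). lia.
  - eapply runs_eq; [apply runs_Inc; [lia|]|].
    + change (unit_time K x <= macK M). apply HU. lia.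
    + sol.
Qed.

Definition round_time : nat := M * (update_time + 2 * macK M) + 4 * macK M.

Lemma runs_Round a A : a <= M ->
  runs Round (solving a 0 0 A) (solving a 0 0 (round A)) round_time.
Proof.
  intros Ha.
  assert (HU : forall v, v <= M -> unit_time K v <= macK M) by (intros; apply mac_unit; auto).
  pose (S_ := fun x => solving a (M - x) x (updates A x)).
  eapply runs_seq with (s2 := S_ 0) (t1 := 2 * macK M)
    (t2 := M * (update_time + 2 * macK M) + 2 * macK M); [| |unfold round_time; lia].
  { eapply runs_eq; [apply runs_Copy with (v := M); try lia; try reflexivity|].
    unfold S_. rewrite Nat.sub_0_r. simpl updates. sol. }
  eapply runs_seq with (s2 := S_ M) (t1 := M * (update_time + 2 * macK M) + macK M)
    (t2 := macK M); [| |lia].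
  - apply runs_For; [lia|reflexivity| |auto]. intros x Hx.
    replace (setreg (S_ x) 7 (M - S x)) with (solving a (M - S x) x (updates A x))
      by (unfold S_; sol).
    apply (@runs_Update a (M - S x) x (updates A x)); lia.
  - eapply runs_eq; [apply runs_Clear; [lia|]|].
    + apply mac_mono. apply Nat.le_refl.
    + unfold S_, round. rewrite Nat.sub_diag. sol.
Qed.

Definition solve_time : nat := M * (round_time + 2 * macK M) + 4 * macK M.

Lemma runs_Solve A :
  runs Solve (solving 0 0 0 A) (solving 0 0 0 (Nat.iter M round A)) solve_time.
Proof.
  assert (HU : forall v, v <= M -> unit_time K v <= macK M) by (intros; apply mac_unit; auto).
  pose (S_ := fun x => solving (M - x) 0 0 (Nat.iter x round A)).
  eapply runs_seq with (s2 := S_ 0) (t1 := 2 * macK M)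
    (t2 := M * (round_time + 2 * macK M) + 2 * macK M); [| |unfold solve_time; lia].
  { eapply runs_eq; [apply runs_Copy with (v := M); try lia; try reflexivity|].
    unfold S_. rewrite Nat.sub_0_r. simpl Nat.iter. sol. }
  eapply runs_eq with (s' := S_ M); [|unfold S_; rewrite Nat.sub_diag; reflexivity].
  eapply runs_weaken; [apply runs_For with (t := round_time) (u := macK M); [lia|reflexivity| |auto]|lia].
  intros x Hx.
  replace (setreg (S_ x) 6 (M - S x)) with (solving (M - S x) 0 0 (Nat.iter x round A))
    by (unfold S_; sol).
  unfold S_. rewrite Nat.iter_succ. apply runs_Round. lia.
Qed.
End Solver.

End Program.

(** * Convergence and soundness of the table iteration *)

Section Iteration.
Variable G : nat -> nat.
Notation M := (G 0).
Notation updateG := (update G).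
Notation updatesG := (updates G).
Notation roundG := (round G).

Lemma update_mono A x y : A 1 y = true -> updateG A x 1 y = true.
Proof.
  intros H. unfold update. destruct (_ =? 0); auto. unfold upd. simpl.
  destruct (y =? x); auto.
Qed.

Lemma update_input A x a : a <> 1 -> updateG A x a = A a.
Proof.
  intros H. unfold update. destruct (_ =? 0); auto. unfold upd.
  apply Nat.eqb_neq in H. rewrite H. reflexivity.
Qed.

Lemma updates_mono A x x' y : x <= x' -> updatesG A x 1 y = true -> updatesG A x' 1 y = true.
Proof. intros H. induction H; auto. intros. apply update_mono. auto. Qed.

Lemma updates_input A x a : a <> 1 -> updatesG A x a = A a.
Proof. intros H. induction x; [reflexivity|]. simpl. rewrite update_input; auto. Qed.

Lemma iter_round_input A k a : a <> 1 -> Nat.iter k roundG A a = A a.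
Proof.
  intros H. induction k; [reflexivity|]. rewrite Nat.iter_succ. unfold round.
  rewrite updates_input; auto.
Qed.

(** Marks only grow within a round, so every intermediate table lies between [A] and [roundG A]. *)
Lemma updates_unchanged A x : (forall y, roundG A 1 y = true -> A 1 y = true) -> x <= M ->
  updatesG A x = A.
Proof.
  intros H Hx. apply functional_extensionality; intros a.
  destruct (Nat.eq_dec a 1) as [->|]; [|apply updates_input; auto].
  apply functional_extensionality; intros y.
  destruct (updatesG A x 1 y) eqn:E1, (A 1 y) eqn:E2; auto.
  - apply (@updates_mono A x M y Hx) in E1. apply H in E1. congruence.
  - change (updatesG A 0 1 y = true) in E2. apply (@updates_mono A 0 x y ltac:(lia)) in E2.
    congruence.
Qed.

Definition marked (A : nat -> nat -> bool) : nat := length (filter (A 1) (seq 0 M)).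

Lemma filter_length_mono (p q : nat -> bool) l : (forall y, p y = true -> q y = true) ->
  length (filter p l) <= length (filter q l) /\
  ((exists y, In y l /\ p y = false /\ q y = true) ->
   length (filter p l) < length (filter q l)).
Proof.
  intros H. induction l as [|z l [IH1 IH2]]; simpl.
  - split; auto. intros (y & [] & _).
  - destruct (p z) eqn:Ep.
    + rewrite (H z Ep). simpl. split; [lia|].
      intros (y & [->|Hy] & H1 & H2); [congruence|]. apply -> Nat.succ_lt_mono.
      apply IH2. eauto.
    + destruct (q z) eqn:Eq; simpl; split; try lia.
      intros (y & [->|Hy] & H1 & H2); [congruence|]. apply IH2. eauto.
Qed.

Lemma updates_outside A x y : x <= y -> updatesG A x 1 y = A 1 y.
Proof.
  induction x; intros H; [reflexivity|]. rewrite <- IHx by lia.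
  change (updateG (updatesG A x) x 1 y = updatesG A x 1 y). unfold update.
  destruct (_ =? 0); auto. unfold upd. simpl. destruct (Nat.eqb_spec y x); [lia|auto].
Qed.

(* Every round but the last stable one marks a new code, so [M] rounds suffice. *)
Lemma solved_closed A x : x < M ->
  eval G (Nat.iter M roundG A) stepE [x] <> 0 -> Nat.iter M roundG A 1 x = true.
Proof.
  intros Hx Hev.
  pose (stable := fun A' => forall y, roundG A' 1 y = true -> A' 1 y = true).
  assert (Hfix : forall A', stable A' -> roundG A' = A').
  { intros A' H. apply updates_unchanged; auto. }
  assert (Hk : forall k, stable (Nat.iter k roundG A) \/ k <= marked (Nat.iter k roundG A)).
  { induction k; [right; lia|]. rewrite Nat.iter_succ.
    set (A' := Nat.iter k roundG A) in *.
    destruct (classic (stable A')) as [Hst|Hst].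
    - left. rewrite (Hfix A' Hst). exact Hst.
    - right. destruct IHk as [|Hc]; [tauto|].
      apply not_all_ex_not in Hst as [y Hy]. apply imply_to_and in Hy as [Hy1 Hy2].
      apply not_true_is_false in Hy2.
      assert (y < M) as HyM.
      { destruct (Nat.lt_ge_cases y M) as [|Hge]; auto. exfalso.
        unfold round in Hy1. rewrite updates_outside in Hy1; auto. congruence. }
      destruct (@filter_length_mono (A' 1) (roundG A' 1) (seq 0 M)) as [_ Hlt].
      { intros z Hz. apply (@updates_mono A' 0 M z ltac:(lia)). exact Hz. }
      specialize (Hlt (ex_intro _ y (conj (proj2 (in_seq M 0 y) ltac:(lia)) (conj Hy2 Hy1)))).
      unfold marked in *. lia. }
  destruct (Hk M) as [Hst|Hc].
  - set (A' := Nat.iter M roundG A) in *.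
    assert (updatesG A' (S x) = A') as E1 by (apply updates_unchanged; auto).
    assert (updatesG A' x = A') as E2 by (apply updates_unchanged; auto; lia).
    change (updateG (updatesG A' x) x = A') in E1. rewrite E2 in E1. unfold update in E1.
    apply Nat.eqb_neq in Hev. rewrite Hev in E1. rewrite <- E1. unfold upd.
    simpl. rewrite Nat.eqb_refl. reflexivity.
  (* With [M] marks among the [M] codes, no code is left unmarked. *)
  - apply not_false_iff_true. intros Hf. unfold marked in Hc.
    destruct (@filter_length_mono (Nat.iter M roundG A 1) (fun _ => true) (seq 0 M)) as [_ Hlt].
    { auto. }
    specialize (Hlt (ex_intro _ x (conj (proj2 (in_seq M 0 x) ltac:(lia)) (conj Hf eq_refl)))).
    pose proof (filter_length_le (fun _ => true) (seq 0 M)) as Hl.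
    rewrite length_seq in Hl. lia.
Qed.

(** Each single update preserves that marked codes satisfy [P], since the step may assume it of all
    marks so far. The premise [A' 0 = A 0] gives the step the unchanged input array, from which its
    formula reads the rules. *)
Lemma solved_sound (P : nat -> Prop) A k :
  (forall A' x, A' 0 = A 0 -> x < M -> (forall z, z < M -> A' 1 z = true -> P z) ->
     eval G A' stepE [x] <> 0 -> P x) ->
  (forall z, z < M -> A 1 z = true -> P z) ->
  forall z, z < M -> Nat.iter k roundG A 1 z = true -> P z.
Proof.
  intros Hstep H0. induction k; [exact H0|]. rewrite Nat.iter_succ.
  set (A' := Nat.iter k roundG A) in *.
  assert (A' 0 = A 0) as E0 by (apply iter_round_input; discriminate).
  assert (forall x, x <= M -> forall z, z < M -> updatesG A' x 1 z = true -> P z) as H.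
  { induction x; intros Hx; [exact IHk|]. intros z Hz.
    change (updateG (updatesG A' x) x 1 z = true -> P z). unfold update.
    destruct (Nat.eqb_spec (eval G (updatesG A' x) stepE [x]) 0) as [E|E]; [apply IHx; auto; lia|].
    unfold upd. simpl. destruct (Nat.eqb_spec z x) as [->|]; [|apply IHx; auto; lia].
    intros _. apply Hstep with (updatesG A' x); auto.
    - rewrite updates_input; auto.
    - apply IHx. lia. }
  apply (H M). apply Nat.le_refl.
Qed.
End Iteration.

(** * Running time *)

(** A single power suffices: the base is at least 2, so constants, sums and products are absorbed by
    raising the exponent. *)
Definition poly_bounded (g : nat -> nat) : Prop := exists c, forall m, g m <= (m + 2) ^ c.

Lemma pb_const c : poly_bounded (fun _ => c).
Proof.
  exists c. intros m. eapply Nat.le_trans; [apply Nat.lt_le_incl, (Nat.pow_gt_lin_r 2); lia|].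
  apply Nat.pow_le_mono_l. lia.
Qed.

Lemma pb_id : poly_bounded (fun m => m).
Proof. exists 1. intros m. rewrite Nat.pow_1_r. lia. Qed.

Lemma pb_add g h : poly_bounded g -> poly_bounded h -> poly_bounded (fun m => g m + h m).
Proof.
  intros [a Ha] [b Hb]. exists (S (a + b)). intros m. rewrite Nat.pow_succ_r'.
  specialize (Ha m). specialize (Hb m).
  assert ((m + 2) ^ a <= (m + 2) ^ (a + b)) by (apply Nat.pow_le_mono_r; lia).
  assert ((m + 2) ^ b <= (m + 2) ^ (a + b)) by (apply Nat.pow_le_mono_r; lia). nia.
Qed.

Lemma pb_mul g h : poly_bounded g -> poly_bounded h -> poly_bounded (fun m => g m * h m).
Proof.
  intros [a Ha] [b Hb]. exists (a + b). intros m. rewrite Nat.pow_add_r.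
  apply Nat.mul_le_mono; auto.
Qed.

Ltac pb := repeat first
  [ assumption | apply pb_const | apply pb_id | apply pb_add | apply pb_mul ].

Lemma pb_unit K : poly_bounded (unit_time K).
Proof. unfold unit_time. pb. Qed.

Lemma pb_mac K : poly_bounded (mac K).
Proof. unfold mac. pose proof (pb_unit K). pb. Qed.

Lemma pb_cost K e : poly_bounded (fun m => cost K m e).
Proof. pose proof (pb_mac K). induction e; simpl; pb. Qed.

Lemma pb_grow K : poly_bounded (grow_time K).
Proof. unfold grow_time. cbv zeta. pose proof (pb_mac K). pb. Qed.

Lemma pb_solve K : poly_bounded (fun m => solve_time K (fun _ => m)).
Proof.
  unfold solve_time, round_time, update_time. pose proof (pb_mac K). pose proof (pb_cost K stepE). pb.
Qed.

(** With [q] the cube of [L + 2], the left side is at most [2 ^ ((q + 1) * c)]. The fourth power of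
    [L + 2] absorbs [q + 1], and [c <= (L + 2) ^ c] absorbs the rest. *)
Lemma poly_exponential c L :
  (2 ^ ((L + 2) * ((L + 2) * (L + 2))) + 2) ^ c <= 2 ^ ((L + 2) ^ (c + 4)).
Proof.
  set (q := (L + 2) * ((L + 2) * (L + 2))).
  assert (1 <= q) as Hq by (unfold q; nia).
  assert (2 <= 2 ^ q) by (rewrite <- (Nat.pow_1_r 2) at 1; apply Nat.pow_le_mono_r; lia).
  assert (2 ^ q + 2 <= 2 ^ (S q)) by (simpl; lia).
  eapply Nat.le_trans; [apply Nat.pow_le_mono_l; eassumption|].
  rewrite <- Nat.pow_mul_r. apply Nat.pow_le_mono_r; [lia|].
  assert (c <= (L + 2) ^ c).
  { eapply Nat.le_trans; [apply Nat.lt_le_incl, (Nat.pow_gt_lin_r 2); lia|].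
    apply Nat.pow_le_mono_l. lia. }
  replace ((L + 2) ^ (c + 4)) with ((L + 2) ^ 4 * (L + 2) ^ c)
    by (rewrite <- Nat.pow_add_r; f_equal; lia).
  apply Nat.mul_le_mono; auto. simpl. unfold q in *. nia.
Qed.

(** * Lengths of the encodings *)

Lemma length_flat_map_in X Y (g : X -> list Y) l x : In x l ->
  length (g x) <= length (flat_map g l).
Proof.
  induction l as [|y l IH]; simpl; [tauto|]. rewrite length_app.
  intros [->|H]; [lia|]. apply IH in H. lia.
Qed.

Lemma length_flat_map_ge X Y (g : X -> list Y) l : (forall x, 1 <= length (g x)) ->
  length l <= length (flat_map g l).
Proof.
  intros H. induction l as [|y l IH]; simpl; [lia|]. rewrite length_app. specialize (H y). lia.
Qed.

Lemma length_matrix (f : nat -> nat -> bool) (l1 l2 : list nat) :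
  length (flat_map (fun u => map (f u) l2) l1) = length l1 * length l2.
Proof. induction l1; simpl; auto. rewrite length_app, length_map. lia. Qed.

Lemma length_enc_network N :
  length (enc_network N) = node_pos N (length (nodes N)) + length (nodes N) * length (nodes N).
Proof.
  unfold enc_network, node_pos. rewrite !length_app, length_matrix, firstn_all. unfold enc_node. lia.
Qed.

(** * Correctness of the decision procedure *)

Section Correct.
Variables (N : network) (R : list rule).
Hypothesis Hwf : wf_network N.
Hypothesis Hmove : no_move R.

Definition inputlen : nat := length (encode N R).
Notation L := inputlen.
Definition codebound : nat := 2 ^ ((L + 2) * ((L + 2) * (L + 2))).
Notation M := codebound.
Notation n := (length (nodes N)).
Definition base : nat := 2 ^ (L + 2).

Definition globals (k : nat) : nat :=
  match k with
  | 0 => M | 1 => L | 2 => base | 3 => n | 4 => node_pos N n | 5 => length (enc_network N)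
  | _ => 0
  end.

Definition input_bits : nat -> nat -> bool := arr (reading L (encode N R) []).

Lemma at_input (A : nat -> nat -> bool) : A 0 = input_bits 0 -> at_pos A 0 (encode N R).
Proof.
  intros E k b Hk. rewrite E. unfold input_bits. simpl.
  assert (k < L) by (apply nth_error_Some; congruence).
  rewrite Nat.sub_0_r, (proj2 (Nat.ltb_lt k L)) by auto. simpl.
  apply nth_error_nth, Hk.
Qed.

Lemma length_parts : L = length (enc_network N) + length (enc_list enc_rule R).
Proof. unfold inputlen, encode. apply length_app. Qed.

Lemma nodes_le : n <= L.
Proof.
  rewrite length_parts. unfold enc_network. rewrite !length_app.
  assert (n <= length (flat_map (enc_node N) (nodes N))) as H.
  { apply length_flat_map_ge. intros x. simpl. lia. }
  unfold enc_node in H. lia.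
Qed.

Lemma pow_le_M a : a <= (L + 2) * ((L + 2) * (L + 2)) -> 2 ^ a <= M.
Proof. intros H. apply Nat.pow_le_mono_r; lia. Qed.

Lemma small_le_M : (L + 3) * (L + 3) <= M.
Proof.
  assert (L + 3 <= 2 ^ (L + 2)).
  { pose proof (Nat.pow_gt_lin_r 2 (L + 2)). lia. }
  eapply Nat.le_trans; [apply Nat.mul_le_mono; eassumption|].
  rewrite <- Nat.pow_add_r. apply pow_le_M. nia.
Qed.

(** The origin of the cube: [L + 2] bits per digit times at most the square of [L + 2] digits, which
    covers the [n + n + n * n] digits of a position. *)
Lemma base_pow_le_M k : k <= (L + 2) * (L + 2) -> base ^ k <= M.
Proof.
  intros H. unfold base. rewrite <- Nat.pow_mul_r. apply pow_le_M. nia.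
Qed.

Lemma length_lt_base : L < base.
Proof. unfold base. pose proof (Nat.pow_gt_lin_r 2 (L + 2)). lia. Qed.

Lemma enc_lt_base v : length (enc_nat v) <= L -> v < base.
Proof.
  intros H. pose proof (enc_nat_value_lt v).
  assert (2 ^ length (enc_nat v) <= base) by (apply Nat.pow_le_mono_r; lia). lia.
Qed.

Lemma two_lt_base : 2 < base.
Proof.
  unfold base. assert (2 ^ 2 <= 2 ^ (L + 2)) by (apply Nat.pow_le_mono_r; lia). simpl in *. lia.
Qed.

Lemma rule_length r : In r R -> length (enc_rule r) < L.
Proof.
  intros H. rewrite length_parts. unfold enc_list. rewrite length_app.
  pose proof (length_flat_map_in (fun r => true :: enc_rule r) _ _ H). simpl in *. lia.
Qed.

Lemma relabel_lt a b c d : In (Relabel a b c d) R -> c < base /\ d < base.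
Proof.
  intros H. apply rule_length in H. simpl in H. rewrite !length_app in H.
  split; apply enc_lt_base; lia.
Qed.

Lemma create_lt pp c sb : In (Create pp c sb) R ->
  length pp <= L /\ c < base /\ forall q, In q pp -> snd q < base.
Proof.
  intros H. apply rule_length in H. simpl in H. rewrite !length_app in H.
  fold enc_pair in H. pose proof (length_list_le enc_pair pp).
  split; [lia|split; [apply enc_lt_base; lia|]].
  intros q Hq. apply enc_lt_base. unfold enc_list in H. rewrite length_app in H.
  pose proof (length_flat_map_in (fun x => true :: enc_pair x) _ _ Hq) as Hl.
  simpl in Hl. unfold enc_pair in Hl at 1. rewrite length_app in Hl. lia.
Qed.

Lemma label_lt v : In v (nodes N) -> lab N v < base.
Proof.
  intros H. apply enc_lt_base. rewrite length_parts. unfold enc_network. rewrite !length_app.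
  pose proof (length_flat_map_in (enc_node N) _ _ H) as Hl. unfold enc_node in Hl. simpl in Hl. lia.
Qed.

Definition answer : Prop :=
  eval globals (Nat.iter M (round globals) input_bits) acceptE [] <> 0.

(** The final table is sound and closed under the step. An unmarked initial code gives safety by
    [unlost_safe]. Conversely an initial code exists because all labels fit into a digit, and in a
    safe game soundness forbids its mark. *)
Lemma answer_correct : answer <-> dynamically_safe N R.
Proof.
  pose proof nodes_le as Hn. pose proof small_le_M as HM. pose proof length_lt_base as HLB.
  pose proof two_lt_base as H2B.
  assert (HnM : base ^ n <= M) by (apply base_pow_le_M; nia).
  assert (HLM : base ^ L <= M) by (apply base_pow_le_M; nia).
  assert (HcM : base ^ (n + n + n * n) <= M) by (apply base_pow_le_M; nia).
  assert (H2L : 2 ^ L <= M) by (apply pow_le_M; nia).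
  assert (HRL : length R <= L).
  { rewrite length_parts. pose proof (length_list_le enc_rule R). lia. }
  assert (HnB : n < base) by lia.
  assert (HatN : forall A, A 0 = input_bits 0 -> at_pos A 0 (enc_network N)).
  { intros A E. apply at_input in E. unfold encode in E. apply at_app in E. apply E. }
  assert (HatR : forall A, A 0 = input_bits 0 -> at_pos A (globals 5) (enc_list enc_rule R)).
  { intros A E. apply at_input in E. unfold encode in E. apply at_app in E. apply E. }
  pose proof length_parts as HL.
  assert (Hlose : forall A x, A 0 = input_bits 0 -> x < M ->
    (eval globals A stepE [x] <> 0 <-> LoseStep n base M L R (A 1) x)).
  { intros A x E Hx.
    apply (@holds_lose globals A) with (R := R); simpl; auto; nia. }
  set (A := Nat.iter M (round globals) input_bits).
  assert (EA : A 0 = input_bits 0) by (apply iter_round_input; discriminate).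
  assert (Hacc : answer <-> exists x, x < M /\ InitRel n base N x /\ ~ A 1 x = true).
  { unfold answer. fold A.
    apply (@holds_accept globals A) with (N := N); simpl; auto; nia. }
  assert (Hsound : forall z, z < M -> A 1 z = true -> forall N', Codes n base N' z -> ~ safeD R N').
  { apply (@solved_sound globals (fun z => forall N', Codes n base N' z -> ~ safeD R N')).
    - intros A' x E Hx HA' Hev N' HC. apply Hlose in Hev; auto.
      apply (@lose_step_sound n base M L R) with (T := A' 1) (x := x);
        first [assumption|exact relabel_lt|exact create_lt].
    - intros z _ Hz. discriminate. }
  assert (Hclosed : forall x, x < M -> LoseStep n base M L R (A 1) x -> A 1 x = true).
  { intros x Hx Hstep. apply (@solved_closed globals); auto. apply Hlose; auto. }
  rewrite Hacc. split.
  - intros (x & Hx & Hi & Hax).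
    apply (@unlost_safe n base M L R) with (T := A 1) (x := x);
      first [assumption|exact relabel_lt|exact create_lt|apply init_codes; auto].
  - intros Hsafe.
    destruct (@init_exists n base M L R) with (N := N) as (x & Hx & Hi);
      first [assumption|exact label_lt|reflexivity|idtac].
    exists x. split; auto. split; auto. intros Hax.
    apply (Hsound x Hx Hax N); auto. apply init_codes; auto.
Qed.

(** * The complete program and its running time *)

Section Run.
Variable K : nat.
Hypothesis HK : 20 < K.
Hypothesis HK1 : 9 + need stepE + 2 < K.
Hypothesis HK2 : NG + need baseE + 2 < K.
Hypothesis HK3 : NG + need (natValE Zero) + 2 < K.
Hypothesis HK4 : NG + need (nodePosE gn) + 2 < K.
Hypothesis HK5 : NG + need (addE gP (mulE gn gn)) + 2 < K.
Hypothesis HK6 : NG + need acceptE + 2 < K.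

Definition globs_time (m : nat) : nat :=
  cost K m baseE + mac K m + (cost K m (natValE Zero) + mac K m +
  (cost K m (nodePosE gn) + mac K m + (cost K m (addE gP (mulE gn gn)) + mac K m))).

(** The globals below [j] are set; [partial 2], with [M] and the input length, is what [Grow] leaves
    behind. *)
Definition partial (j : nat) : mstate :=
  mkS (fun k => if k <? j then globals k else 0) input_bits [].

Lemma runs_glob j e : 1 < j -> j < NG -> NG + need e + 2 < K ->
  eval (reg (partial j)) input_bits e [] = globals j -> (forall k, globals k <= M) ->
  runs K L (SetGlob K j e) (partial j) (partial (S j)) (cost K M e + mac K M).
Proof.
  intros Hj Hj' Hn Hev Hle.
  assert (reg (partial j) 0 = M) as E0.
  { simpl. destruct (Nat.ltb_spec 0 j); [reflexivity|lia]. }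
  rewrite <- E0. eapply runs_eq; [apply runs_SetGlob; auto; try lia|].
  - simpl. rewrite Nat.ltb_irrefl. reflexivity.
  - rewrite E0. pose proof small_le_M. lia.
  - intros k Hk. simpl. destruct (Nat.ltb_spec k j); [unfold NG in *; lia|reflexivity].
  - intros k. rewrite E0. simpl. destruct (k <? j); [apply Hle|lia].
  - change (arr (partial j)) with input_bits. rewrite Hev.
    apply mstate_ext; [|reflexivity|reflexivity]. intros k. simpl. unfold upd.
    destruct (Nat.eqb_spec k j) as [->|].
    + destruct (Nat.ltb_spec j (S j)); [reflexivity|lia].
    + destruct (Nat.ltb_spec k j), (Nat.ltb_spec k (S j)); auto; lia.
Qed.

Lemma runs_SetGlobs : runs K L (SetGlobs K) (partial 2) (partial 6) (globs_time M).
Proof.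
  pose proof nodes_le as Hn. pose proof small_le_M as HM. pose proof length_parts as HL.
  assert (HatN : at_pos input_bits 0 (enc_network N)).
  { pose proof (@at_input input_bits eq_refl) as E. unfold encode in E. apply at_app in E. apply E. }
  pose proof (length_enc_network N) as HlN.
  assert (Hbase : base <= M) by (apply pow_le_M; nia).
  assert (Hle : forall k, globals k <= M).
  { intros k. do 6 (destruct k as [|k]; [simpl; nia|]). simpl. lia. }
  unfold SetGlobs, globs_time.
  eapply runs_seq; [apply runs_glob; auto; unfold NG; try lia| |apply Nat.le_refl].
  { unfold baseE.
    assert (forall G A, G 1 = L -> G 0 = M -> eval G A (Rec (Succ (Succ gL)) One (addE (Var 0) (Var 0))) [] = base) as H.
    { intros G A E1 E0. cbn [eval].
      change (nat_rect (fun _ => nat) (eval G A One [])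
        (fun k acc => eval G A (addE (Var 0) (Var 0)) [acc; k]) (eval G A (Succ (Succ gL)) []) = base).
      rewrite (@ev_Succ G A (Succ gL) [] (S L)); [|apply ev_Succ; [exact E1|nia]|nia].
      rewrite ev_One by lia. unfold base. replace (L + 2) with (S (S L)) by lia.
      assert (forall k, k <= S (S L) -> nat_rect (fun _ => nat) 1
        (fun k acc => eval G A (addE (Var 0) (Var 0)) [acc; k]) k = 2 ^ k) as Hk.
      { induction k; intros Hk; [reflexivity|]. cbn [nat_rect]. rewrite IHk by lia.
        assert (2 ^ S k <= M) as Hp by (apply pow_le_M; nia). simpl Nat.pow in Hp |- *.
        rewrite Nat.add_0_r in *. apply ev_add; try reflexivity. lia. }
      apply Hk. lia. }
    apply H; reflexivity. }
  eapply runs_seq; [apply runs_glob; auto; unfold NG; try lia| |apply Nat.le_refl].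
  { assert (at_pos input_bits 0 (enc_nat n)) as Hat0.
    { unfold enc_network in HatN. apply at_app in HatN. apply HatN. }
    change (globals 3) with n.
    apply (@ev_natVal (reg (partial 3)) input_bits) with (p := 0); auto.
    - simpl. nia.
    - change (0 + length (enc_nat n) <= L). rewrite HL. unfold enc_network.
      rewrite !length_app. lia.
    - change (n <= M). nia. }
  eapply runs_seq; [apply runs_glob; auto; unfold NG; try lia| |apply Nat.le_refl].
  { change (globals 4) with (node_pos N n).
    apply (@ev_nodePos (reg (partial 4)) input_bits); auto.
    - simpl. nia.
    - change (length (enc_network N) <= L). lia. }
  apply runs_glob; auto; unfold NG; try lia.
  change (globals 5) with (length (enc_network N)). rewrite HlN.
  apply ev_add; [reflexivity|apply ev_mul; try reflexivity|].
  - change (n * n <= M). nia.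
  - change (node_pos N n + n * n <= M). nia.
Qed.

Definition Main : tcmd :=
  Sq (Grow K) (Sq (SetGlobs K) (Sq (Solve K) (compile K acceptE [] NG))).

Definition main_time (m : nat) : nat :=
  grow_time K m + (globs_time m + (solve_time K (fun _ => m) + cost K m acceptE)).

Lemma runs_Main : runs K L Main (reading L (encode N R) [])
  (setreg (solving globals 0 0 0 (Nat.iter M (round globals) input_bits)) NG
     (eval globals (Nat.iter M (round globals) input_bits) acceptE [])) (main_time M).
Proof.
  pose proof nodes_le as Hn. pose proof small_le_M as HM. pose proof length_parts as HL.
  pose proof (length_enc_network N) as HlN.
  assert (Hbase : base <= M) by (apply pow_le_M; nia).
  assert (Hle : forall k, globals k <= M).
  { intros k. do 6 (destruct k as [|k]; [simpl; nia|]). simpl. lia. }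
  eapply runs_seq with (s2 := partial 2); [| |apply Nat.le_refl].
  { eapply runs_eq; [apply runs_Grow with (m := M); auto|].
    - simpl. unfold upd. simpl. lia.
    - intros k Hk. simpl. unfold upd. apply Nat.eqb_neq in Hk. rewrite Hk. reflexivity.
    - apply mstate_ext; [|reflexivity|reflexivity]. intros k. simpl. unfold upd.
      destruct k as [|[|k]]; simpl; auto. lia. }
  eapply runs_seq with (s2 := solving globals 0 0 0 input_bits); [| |apply Nat.le_refl].
  { eapply runs_eq; [apply runs_SetGlobs|].
    apply mstate_ext; [|reflexivity|reflexivity]. intros k. simpl.
    do 9 (destruct k as [|k]; [reflexivity|]). reflexivity. }
  eapply runs_seq; [apply (@runs_Solve K L HK globals); auto; simpl; nia| |apply Nat.le_refl].
  apply (@compile_ok K L globals); auto.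
  - simpl. nia.
  - intros k Hk. unfold NG in Hk. do 9 (destruct k as [|k]; [try lia; reflexivity|]). reflexivity.
  - intros k. do 9 (destruct k as [|k]; [simpl; apply (Hle 0) || apply Hle || lia|]). simpl. lia.
  - intros k Hk. simpl. apply Nat.ltb_lt in Hk. rewrite Hk. reflexivity.
Qed.

(** The final moves stop on the cell of register [NG] in column 0. In unary it is marked iff the
    value of [acceptE] is nonzero, and this cell decides acceptance. *)
Definition whole : tcmd := Sq (Sq (start_cmd K) (read_cmd K)) (Sq Main (goR (NG + 3))).

Definition total_time (m : nat) : nat :=
  (m + 2) * (6 * m + 40 + 2 * unit_time K m) + (main_time m + (NG + 4)).

Lemma exec_whole : exists f p t, exec whole (input_tape (encode N R)) 0 f p t /\
  t <= total_time M /\ (f p = Some true <-> answer).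
Proof.
  assert (encode N R <> []) as Hne.
  { unfold encode, enc_network, enc_nat. destruct (flat_map _ (bits_aux n n)); discriminate. }
  pose proof small_le_M as HM.
  destruct (@exec_input K L HK (encode N R) eq_refl Hne) as (f1 & t1 & E1 & Ht1 & HT1).
  destruct (runs_Main HT1) as (f2 & t2 & E2 & Ht2 & HT2).
  exists f2. do 2 eexists. split; [|split].
  - eapply ex_seq; [exact E1|]. eapply ex_seq; [exact E2|]. apply exec_goR.
  - unfold total_time.
    assert (L <= M) as HLM by nia. pose proof (unit_time_mono K HLM).
    assert ((L + 2) * (6 * L + 40 + 2 * unit_time K L) <=
            (M + 2) * (6 * M + 40 + 2 * unit_time K M)) by (apply Nat.mul_le_mono; lia).
    lia.
  - destruct HT2 as (_ & _ & HT2).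
    replace (pos K L 0 0 + (NG + 3)) with (pos K L 0 (S (NG + 2))) by (unfold pos; lia).
    rewrite HT2 by (unfold NG in *; lia). rewrite trk_reg. unfold answer.
    set (v := eval _ _ _ _).
    change (reg (setreg _ NG v) NG) with v.
    destruct v as [|v]; simpl; split; congruence.
Qed.
End Run.
End Correct.

(** Exceeds the register demand of every compiled expression and depends on no input, so one machine
    serves all instances. *)
Definition tracks : nat :=
  30 + need stepE + need baseE + need (natValE Zero) + need (nodePosE gn) +
  need (addE gP (mulE gn gn)) + need acceptE.

Theorem mainTheorem6 :
  exists (M : TM) (k : nat),
    forall (G : network) (R : list rule),
      wf_network G -> wf_rules R -> connected G -> no_move R ->
      exists ans : bool,
        (ans = true <-> dynamically_safe G R) /\
        tm_decides_within M (encode G R) (2 ^ ((length (encode G R) + 2) ^ k)) ans.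
Proof.
  (* The number of tracks is made opaque, so that no tactic computes it. *)
  assert (exists K, K = tracks) as [K HK] by eauto.
  assert (poly_bounded (fun m => S (total_time K m))) as [c Hc].
  { change (poly_bounded (fun m => 1 + total_time K m)).
    unfold total_time, main_time, globs_time.
    pose proof (pb_unit K). pose proof (pb_mac K). pose proof (pb_grow K). pose proof (pb_solve K).
    pose proof (pb_cost K baseE). pose proof (pb_cost K (natValE Zero)).
    pose proof (pb_cost K (nodePosE gn)). pose proof (pb_cost K (addE gP (mulE gn gn))).
    pose proof (pb_cost K acceptE). pb. }
  (* The running time is at most the power [c] of [M + 2]; [c + 4] is the exponent provided by
     [poly_exponential]. *)
  exists (machine (whole K)), (c + 4). intros G R Hwf _ _ Hmove.
  destruct (@exec_whole G R) with (K := K) as (f & p & t & HE & Ht & Hans);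
    try (rewrite HK; unfold tracks, NG; lia).
  exists (is_true_sym (f p)). split.
  { rewrite <- (answer_correct Hwf Hmove), <- Hans. destruct (f p) as [[|]|]; simpl; split; congruence. }
  destruct (@machine_decides (whole K) (encode G R) f p t (is_true_sym (f p)) HE)
    as (k & Hk & Hstate).
  { destruct (f p) as [[|]|]; simpl; split; congruence. }
  exists k. split; auto.
  pose proof (poly_exponential c (length (encode G R))) as Hp.
  specialize (Hc (codebound G R)). unfold codebound, inputlen in *. lia.
Qed.
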